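(* Let $n\ge1$, let $k\ge n+2$, and let $\kappa\in C^k(\mathbb R)$ be even, not identically zero, with $0\le\kappa\le1$ and $\mathrm{supp}(\kappa)\subseteq[-2,2]$. There are positive constants $C=C_{n,\kappa,k}$ and $c=c_{n,\kappa,k}$ such that for every infinitely differentiable spherical basis function $\phi$ on $\mathbb S^n$, every $1\le p\le\infty$, and every set of centers $X\subset\mathbb S^n$ with separation radius $q$ and mesh ratio $\rho$, the stability ratio of $\mathcal G=\mathcal G_{\phi,X}$ satisfies $$\mathsf r_{\mathcal G,p}\le C\,\rho^{n/p}\,\frac{q^{\,n(1/p'-1/2)}}{\hat\phi_{\min}(L_{cq/2})},\qquad L_{cq/2}=\lfloor 2/(cq)-\lambda_n\rfloor .$$
   Context: $\mathbb S^n$ is the unit sphere in $\mathbb R^{n+1}$ with its standard surface measure; $L^p=L^p(\mathbb S^n)$ with norm $\|\cdot\|_p$; $1/p+1/p'=1$; $\lambda_n=(n-1)/2$. $\mathcal H_\ell$ is the space of spherical harmonics of degree $\ell$ and $P_\ell(\xi\cdot\eta)$ the kernel of the orthogonal projection onto $\mathcal H_\ell$. A zonal function has the expansion $\phi(\xi\cdot\eta)=\sum_{\ell\ge0}\hat\phi(\ell)P_\ell(\xi\cdot\eta)$; it is a spherical basis function (SBF) if $\hat\phi(\ell)>0$ for all $\ell\ge 0$. $\hat\phi_{\min}(L)=\min_{0\le\ell\le L}\hat\phi(\ell)$. A set of centers $X$ is a finite set of (at least two) distinct points of $\mathbb S^n$; with $d$ the geodesic distance, $h_X=\sup_{y}\min_{\xi\in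 X}d(\xi,y)$, $q=q_X=\frac12\min_{\xi\ne\xi'}d(\xi,\xi')$, $\rho=h_X/q_X$. $\mathcal G_{\phi,X}=\mathrm{span}\{\phi((\cdot)\cdot\xi):\xi\in X\}$; each $g\in\mathcal G_{\phi,X}$ is uniquely $g(x)=\sum_{\xi\in X}a_\xi\phi(x\cdot\xi)$. With $|a|_p$ the $\ell^p$ norm of $(a_\xi)_{\xi\in X}$, the $p$-norm stability ratio is $\mathsf r_{\mathcal G,p}=\max_{0\ne g\in\mathcal G}|a|_p/\|g\|_p$. *)

(* Defs.v *)
From HB Require Import structures.
From mathcomp Require Import all_boot all_order all_algebra.
From mathcomp Require Import finmap.
From mathcomp Require Import all_classical all_reals all_analysis.
From mathcomp Require Import measurable_realfun.
(* A full import of [mpoly] would clash with notations of MathComp-Analysis. *)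
From mathcomp Require mpoly.
Import (canonicals, coercions) mpoly.

Set Implicit Arguments.
Unset Strict Implicit.
Unset Printing Implicit Defensive.
Import Order.TTheory GRing.Theory Num.Theory.
Import numFieldNormedType.Exports.

Local Open Scope classical_set_scope.
Local Open Scope ring_scope.

(* Points of R^k are [k.-tuple R], which carries the product sigma-algebra. *)

Section lebesgue_cons.
Context (R : realType) (k : nat).
Variable m : {sigma_finite_measure set (k.-tuple R) -> \bar R}.
Local Open Scope ereal_scope.

Definition tuple_cons (z : R * k.-tuple R) : k.+1.-tuple R :=
  [tuple of z.1 :: z.2].

Lemma measurable_tuple_cons : measurable_fun [set: R * k.-tuple R] tuple_cons.
Proof. exact: (measurable_cons measurable_fst measurable_snd). Qed.

Definition lebesgue_cons : set (k.+1.-tuple R) -> \bar R :=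
  pushforward (@lebesgue_measure R \x m) tuple_cons.

Let lebesgue_cons0 : lebesgue_cons set0 = 0.
Proof. by rewrite /lebesgue_cons /pushforward preimage_set0 measure0. Qed.

Let lebesgue_cons_ge0 A : 0 <= lebesgue_cons A.
Proof. exact: (measure_ge0 (@lebesgue_measure R \x m)%E). Qed.

Let lebesgue_cons_sigma_additive : semi_sigma_additive lebesgue_cons.
Proof.
move=> F mF tF mUF; rewrite /lebesgue_cons /pushforward preimage_bigcup.
have mc := measurable_tuple_cons.
apply: (@measure_semi_sigma_additive _ _ _ (@lebesgue_measure R \x m)).
- by move=> n; rewrite -[X in measurable X]setTI; exact: mc.
- apply/trivIsetP => /= i j _ _ ij; rewrite -preimage_setI.
  by move/trivIsetP : tF => /(_ _ _ _ _ ij) ->//; rewrite preimage_set0.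
- by rewrite -preimage_bigcup -[X in measurable X]setTI; exact: mc.
Qed.

HB.instance Definition _ := isMeasure.Build _ _ _ lebesgue_cons
  lebesgue_cons0 lebesgue_cons_ge0 lebesgue_cons_sigma_additive.

Let lebesgue_cons_sigma_finite : sigma_finite setT lebesgue_cons.
Proof.
have /sigma_finiteP[F [TF ndF Foo]] := sigma_finiteT (@lebesgue_measure R).
have /sigma_finiteP[G [TG ndG Goo]] := sigma_finiteT m.
pose u (t : k.+1.-tuple R) : measurableTypeR R * k.-tuple R :=
  (thead t, [tuple of behead t]).
have uK : cancel tuple_cons u.
  by move=> [x t]; rewrite /u theadE; congr pair; exact/val_inj.
have mu : measurable_fun [set: k.+1.-tuple R] u.
  apply: measurable_fun_pair; first exact: measurable_tnth.
  exact: measurable_behead.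
exists (fun n => u @^-1` (F n `*` G n)).
  rewrite -preimage_bigcup; apply/esym/seteqP; split=> // t _ /=.
  have [i _ Fi] : (\bigcup_i F i) (u t).1 by rewrite -TF.
  have [j _ Gj] : (\bigcup_i G i) (u t).2 by rewrite -TG.
  exists (maxn i j) => //; split.
    by move: (u t).1 Fi; exact/subsetPset/ndF/leq_maxl.
  by move: (u t).2 Gj; exact/subsetPset/ndG/leq_maxr.
move=> n; have [mF Fn] := Foo n; have [mG Gn] := Goo n; split.
  by rewrite -[X in measurable X]setTI; apply: mu => //; exact: measurableX.
rewrite /lebesgue_cons /pushforward -comp_preimage.
rewrite (_ : u \o tuple_cons = id); last exact/funext.
by rewrite preimage_id product_measure1E// lte_mul_pinfty// ge0_fin_numE.
Qed.

HB.instance Definition _ := Measure_isSigmaFinite.Build _ _ _ lebesgue_cons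
  lebesgue_cons_sigma_finite.

End lebesgue_cons.

Fixpoint lebesgue_tuple (R : realType) (k : nat) :
    {sigma_finite_measure set (k.-tuple R) -> \bar R} :=
  match k with
  | 0%N => \d_([tuple] : 0.-tuple R)
  | k'.+1 => lebesgue_cons (lebesgue_tuple R k')
  end.

Section euclidean.
Context (R : realType) (k : nat).
Implicit Types x y : k.-tuple R.

Definition dot x y : R := \sum_(i < k) tnth x i * tnth y i.

Definition enorm x : R := Num.sqrt (dot x x).

Definition normalize x : k.-tuple R := [tuple tnth x i / enorm x | i < k].

Definition sphere : set (k.-tuple R) := [set x | enorm x = 1].

Definition geodesic_dist x y : R := acos (dot x y).

(* The origin is excluded so that [normalize] is meaningful. *)
Definition punctured_ball : set (k.-tuple R) := [set x | 0 < enorm x <= 1].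

Lemma measurable_enorm : measurable_fun [set: k.-tuple R] enorm.
Proof.
have dot_ge0 x : 0 <= dot x x.
  by apply: sumr_ge0 => i _; rewrite -expr2 sqr_ge0.
rewrite (_ : enorm = (@powR R ^~ 2^-1) \o (fun x => dot x x)); last first.
  by apply/funext => x /=; rewrite powR12_sqrt.
apply: measurableT_comp; first exact: measurable_powR.
by apply: measurable_sum => i; apply: measurable_funM; exact: measurable_tnth.
Qed.

Lemma measurable_normalize : measurable_fun [set: k.-tuple R] normalize.
Proof.
apply/measurable_fun_tnthP => i.
rewrite (_ : _ \o _ = fun x => tnth x i * (enorm x) `^ (-1)); last first.
  apply/funext => x /=; rewrite /normalize tnth_mktuple powR_inv1//.
  exact: sqrtr_ge0.
apply: measurable_funM; first exact: measurable_tnth.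
apply: (@measurableT_comp _ _ _ _ _ _ (@powR R ^~ (-1))).
  exact: measurable_powR.
exact: measurable_enorm.
Qed.

Lemma measurable_punctured_ball : measurable punctured_ball.
Proof.
rewrite (_ : punctured_ball = enorm @^-1` `]0, 1]).
  by rewrite -[X in measurable X]setTI; exact: measurable_enorm.
by apply/seteqP; split => x /=; rewrite in_itv.
Qed.

End euclidean.

Arguments sphere {R k}.
Arguments normalize {R k}.
Arguments punctured_ball {R k}.

(* The surface measure of S^n, seen as a measure on R^(n+1) concentrated on the
   unit sphere: A has mass (n + 1) times the volume of the solid cone
   { r a | 0 < r <= 1, a in A } over A. *)
Section surface_measure.
Context (R : realType) (n : nat).
Local Open Scope ereal_scope.

Definition surface_measure (A : set (n.+1.-tuple R)) : \bar R :=
  n.+1%:R%:E *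
  lebesgue_tuple R n.+1 (normalize @^-1` A `&` punctured_ball).

Let nu : {measure set (n.+1.-tuple R) -> \bar R} := mscale (n.+1%:R%:nng : {nonneg R})%R
  (mrestr (lebesgue_tuple R n.+1) (@measurable_punctured_ball R n.+1)).

Let surface_measureE : surface_measure = pushforward nu normalize.
Proof. by []. Qed.

Let surface_measure0 : surface_measure set0 = 0.
Proof. by rewrite surface_measureE; exact: (measure0 nu). Qed.

Let surface_measure_ge0 A : 0 <= surface_measure A.
Proof. by rewrite surface_measureE; exact: (measure_ge0 nu). Qed.

Let surface_measure_sigma_additive : semi_sigma_additive surface_measure.
Proof.
rewrite surface_measureE => F mF tF mUF.
have mn := @measurable_normalize R n.+1.
rewrite /pushforward preimage_bigcup; apply: (@measure_semi_sigma_additive _ _ _ nu).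
- by move=> i; rewrite -[X in measurable X]setTI; exact: mn.
- apply/trivIsetP => /= i j _ _ ij; rewrite -preimage_setI.
  by move/trivIsetP : tF => /(_ _ _ _ _ ij) ->//; rewrite preimage_set0.
- by rewrite -preimage_bigcup -[X in measurable X]setTI; exact: mn.
Qed.

HB.instance Definition _ := isMeasure.Build _ _ _ surface_measure
  surface_measure0 surface_measure_ge0 surface_measure_sigma_additive.

End surface_measure.

Section spherical_harmonics.
Context (R : realType) (n : nat).
Let T := n.+1.-tuple R.
Let sigma : {measure set T -> \bar R} := @surface_measure R n.

Definition harmonic_mpoly (p : mpoly.mpoly n.+1 R) : Prop :=
  \sum_(i < n.+1) mpoly.mderiv i (mpoly.mderiv i p) = 0.

Definition spherical_harmonic (l : nat) (f : T -> R) : Prop :=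
  exists p : mpoly.mpoly n.+1 R,
    [/\ p \is mpoly.ishomog1 l mpoly.mdeg, harmonic_mpoly p &
        forall x, sphere x -> f x = mpoly.meval (tnth x) p].

Definition square_integrable (f : T -> R) : Prop :=
  measurable_fun sphere f /\
  sigma.-integrable sphere (fun x => (f x ^+ 2)%:E).

Definition is_orth_proj (l : nat) (f g : T -> R) : Prop :=
  spherical_harmonic l g /\
  forall h, spherical_harmonic l h ->
    \int[sigma]_(x in sphere) ((f x - g x) * h x) = 0.

(* An integral kernel is only determined almost everywhere by its operator;
   asking [K x] to be a spherical harmonic selects the smooth one, and makes
   [K] unique on the sphere. *)
Definition is_proj_kernel (l : nat) (K : T -> T -> R) : Prop :=
  (forall x, sphere x -> spherical_harmonic l (K x)) /\
  forall f, square_integrable f ->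
    is_orth_proj l f (fun x => \int[sigma]_(y in sphere) (K x y * f y)).

(* [proj_kernel l x y] is P_l(x . y). *)
Definition proj_kernel (l : nat) : T -> T -> R :=
  xget (fun _ _ => 0) [set K | is_proj_kernel l K].

Definition zonal_expansion (phi : R -> R) (phihat : nat -> R) : Prop :=
  forall x y : T, sphere x -> sphere y ->
    (fun N => \sum_(l < N) phihat l * proj_kernel l x y) @ \oo
      --> phi (dot x y).

Definition sbf (phi : R -> R) (phihat : nat -> R) : Prop :=
  zonal_expansion phi phihat /\ forall l, 0 < phihat l.

End spherical_harmonics.

Section smoothness.
Context (R : realType).

Definition Ck (k : nat) (f : R -> R) : Prop :=
  (forall j x, (j < k)%N -> derivable (derive1n j f) x 1) /\
  continuous (derive1n k f).

(* C^k on an open subset of R^m, by iterated partial derivatives. *)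
Fixpoint Ck_on (m k : nat) (U : set 'rV[R]_m.+1) (F : 'rV[R]_m.+1 -> R) : Prop :=
  {in U, continuous F} /\
  match k with
  | 0%N => True
  | k'.+1 => forall i : 'I_m.+1,
      (forall x, U x -> derivable F x (delta_mx 0 i)) /\
      Ck_on k' U ('D_(delta_mx 0 i) F)
  end.

(* Smooth functions on S^n are the restrictions of smooth functions defined on
   an open neighbourhood of the sphere. *)
Definition smooth_on_sphere (n : nat) (f : n.+1.-tuple R -> R) : Prop :=
  exists (U : set 'rV[R]_n.+1) (F : 'rV[R]_n.+1 -> R),
    [/\ open U, forall k, Ck_on k U F &
        forall x : n.+1.-tuple R, sphere x ->
          U (\row_i tnth x i) /\ F (\row_i tnth x i) = f x].

Definition smooth_zonal (n : nat) (phi : R -> R) : Prop :=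
  forall xi : n.+1.-tuple R, sphere xi ->
    smooth_on_sphere (fun x => phi (dot x xi)).

End smoothness.

Local Open Scope fset_scope.

Section centers.
Context (R : realType) (n : nat).
Let T := n.+1.-tuple R.
Let sigma : {measure set T -> \bar R} := @surface_measure R n.
Implicit Types (X : {fset T}) (p : \bar R).

Definition centers X : Prop := (2 <= #|` X|)%N /\ {in X, forall xi, sphere xi}.

Definition mesh_norm X : R :=
  sup [set inf [set geodesic_dist xi y | xi in [set` X]] | y in sphere].

Definition separation_radius X : R :=
  inf [set geodesic_dist z.1 z.2 | z in
        [set z : T * T | [/\ z.1 \in X, z.2 \in X & z.1 != z.2]]] / 2.

Definition mesh_ratio X : R := mesh_norm X / separation_radius X.

(* [expo_inv p] is 1/p, with 1/oo = 0. *)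
Definition expo_inv p : R := fine (p^-1)%E.

Definition lp_norm p X (a : T -> R) : R :=
  match p with
  | r%:E => (\sum_(xi <- X) `|a xi| `^ r) `^ r^-1
  | _ => \big[Num.max/0]_(xi <- X) `|a xi|
  end.

(* The Lp norm on the sphere; [\_] sets [g] to 0 off the sphere. *)
Definition Lp_norm p (g : T -> R) : \bar R :=
  ('N[sigma]_p[EFin \o (g \_ sphere)])%E.

Definition kernel_comb (phi : R -> R) X (a : T -> R) (x : T) : R :=
  \sum_(xi <- X) a xi * phi (dot x xi).

(* The elements of G_(phi,X) are given through their coefficients; only the
   values of [a] on [X] matter, and they are determined by g. *)
Definition stability_ratio p (phi : R -> R) X : \bar R :=
  ereal_sup [set ((lp_norm p X a)%:E / Lp_norm p (kernel_comb phi X a))%E | a in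
    [set a | exists x, sphere x /\ kernel_comb phi X a x != 0]].

End centers.

(* If [L] is negative the set is empty and [phihat_min] is 0; since x / 0 = 0 in
   R, an upper bound with [phihat_min] in the denominator then cannot hold for a
   positive quantity. *)
Definition phihat_min (R : realType) (phihat : nat -> R) (L : int) : R :=
  inf [set phihat l | l in [set l : nat | (l%:Z <= L)%R]].

Definition lambda_ (R : realType) (n : nat) : R := (n%:R - 1) / 2.

(* Main.v *)
(** Let [P_l] be the projection kernels and [K] the sum of the [P_l], [l <= L],
which reproduces the polynomials of degree at most [L] on the sphere.  Pair
[g = \sum a_xi phi(. xi)] with [F = \sum a_xi K(., xi)]: every Fourier
coefficient of [phi] up to [L] is at least [m := phihat_min L], hence
[m |F|_2^2 <= <g, F>].  This bounds [m |F|_2] by [|g|_2], and also by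
[sup_x K(x, x)^(1/2) |g|_1], where [K(x, x)] is constant by rotation invariance,
hence of order at most [L^n].

The coefficients are recovered from [F] by means of a polynomial kernel [M] of
degree at most [L] with [0 <= M <= 1] and [M(x, x) = 1], concentrated at the scale
[q]: it is a power of [\prod_j (1 + T_(2^j)(x . y)) / 2], with [T_i] the Chebyshev
polynomials.  With [h = \sum a_xi M(., xi)], packing bounds and Schur's test give
[|a|_2^2 / 2 <= \sum a_xi h(xi) = <F, h>] and [|h|_2^2 <= C q^n |a|_2^2], so that
[m |a|_2 <= C q^(n/2) |g|_2].

For [p >= 2] one concludes by [|a|_p <= |a|_2] and [|g|_2 <= C |g|_p]; for [p <= 2]
by the bound in terms of [|g|_1] and by Hoelder's inequality for [a], as [X] has at
most [C q^-n] points.  The mesh ratio only enters through [rho >= 1/4]. *)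

Require Import Defs.
From mathcomp Require Import all_boot all_order all_algebra.
From mathcomp Require Import finmap.
From mathcomp Require Import all_classical all_reals all_analysis.
From mathcomp Require Import measurable_realfun ess_sup_inf.
From mathcomp Require Import ring lra.
From mathcomp Require mpoly.
Import (canonicals, coercions) mpoly.

Set Implicit Arguments.
Unset Strict Implicit.
Unset Printing Implicit Defensive.
Import Order.TTheory GRing.Theory Num.Theory.
Import numFieldNormedType.Exports.
Local Open Scope classical_set_scope.
Local Open Scope ring_scope.

(** The surface measure is defined through solid cones, so integrals over the sphere are transported
    to the unit ball, where Tonelli's theorem, dilations and integration by parts along chords are
    enough. Rotations enter only through their generators [x_i d_j - x_j d_i]: the surface integral
    annihilates their images, which yields the orthogonality of distinct degrees and the constancy
    of [K(x, x)]. Two norms of [g] are needed to get the right power of [q] on both sides of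
    [p = 2]. For [p <= 2] the bound by [|g|_1] costs [L^(n/2)], which cancels the [q^(n/2)] gained
    from [h] because [L] is of order [1/q]; the cardinality factor [(q^-n)^(1/p - 1/2)] is then the
    only power of [q] left, and it is the announced one. For [p >= 2] the factor [q^(n/2)] is kept,
    and the part [q^(n/p)] of it is bounded by [2^n], since [q <= 2]. *)

Local Notation mpol k R := (mpoly.mpoly k R).
Local Notation mvar i := (mpoly.mpolyX _ (mpoly.mnm1 i)).
Local Notation mder := mpoly.mderiv.
Local Notation mhom m p := (p \is mpoly.ishomog1 m mpoly.mdeg).

(** * Lebesgue measure on tuples *)

Section lebesgue_tuple.
Context (R : realType).
Local Open Scope ereal_scope.
Local Notation mu := (@lebesgue_measure R).
Local Notation leb := (lebesgue_tuple R).

Lemma ge0_integral_tupleS k (f : k.+1.-tuple R -> \bar R) :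
  measurable_fun setT f -> (forall x, 0 <= f x) ->
  \int[leb k.+1]_x f x = \int[mu]_s \int[leb k]_t f (tuple_cons (s, t)).
Proof.
move=> mf f0.
rewrite [LHS](_ : _ = \int[pushforward (mu \x leb k) (@tuple_cons R k)]_x f x)//.
rewrite ge0_integral_pushforward//; last exact: measurable_tuple_cons.
rewrite preimage_setT fubini_tonelli1//.
  by apply: measurableT_comp => //; exact: measurable_tuple_cons.
by move=> z; exact: f0.
Qed.

Lemma ge0_integral_tupleSr k (f : k.+1.-tuple R -> \bar R) :
  measurable_fun setT f -> (forall x, 0 <= f x) ->
  \int[leb k.+1]_x f x = \int[leb k]_t \int[mu]_s f (tuple_cons (s, t)).
Proof.
move=> mf f0.
rewrite [LHS](_ : _ = \int[pushforward (mu \x leb k) (@tuple_cons R k)]_x f x)//.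
rewrite ge0_integral_pushforward//; last exact: measurable_tuple_cons.
rewrite preimage_setT fubini_tonelli2//.
  by apply: measurableT_comp => //; exact: measurable_tuple_cons.
by move=> z; exact: f0.
Qed.

(** The pushforward of Lebesgue measure under the dilation, multiplied by [r], agrees with Lebesgue
    measure on half-open intervals, hence everywhere. *)
Lemma ge0_integral_scale (r : R) (f : R -> \bar R) : (0 < r)%R ->
  measurable_fun setT f -> (forall x, 0 <= f x) ->
  \int[mu]_x f (r * x)%R = r^-1%:E * \int[mu]_x f x.
Proof.
move=> r0 mf f0.
have mr : measurable_fun setT ( *%R r : measurableTypeR R -> measurableTypeR R).
  exact: measurable_funM.
have r1 : (0 <= r)%R by exact: ltW.
pose m := mscale (NngNum r1) (pushforward mu ( *%R r : measurableTypeR R -> measurableTypeR R)).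
have mE A : measurable A -> m mr A = mu A.
  move=> mA; apply/esym/(@lebesgue_measure_unique _ (m mr)) => //= _ [[a b]] _ <-.
  rewrite /m /mscale/= /pushforward.
  rewrite (_ : _ @^-1` _ = `](a / r)%R, (b / r)%R]%classic); last first.
    by apply/seteqP; split => x /=; rewrite !in_itv/= ltr_pdivrMr// ler_pdivlMr// ![(x * _)%R]mulrC.
  rewrite !lebesgue_measure_itv/= !lte_fin ltr_pM2r ?invr_gt0//.
  case: ifPn => ab; last by rewrite mule0.
  by rewrite -EFinB -EFinM -mulrBl mulrCA divff ?mulr1// gt_eqF.
transitivity (\int[pushforward mu ( *%R r : measurableTypeR R -> measurableTypeR R)]_x f x).
  by rewrite ge0_integral_pushforward.
have -> : \int[mu]_x f x = \int[m mr]_x f x.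
  by apply: eq_measure_integral => A mA _; apply/esym; exact: mE.
rewrite /m ge0_integral_mscale// muleA -EFinM mulVf ?mul1e//.
by rewrite gt_eqF.
Qed.

Definition tscale k (r : R) (x : k.-tuple R) : k.-tuple R :=
  [tuple (r * tnth x i)%R | i < k].

Definition tupd k (x : k.-tuple R) (i : 'I_k) (s : R) : k.-tuple R :=
  [tuple if j == i then s else tnth x j | j < k].

Lemma tnth_tuple_cons0 k (z : R * k.-tuple R) : tnth (tuple_cons z) ord0 = z.1.
Proof. exact: tnth0. Qed.

Lemma tnth_tuple_consS k (z : R * k.-tuple R) i :
  tnth (tuple_cons z) (lift ord0 i) = tnth z.2 i.
Proof. exact: tnthS. Qed.

Lemma tuple_consP k (x : k.+1.-tuple R) : exists z, x = tuple_cons z.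
Proof. by case/tupleP: x => s t; exists (s, t); apply: val_inj. Qed.

Lemma tscale_cons k r (z : R * k.-tuple R) :
  tscale r (tuple_cons z) = tuple_cons (r * z.1, tscale r z.2)%R.
Proof.
apply: eq_from_tnth => i; rewrite tnth_mktuple.
have [j ->|->] := unliftP ord0 i; first by rewrite !tnth_tuple_consS tnth_mktuple.
by rewrite !tnth_tuple_cons0.
Qed.

Lemma tupd_cons0 k (z : R * k.-tuple R) s :
  tupd (tuple_cons z) ord0 s = tuple_cons (s, z.2).
Proof.
apply: eq_from_tnth => i; rewrite tnth_mktuple.
have [j ->|->] := unliftP ord0 i; first by rewrite !tnth_tuple_consS.
by rewrite !tnth_tuple_cons0.
Qed.

Lemma tupd_consS k (z : R * k.-tuple R) i s :
  tupd (tuple_cons z) (lift ord0 i) s = tuple_cons (z.1, tupd z.2 i s).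
Proof.
apply: eq_from_tnth => l; rewrite tnth_mktuple.
have [j ->|->] := unliftP ord0 l; last by rewrite !tnth_tuple_cons0.
by rewrite !tnth_tuple_consS tnth_mktuple (inj_eq (@lift_inj _ _)).
Qed.

Lemma measurable_tscale k (r : R) : measurable_fun [set: k.-tuple R] (tscale r).
Proof.
apply/measurable_fun_tnthP => i.
rewrite (_ : _ \o _ = fun x => (r * tnth x i)%R); last first.
  by apply/funext => x /=; rewrite tnth_mktuple.
by apply: measurable_funM => //; exact: measurable_tnth.
Qed.

Lemma measurable_tuple_consl k (s : R) :
  measurable_fun [set: k.-tuple R] (fun t => tuple_cons (s, t)).
Proof.
apply: (@measurableT_comp _ _ _ _ _ _ _ _ (fun t => (s, t))).
  exact: measurable_tuple_cons.
exact: measurable_pair1.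
Qed.

Lemma ge0_integral_tscale k (r : R) (f : k.-tuple R -> \bar R) : (0 < r)%R ->
  measurable_fun setT f -> (forall x, 0 <= f x) ->
  \int[leb k]_x f (tscale r x) = (r^-1 ^+ k)%R%:E * \int[leb k]_x f x.
Proof.
move=> r0; elim: k f => [|k IH] f mf f0.
  rewrite expr0 mul1e /=; apply: eq_integral => x _.
  have -> : tscale r x = x by apply: eq_from_tnth => -[].
  by [].
rewrite [LHS]ge0_integral_tupleS//; last first.
  by apply: measurableT_comp => //; exact: measurable_tscale.
rewrite [X in _ = _ * X]ge0_integral_tupleS//.
pose F s := \int[leb k]_t f (tuple_cons (s, t)).
have F0 s : 0 <= F s by exact: integral_ge0.
have mF : measurable_fun setT F.
  apply: (@measurable_fun_fubini_tonelli_F _ _ _ _ _ _ (f \o @tuple_cons R k)) => //.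
    by apply: measurableT_comp => //; exact: measurable_tuple_cons.
  by move=> x; exact: f0.
transitivity (\int[mu]_s ((r^-1 ^+ k)%R%:E * F (r * s)%R)).
  apply: eq_integral => s _.
  under eq_integral do rewrite tscale_cons/=.
  apply: (IH (fun t => f (tuple_cons ((r * s)%R, t)))) => //.
  by apply: measurableT_comp => //; exact: measurable_tuple_consl.
rewrite ge0_integralZl//.
- by rewrite ge0_integral_scale// muleA -EFinM -exprSr.
- by apply: (@measurableT_comp _ _ _ _ _ _ F) => //; exact: measurable_funM.
- by rewrite lee_fin exprn_ge0// invr_ge0 ltW.
Qed.

(** The form of Fubini used for integration by parts, where a single coordinate moves. The induction
    is on the position of [i]: the head coordinate is integrated last when [i] lies in the tail,
    first when [i] is the head. *)
Lemma ge0_integral_slices k (i : 'I_k) (f g : k.-tuple R -> \bar R) :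
  measurable_fun setT f -> (forall x, 0 <= f x) ->
  measurable_fun setT g -> (forall x, 0 <= g x) ->
  (forall z, \int[mu]_s f (tupd z i s) = \int[mu]_s g (tupd z i s)) ->
  \int[leb k]_x f x = \int[leb k]_x g x.
Proof.
elim: k i f g => [[]//|k IH] i f g mf f0 mg g0 fg.
have [j ij|i0] := unliftP ord0 i.
  rewrite !ge0_integral_tupleS//; apply: eq_integral => s _.
  apply: (IH j) => //.
  - by apply: measurableT_comp => //; exact: measurable_tuple_consl.
  - by apply: measurableT_comp => //; exact: measurable_tuple_consl.
  - move=> z; have := fg (tuple_cons (s, z)); rewrite ij.
    by under eq_integral do rewrite tupd_consS/=; under [in RHS]eq_integral do rewrite tupd_consS/=.
rewrite !ge0_integral_tupleSr//; apply: eq_integral => t _.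
have := fg (tuple_cons (0%R, t)); rewrite i0.
by under eq_integral do rewrite tupd_cons0/=; under [in RHS]eq_integral do rewrite tupd_cons0/=.
Qed.

(** Closed balls of the sup norm stand in for spherical caps throughout, because their volume is a
    product. *)
Definition cube k (c : k.-tuple R) (e : R) : set (k.-tuple R) :=
  [set x | forall i, (`|tnth x i - tnth c i| <= e)%R].

Lemma measurable_cube k (c : k.-tuple R) (e : R) : measurable (cube c e).
Proof.
rewrite (_ : cube c e = \bigcap_(i in [set: 'I_k])
    (fun x => (tnth x i : R)) @^-1` `[(tnth c i - e)%R, (tnth c i + e)%R]); last first.
  apply/seteqP; split=> [x H i _/=|x H i]; last have := H i I.
    by have := H i; rewrite in_itv/= ler_distl.
  by rewrite /= in_itv/= ler_distl.
apply: fin_bigcap_measurable; first exact: finite_finset.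
move=> i _; rewrite -[X in measurable X]setTI; apply: measurable_tnth => //.
Qed.

Lemma lebesgue_cube k (c : k.-tuple R) (e : R) : (0 <= e)%R ->
  leb k (cube c e) = ((2 * e) ^+ k)%R%:E.
Proof.
move=> e0; elim: k c => [|k IH] c.
  rewrite expr0/= diracE mem_set//= => -[]//.
have [[c0 c'] cE] := tuple_consP c.
rewrite [LHS](_ : _ = (mu \x leb k)%E (@tuple_cons R k @^-1` cube c e))//.
rewrite (_ : _ @^-1` _ = `[(c0 - e)%R, (c0 + e)%R] `*` cube c' e); last first.
  apply/seteqP; split=> [[s t] /= H|[s t] /= [H1 H2] i].
    split; first by have := H ord0; rewrite cE !tnth_tuple_cons0/= in_itv/= ler_distl.
    by move=> i; have := H (lift ord0 i); rewrite cE !tnth_tuple_consS.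
  have [j ->|->] := unliftP ord0 i; first by rewrite cE !tnth_tuple_consS; exact: H2.
  by move: H1; rewrite cE !tnth_tuple_cons0/= in_itv/= ler_distl.
rewrite product_measure1E//; last exact: measurable_cube.
rewrite [X in _ * X](IH c') exprS EFinM; congr (_ * _).
rewrite [LHS](_ : _ = mu `[(c0 - e)%R, (c0 + e)%R]%classic)// lebesgue_measure_itv/= lte_fin.
have [e1|e1] := ltP (c0 - e)%R (c0 + e)%R; first by rewrite -EFinB; congr EFin; ring.
have e2 : e = 0%R by lra.
by rewrite e2 mulr0.
Qed.

End lebesgue_tuple.

(** * Bounded measurable functions on a set of finite measure *)

Section bounded_measurable.
Context d (X : measurableType d) (R : realType) (mu : {measure set X -> \bar R}).
Variables (D : set X) (mD : measurable D) (Doo : (mu D < +oo)%E).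
Implicit Types f g : X -> R.

(** A class closed under ring operations on which the real-valued integral is linear, so that no
    separate integrability conditions arise. *)
Definition bmfun f := measurable_fun D f /\ exists M : R, forall x, D x -> `|f x| <= M.

Lemma bmfun_cst c : bmfun (cst c).
Proof. by split; [exact: measurable_cst|exists `|c| => x _]. Qed.

Lemma bmfunD f g : bmfun f -> bmfun g -> bmfun (fun x => f x + g x).
Proof.
move=> [mf [M fM]] [mg [N gN]]; split; first exact: measurable_funD.
by exists (M + N) => x Dx; rewrite (le_trans (ler_normD _ _))// lerD ?fM ?gN.
Qed.

Lemma bmfunM f g : bmfun f -> bmfun g -> bmfun (fun x => f x * g x).
Proof.
move=> [mf [M fM]] [mg [N gN]]; split; first exact: measurable_funM.
by exists (M * N) => x Dx; rewrite normrM ler_pM ?fM ?gN.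
Qed.

Lemma bmfunZ c f : bmfun f -> bmfun (fun x => c * f x).
Proof. by move=> bf; apply: bmfunM => //; exact: bmfun_cst. Qed.

Lemma bmfunN f : bmfun f -> bmfun (fun x => - f x).
Proof.
move=> /(bmfunZ (-1)); rewrite (_ : (fun x => -1 * f x) = (fun x => - f x))//.
by apply/funext => x; rewrite mulN1r.
Qed.

Lemma bmfunB f g : bmfun f -> bmfun g -> bmfun (fun x => f x - g x).
Proof. by move=> bf bg; apply: bmfunD => //; exact: bmfunN. Qed.

Lemma eq_bmfun f g : (forall x, D x -> f x = g x) -> bmfun f -> bmfun g.
Proof.
move=> fg [mf [M fM]]; split; last by exists M => x Dx; rewrite -fg// fM.
by apply: eq_measurable_fun mf => x; rewrite inE => /fg.
Qed.

Lemma bmfunX f m : bmfun f -> bmfun (fun x => f x ^+ m).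
Proof.
move=> bf; elim: m => [|m IH]; first exact: bmfun_cst.
by apply: (eq_bmfun (f := fun x => f x * f x ^+ m)) => [x _|]; rewrite ?exprS//; exact: bmfunM.
Qed.

Lemma bmfun_sum (I : Type) (s : seq I) (P : pred I) (F : I -> X -> R) :
  (forall i, P i -> bmfun (F i)) -> bmfun (fun x => \sum_(i <- s | P i) F i x).
Proof.
move=> bF; elim: s => [|i s IH].
  by apply: (eq_bmfun (f := cst 0)) => [x _|]; rewrite ?big_nil//; exact: bmfun_cst.
have [Pi|Pi] := boolP (P i).
  apply: (eq_bmfun (f := fun x => F i x + \sum_(j <- s | P j) F j x)) => [x _|].
    by rewrite big_cons Pi.
  by apply: bmfunD => //; exact: bF.
by apply: eq_bmfun IH => x _; rewrite big_cons (negbTE Pi).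
Qed.

Lemma bmfun_norm f : bmfun f -> bmfun (fun x => `|f x|).
Proof.
move=> [mf [M fM]]; split; first exact: measurableT_comp.
by exists M => x Dx; rewrite normr_id fM.
Qed.

Lemma bmfun_integrable f : bmfun f -> mu.-integrable D (EFin \o f).
Proof.
move=> [mf [M fM]]; apply: measurable_bounded_integrable => //.
by exists M; split; rewrite ?num_real// => N /ltW MN x Dx; exact: le_trans (fM _ Dx) MN.
Qed.

Local Notation rint f := (\int[mu]_(x in D) f x).

Lemma rintD f g : bmfun f -> bmfun g ->
  rint (fun x => f x + g x) = rint f + rint g.
Proof. by move=> bf bg; rewrite RintegralD//; exact: bmfun_integrable. Qed.

Lemma rintZ c f : bmfun f -> rint (fun x => c * f x) = c * rint f.
Proof. by move=> bf; rewrite RintegralZl//; exact: bmfun_integrable. Qed.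

Lemma rintB f g : bmfun f -> bmfun g ->
  rint (fun x => f x - g x) = rint f - rint g.
Proof. by move=> bf bg; rewrite RintegralB//; exact: bmfun_integrable. Qed.

Lemma eq_rint f g : (forall x, D x -> f x = g x) -> rint f = rint g.
Proof. by move=> fg; apply: eq_Rintegral => x; rewrite inE => /fg. Qed.

Lemma rint_cst c : rint (cst c) = c * fine (mu D).
Proof. by rewrite Rintegral_cst. Qed.

Lemma le_rint f g : bmfun f -> bmfun g -> (forall x, D x -> f x <= g x) ->
  rint f <= rint g.
Proof. by move=> bf bg fg; apply: le_Rintegral => //; exact: bmfun_integrable. Qed.

Lemma rint_ge0 f : (forall x, D x -> 0 <= f x) -> 0 <= rint f.
Proof. exact: Rintegral_ge0. Qed.

Lemma rint_sum (I : Type) (s : seq I) (P : pred I) (F : I -> X -> R) :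
  (forall i, P i -> bmfun (F i)) ->
  rint (fun x => \sum_(i <- s | P i) F i x) = \sum_(i <- s | P i) rint (F i).
Proof.
move=> bF; elim: s => [|i s IH].
  rewrite big_nil; under eq_Rintegral do rewrite big_nil.
  by rewrite (rint_cst 0) mul0r.
rewrite big_cons; under eq_Rintegral do rewrite big_cons; case: ifPn => // Pi.
by rewrite rintD ?IH//; [exact: bF|exact: bmfun_sum].
Qed.

Lemma fine_integral f : bmfun f -> (forall x, D x -> 0 <= f x) ->
  (\int[mu]_(x in D) (f x)%:E)%E = (rint f)%:E.
Proof.
by move=> bf f0; rewrite /Rintegral fineK//; apply: integrable_fin_num => //; exact: bmfun_integrable.
Qed.

Lemma rint_CS f g : bmfun f -> bmfun g ->
  rint (fun x => f x * g x) ^+ 2 <=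
  rint (fun x => f x ^+ 2) * rint (fun x => g x ^+ 2).
Proof.
move=> bf bg.
set a := rint (fun x => f x ^+ 2); set b := rint (fun x => f x * g x).
set c := rint (fun x => g x ^+ 2).
have q t : 0 <= a + t * (2 * b) + t ^+ 2 * c.
  have bff := bmfunX 2 bf; have bgg := bmfunZ (t ^+ 2) (bmfunX 2 bg).
  have bfg := bmfunM bf bg; have bfg2 := bmfunZ t (bmfunZ 2 bfg).
  rewrite /a /b /c -(rintZ 2 bfg) -(rintZ t (bmfunZ 2 bfg)) -(rintZ (t ^+ 2) (bmfunX 2 bg)).
  rewrite -(rintD bff bfg2) -(rintD (bmfunD bff bfg2) bgg).
  apply: rint_ge0 => x _.
  by rewrite (_ : _ + _ = (f x + t * g x) ^+ 2) ?sqr_ge0//; ring.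
have a0 : 0 <= a by apply: rint_ge0 => x _; exact: sqr_ge0.
have c0 : 0 <= c by apply: rint_ge0 => x _; exact: sqr_ge0.
(* If [c] is 0 the quadratic is affine in [t]; a nonzero slope would allow the value -1, reached at
   [t = - (a + 1) / (2 b)]. Otherwise its minimum, at [t = - b / c], is nonnegative. *)
have [c00|c1] := eqVneq c 0.
  have [->|b0] := eqVneq b 0; first by rewrite expr0n/= mulr_ge0.
  have := q (- (a + 1) / (2 * b)); rewrite c00 mulr0 addr0 divfK ?mulf_neq0//; lra.
have cp : 0 < c by rewrite lt_def c1.
have := q (- b / c); rewrite -(pmulr_rge0 _ cp).
rewrite (_ : c * _ = a * c - b ^+ 2) ?subr_ge0//; field; exact: c1.
Qed.

End bounded_measurable.

(** * Euclidean geometry of the sphere *)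

Section euclidean_facts.
Context (R : realType) (k : nat).
Implicit Types x y : k.-tuple R.

Lemma dotC x y : dot x y = dot y x.
Proof. by apply: eq_bigr => i _; rewrite mulrC. Qed.

Lemma dot_ge0 x : 0 <= dot x x.
Proof. by apply: sumr_ge0 => i _; rewrite -expr2 sqr_ge0. Qed.

Lemma enorm_ge0 x : 0 <= enorm x.
Proof. exact: sqrtr_ge0. Qed.

Lemma sqr_enorm x : enorm x ^+ 2 = dot x x.
Proof. by rewrite sqr_sqrtr// dot_ge0. Qed.

Lemma sphereP x : sphere x <-> dot x x = 1.
Proof.
rewrite -sqr_enorm; split => [/= ->|/eqP]; first by rewrite expr1n.
by rewrite sqrf_eq1 => /orP[/eqP//|/eqP xN1]; have := enorm_ge0 x; rewrite xN1 ler0N1.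
Qed.

Lemma normr_tnth_le x i : `|tnth x i| <= enorm x.
Proof.
rewrite -(@ler_pXn2r _ 2) ?nnegrE ?enorm_ge0// sqr_enorm real_normK ?num_real//.
rewrite /dot (bigD1 i)//= expr2 lerDl; apply: sumr_ge0 => j _.
by rewrite -expr2 sqr_ge0.
Qed.

Lemma sphere_tnth_le1 x i : sphere x -> `|tnth x i| <= 1.
Proof. by move=> <-; exact: normr_tnth_le. Qed.

Lemma dot_tscalel r x y : dot (tscale r x) y = r * dot x y.
Proof. by rewrite /dot mulr_sumr; apply: eq_bigr => i _; rewrite tnth_mktuple mulrA. Qed.

Lemma dot_tscaler r x y : dot x (tscale r y) = r * dot x y.
Proof. by rewrite dotC dot_tscalel dotC. Qed.

Lemma enorm_tscale r x : 0 <= r -> enorm (tscale r x) = r * enorm x.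
Proof.
move=> r0; rewrite /enorm dot_tscalel dot_tscaler mulrA -expr2 sqrtrM ?sqr_ge0//.
by rewrite sqrtr_sqr ger0_norm.
Qed.

Lemma normalizeE x : normalize x = tscale (enorm x)^-1 x.
Proof. by apply: eq_from_tnth => i; rewrite !tnth_mktuple mulrC. Qed.

Lemma sphere_normalize x : 0 < enorm x -> sphere (normalize x).
Proof.
move=> x0; rewrite /sphere /= normalizeE enorm_tscale ?invr_ge0 ?(ltW x0)//.
by rewrite mulVf// gt_eqF.
Qed.

Lemma tscaleA r s x : tscale r (tscale s x) = tscale (r * s) x.
Proof. by apply: eq_from_tnth => i; rewrite !tnth_mktuple mulrA. Qed.

Lemma tscale1 x : tscale 1 x = x.
Proof. by apply: eq_from_tnth => i; rewrite !tnth_mktuple mul1r. Qed.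

Lemma normalize_tscale r x : 0 < r -> normalize (tscale r x) = normalize x.
Proof.
move=> r0; rewrite !normalizeE enorm_tscale ?(ltW r0)// tscaleA invfM mulrAC mulVf ?mul1r//.
by rewrite gt_eqF.
Qed.

Lemma tscale_normalize x : 0 < enorm x -> tscale (enorm x) (normalize x) = x.
Proof. by move=> x0; rewrite normalizeE tscaleA divff ?gt_eqF// tscale1. Qed.

Lemma normalize_sphere x : sphere x -> normalize x = x.
Proof. by move=> x1; rewrite normalizeE x1 invr1 tscale1. Qed.

Lemma measurable_sphere : measurable (@sphere R k).
Proof.
rewrite (_ : sphere = (@enorm R k) @^-1` [set 1])//.
rewrite -[X in measurable X]setTI; apply: measurable_enorm => //.
Qed.

Lemma sqdist_sphere x y : sphere x -> sphere y ->
  \sum_(i < k) (tnth x i - tnth y i) ^+ 2 = 2 - 2 * dot x y.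
Proof.
move=> /sphereP x1 /sphereP y1.
transitivity (dot x x + dot y y - 2 * dot x y); last by rewrite x1 y1; ring.
rewrite /dot mulr_sumr -sumrN -!big_split/=; apply: eq_bigr => i _; ring.
Qed.

Lemma sphere_dot_le1 x y : sphere x -> sphere y -> `|dot x y| <= 1.
Proof.
move=> xS yS; have h1 : 0 <= 2 - 2 * dot x y.
  by rewrite -sqdist_sphere//; apply: sumr_ge0 => i _; exact: sqr_ge0.
have h2 : 0 <= dot x x + dot y y + 2 * dot x y.
  have -> : dot x x + dot y y + 2 * dot x y = \sum_(i < k) (tnth x i + tnth y i) ^+ 2.
    by rewrite /dot mulr_sumr -!big_split/=; apply: eq_bigr => i _; ring.
  by apply: sumr_ge0 => i _; exact: sqr_ge0.
move: xS yS h2 => /sphereP -> /sphereP -> h2.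
rewrite ler_norml; apply/andP; split; lra.
Qed.

Lemma sphere_far_cube x y r : 0 <= r -> sphere x -> sphere y -> ~ cube x r y ->
  r ^+ 2 < 2 - 2 * dot x y.
Proof.
move=> r0 xS yS /existsNP[i /negP]; rewrite -ltNge => yi.
rewrite -sqdist_sphere// (bigD1 i)//=.
apply: (@lt_le_trans _ _ ((tnth x i - tnth y i) ^+ 2)).
  by rewrite -[ltRHS]real_normK ?num_real// distrC ltrXn2r// nnegrE.
by rewrite lerDl; apply: sumr_ge0 => j _; exact: sqr_ge0.
Qed.

End euclidean_facts.

Lemma ge0_integral_mrestr d (X : measurableType d) (R : realType)
    (mu : {measure set X -> \bar R}) (D : set X) (mD : measurable D) (f : X -> \bar R) :
  measurable_fun setT f -> (forall x, (0 <= f x)%E) ->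
  (\int[mrestr mu mD]_x f x = \int[mu]_(x in D) f x)%E.
Proof.
move=> mf f0; have mDc := measurableC mD.
have dD : [disjoint ~` D & D] by apply/disj_set2P; rewrite setICl.
rewrite -(setvU D) ge0_integral_setU ?setvU//.
rewrite [X in (X + _)%E](_ : _ = 0%E) ?add0e; last first.
  rewrite (@eq_measure_integral _ _ _ _ mzero) ?integral_measure_zero// => A mA AD.
  have AD0 : A `&` D = set0 by rewrite -subset0 => x [/AD].
  by rewrite [LHS](_ : _ = mu (A `&` D))// AD0 measure0.
rewrite (@eq_measure_integral _ _ _ _ mu)// => A mA AD.
by rewrite [LHS](_ : _ = mu (A `&` D))// setIidl.
Qed.

(** * The surface measure *)

Section surface.
Context (R : realType) (n : nat).
Local Notation T := (n.+1.-tuple R).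
Local Notation sigma := (@surface_measure R n).
Local Notation leb := (lebesgue_tuple R n.+1).

Let mS : measurable (@sphere R n.+1) := @measurable_sphere R n.+1.
Let mB : measurable (@punctured_ball R n.+1) := @measurable_punctured_ball R n.+1.

Lemma ge0_integral_surface (f : T -> \bar R) :
  measurable_fun sphere f -> (forall x, sphere x -> (0 <= f x)%E) ->
  (\int[sigma]_(x in sphere) f x =
   n.+1%:R%:E * \int[leb]_(z in punctured_ball) f (normalize z))%E.
Proof.
move=> mf f0; rewrite integral_mkcond.
have mf' : measurable_fun setT (f \_ sphere) by exact/(measurable_restrictT _ mS).
have f0' x : (0 <= (f \_ sphere) x)%E.
  by rewrite patchE; case: ifPn => //; rewrite inE => /f0.
pose nu : {measure set T -> \bar R} := mscale (NngNum (ler0n R n.+1)) (mrestr leb mB).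
transitivity (\int[pushforward nu normalize]_x (f \_ sphere) x)%E; first by [].
rewrite ge0_integral_pushforward//; last exact: measurable_normalize.
have mfn : measurable_fun setT ((f \_ sphere) \o normalize).
  by apply: measurableT_comp => //; exact: measurable_normalize.
rewrite preimage_setT /nu ge0_integral_mscale//=.
congr (_ * _)%E; rewrite ge0_integral_mrestr//=.
apply: eq_integral => z; rewrite inE => -/andP[z0 _] /=.
by rewrite patchE mem_set//; exact: sphere_normalize.
Qed.

Lemma punctured_ball_cube : (@punctured_ball R n.+1) `<=` cube [tuple 0 | i < n.+1] 1.
Proof. by move=> x /andP[_ x1] i; rewrite tnth_mktuple subr0 (le_trans (normr_tnth_le _ _)). Qed.

Lemma lebesgue_punctured_ball : (leb punctured_ball < +oo)%E.
Proof.
rewrite (@le_lt_trans _ _ (leb (cube [tuple 0 | i < n.+1] 1)))//.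
  by rewrite le_measure ?inE//; [exact: measurable_cube|exact: punctured_ball_cube].
by rewrite [X in (X < _)%E]lebesgue_cube// ltry.
Qed.

Lemma surface_sphere_lty : (sigma sphere < +oo)%E.
Proof.
rewrite /surface_measure lte_mul_pinfty// ?lee_fin//.
apply: (le_lt_trans _ lebesgue_punctured_ball); rewrite le_measure ?inE//.
by apply: measurableI => //; rewrite -[X in measurable X]setTI; exact: measurable_normalize.
Qed.

End surface.

Section surface_cube.
Context (R : realType) (n : nat).
Local Notation T := (n.+1.-tuple R).
Local Notation sigma := (@surface_measure R n).
Local Notation leb := (lebesgue_tuple R n.+1).

(* The cone over a cap of radius r is covered by O(1/r) cubes of side 4 r
   centred on its axis. *)
Lemma surface_cube_le (x : T) (r : R) : sphere x -> 0 < r <= 2 ->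
  (sigma (cube x r) <= (n.+1%:R * (3 * 4 ^+ n.+1 * r ^+ n))%:E)%E.
Proof.
move=> xS /andP[r0 r2].
(* The cone is cut into the layers [j r <= |z| < (j + 1) r]; as [|z| <= 1], only [j <= 1/r]
   occurs. *)
pose J := (Num.truncn r^-1).+1.
have Jr : J%:R * r <= 3.
  have /andP[h _] := truncn_itv (ltW (etrans (invr_gt0 r) r0)).
  have : (Num.truncn r^-1)%:R * r <= 1 by rewrite -ler_pdivlMr// div1r.
  rewrite /J -natr1 mulrDl mul1r; lra.
have mC : measurable (normalize @^-1` cube x r `&` (@punctured_ball R n.+1)).
  apply: measurableI; last exact: measurable_punctured_ball.
  by rewrite -[X in measurable X]setTI; apply: measurable_normalize => //; exact: measurable_cube.
rewrite /surface_measure EFinM lee_pmul2l ?lte_fin ?ltr0n//.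
apply: (@le_trans _ _ (\sum_(j < J) leb (cube (tscale (j%:R * r) x) (2 * r)))%E).
  apply: (@content_subadditive _ _ _ leb _ (fun j => cube (tscale (j%:R * r) x) (2 * r))) => //.
    by move=> j _; exact: measurable_cube.
  rewrite -(bigcup_mkord J (fun j => cube (tscale (j%:R * r) x) (2 * r))).
  move=> z [/= zx /andP[z0 z1]].
  pose j := Num.truncn (enorm z / r).
  have /andP[h1 h2] : j%:R <= enorm z / r < j.+1%:R by apply: truncn_itv; rewrite divr_ge0// ltW.
  exists j => /=.
    rewrite ltnS /j le_truncn// ler_pdivrMr// mulVf// gt_eqF//.
  (* The point [z] is first compared with [|z| x], then with [j r x]; each comparison costs at most
     [r] in every coordinate. *)
  move=> i; rewrite tnth_mktuple.
  have -> : tnth z i - j%:R * r * tnth x i =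
      enorm z * (tnth (normalize z) i - tnth x i) + (enorm z - j%:R * r) * tnth x i.
    by rewrite tnth_mktuple; field; rewrite gt_eqF.
  rewrite (le_trans (ler_normD _ _))// !normrM (_ : 2 * r = r + r) ?lerD//; last by ring.
    by rewrite (ger0_norm (ltW z0)) -[leRHS]mul1r ler_pM ?(ltW z0)//; exact: zx.
  rewrite -[leRHS]mulr1 ler_pM//; last exact: sphere_tnth_le1.
  rewrite ger0_norm; last by rewrite subr_ge0 -ler_pdivlMr.
  by move: h2; rewrite -natr1 ltr_pdivrMr// mulrDl mul1r; lra.
rewrite (eq_bigr (fun=> ((2 * (2 * r)) ^+ n.+1)%:E)); last first.
  by move=> j _; rewrite lebesgue_cube// mulr_ge0// ltW.
rewrite sumEFin lee_fin sumr_const card_ord.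
rewrite (_ : _ *+ J = (J%:R * r) * (4 ^+ n.+1 * r ^+ n)); last first.
  by rewrite -[LHS]mulr_natl mulrA (_ : 2 * 2 = 4) ?exprMn 1?[r ^+ n.+1]exprSr; ring.
by rewrite -[leRHS]mulrA ler_wpM2r// mulr_ge0 ?exprn_ge0// ltW.
Qed.

(** The cone over the cap contains a small solid cube around [x / 2], away from both the origin and
    the boundary of the ball. *)
Lemma surface_cube_gt0 (x : T) (r : R) : sphere x -> 0 < r -> (0 < sigma (cube x r))%E.
Proof.
move=> xS r0.
(* The bound [1 / 8] on [n.+1 * e] keeps [|z|] in [[1/4, 1]]; the bound [r / 16] absorbs the total
   error [3 (n + 1) e] after division by [|z| >= 1/4]. *)
pose e : R := Num.min (1 / 8) (r / 16) / (n.+1%:R).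
have n0 : 0 < n.+1%:R :> R by rewrite ltr0n.
have e0 : 0 < e by rewrite divr_gt0// lt_min; apply/andP; split; lra.
have e1 : n.+1%:R * e <= 1 / 8 by rewrite mulrC divfK ?gt_eqF// ge_min lexx.
have e2 : n.+1%:R * e <= r / 16 by rewrite mulrC divfK ?gt_eqF// ge_min lexx orbT.
have ee : e <= n.+1%:R * e by rewrite ler_peMl ?(ltW e0)// ler1n.
rewrite /surface_measure mule_gt0 ?lte_fin//.
apply: (@lt_le_trans _ _ (leb (cube (tscale 2^-1 x) e))).
  by rewrite lebesgue_cube ?(ltW e0)// lte_fin exprn_gt0// mulr_gt0.
rewrite le_measure ?inE//; first exact: measurable_cube.
  apply: measurableI; last exact: measurable_punctured_ball.
  by rewrite -[X in measurable X]setTI; apply: measurable_normalize => //; exact: measurable_cube.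
move=> z zx.
have zi i : `|tnth z i - 2^-1 * tnth x i| <= e by have := zx i; rewrite tnth_mktuple.
have d2 : `|dot z z - 1 / 4| <= n.+1%:R * e * (5 / 4).
  have -> : dot z z - 1 / 4 = \sum_(i < n.+1) (tnth z i - 2^-1 * tnth x i) * (tnth z i + 2^-1 * tnth x i).
    rewrite (_ : 1 / 4 = 2^-1 * 2^-1 * dot x x); last first.
      by move/sphereP : xS => ->; field.
    by rewrite /dot mulr_sumr -sumrB; apply: eq_bigr => i _; ring.
  rewrite (le_trans (ler_norm_sum _ _ _))//.
  apply: (@le_trans _ _ (\sum_(i < n.+1) e * (5 / 4))); last first.
    by rewrite sumr_const card_ord -[leLHS]mulr_natl mulrA.
  apply: ler_sum => i _; rewrite normrM ler_pM// ?zi//.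
  have := sphere_tnth_le1 i xS; have := zi i; move: ee e1 {zi}.
  rewrite !ler_norml => ? ? /andP[? ?] /andP[? ?]; apply/andP; split; lra.
have zz : 1 / 4 <= enorm z <= 1.
  move: d2; rewrite ler_norml => /andP[d21 d22].
  have hz := sqr_enorm z; have z0 := enorm_ge0 z.
  apply/andP; split.
    by rewrite -(@ler_pXn2r _ 2) ?nnegrE// hz; lra.
  by rewrite -(@ler_pXn2r _ 2) ?nnegrE// hz; lra.
move/andP: zz => [z1 z2]; have z0 : 0 < enorm z by lra.
split; last by apply/andP.
move=> i; rewrite tnth_mktuple.
have d3 : `|enorm z - 2^-1| <= n.+1%:R * e * 2.
  have : `|(enorm z - 2^-1) * (enorm z + 2^-1)| <= n.+1%:R * e * (5 / 4).
    by rewrite (_ : (_ - _) * _ = dot z z - 1 / 4)// -sqr_enorm; field.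
  have zp : 0 <= enorm z + 2^-1 by lra.
  rewrite normrM (ger0_norm zp).
  move=> h; have : `|enorm z - 2^-1| * (3 / 4) <= n.+1%:R * e * (5 / 4).
    by apply: le_trans h; rewrite ler_wpM2l//; lra.
  lra.
have h : `|tnth z i - enorm z * tnth x i| <= n.+1%:R * e * 2 + e.
  rewrite (_ : _ - _ = (tnth z i - 2^-1 * tnth x i) + (2^-1 - enorm z) * tnth x i); last by ring.
  rewrite (le_trans (ler_normD _ _))// addrC lerD// normrM distrC -[leRHS]mulr1.
  by rewrite ler_pM//; exact: sphere_tnth_le1.
rewrite (_ : _ - _ = (tnth z i - enorm z * tnth x i) / enorm z); last by field; rewrite gt_eqF.
rewrite normrM normfV (gtr0_norm z0) ler_pdivrMr//.
apply: (le_trans h); apply: (@le_trans _ _ (r * (1 / 4))).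
  lra.
by rewrite ler_wpM2l// ltW.
Qed.

End surface_cube.

(** * Polynomials on the ball and on the sphere *)

Section mpoly_functions.
Context (R : realType) (k : nat).
Implicit Types (p q : mpol k R) (x z : k.-tuple R).

Lemma mpoly_ring_ind (P : mpol k R -> Prop) :
  (forall c, P (mpoly.mpolyC k c)) -> (forall p q, P p -> P q -> P (p + q)) ->
  (forall i p, P p -> P (mvar i * p)) -> forall p, P p.
Proof.
move=> PC PD PX.
have PXn i e p : P p -> P (mvar i ^+ e * p).
  move=> Pp; elim: e => [|e IH]; first by rewrite expr0 mul1r.
  by rewrite exprS -mulrA; exact: PX.
apply: mpoly.mpolyind => [|c m p _ _ Pp].
  by rewrite -[0](mpoly.mpolyC0 _ R); exact: PC.
apply: PD => //; rewrite mpoly.mpolyXE_id.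
rewrite -mpoly.mul_mpolyC mulrC.
elim/big_rec : _ => [|i r _ IH]; first by rewrite mul1r; exact: PC.
by rewrite -mulrA; exact: PXn.
Qed.

Definition pev p x : R := mpoly.meval (tnth x) p.

Lemma pevC c x : pev (mpoly.mpolyC k c) x = c.
Proof. exact: mpoly.mevalC. Qed.
Lemma pev1 x : pev 1 x = 1.
Proof. by rewrite -[X in pev X]mpoly.mpolyC1 pevC. Qed.
Lemma pevD p q x : pev (p + q) x = pev p x + pev q x.
Proof. exact: mpoly.mevalD. Qed.
Lemma pevM p q x : pev (p * q) x = pev p x * pev q x.
Proof. exact: mpoly.mevalM. Qed.
Lemma pevB p q x : pev (p - q) x = pev p x - pev q x.
Proof. exact: mpoly.mevalB. Qed.
Lemma pevZ c p x : pev (c *: p) x = c * pev p x.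
Proof. exact: mpoly.mevalZ. Qed.
Lemma pevX i x : pev (mvar i) x = tnth x i.
Proof. exact: mpoly.mevalXU. Qed.
Lemma pev_sum (I : Type) (r : seq I) (P : pred I) (F : I -> mpol k R) x :
  pev (\sum_(i <- r | P i) F i) x = \sum_(i <- r | P i) pev (F i) x.
Proof. by rewrite /pev raddf_sum. Qed.

Lemma measurable_pev p : measurable_fun [set: k.-tuple R] (pev p).
Proof.
elim/mpoly_ring_ind : p => [c|p q mp mq|i p mp].
- by apply: (eq_measurable_fun (cst c)) => [x _|]; rewrite ?pevC.
- apply: (eq_measurable_fun (fun x => pev p x + pev q x)) => [x _|].
    by rewrite pevD.
  exact: measurable_funD.
- apply: (eq_measurable_fun (fun x => (tnth x i : R) * pev p x)) => [x _|].
    by rewrite pevM pevX.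
  by apply: measurable_funM => //; exact: measurable_tnth.
Qed.

Lemma pev_bounded p : exists2 M : R, 0 <= M &
  forall x, (forall i, `|tnth x i| <= 1) -> `|pev p x| <= M.
Proof.
elim/mpoly_ring_ind : p => [c|p q [M M0 pM] [N N0 qN]|i p [M M0 pM]].
- by exists `|c| => // x _; rewrite pevC.
- exists (M + N) => [|x x1]; first exact: addr_ge0.
  by rewrite pevD (le_trans (ler_normD _ _))// lerD ?pM ?qN.
- exists M => // x x1; rewrite pevM pevX normrM -[leRHS]mul1r.
  by rewrite ler_pM// ?pM.
Qed.

Lemma pev_lipschitz p : exists2 L : R, 0 <= L & forall x y (e : R),
  (forall i, `|tnth x i| <= 1) -> (forall i, `|tnth y i| <= 1) ->
  (forall i, `|tnth x i - tnth y i| <= e) -> `|pev p x - pev p y| <= L * e.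
Proof.
elim/mpoly_ring_ind : p => [c|p q [M M0 pM] [N N0 qN]|i p [M M0 pM]].
- by exists 0 => // x y e _ _ _; rewrite !pevC subrr normr0 mul0r.
- exists (M + N) => [|x y e x1 y1 xy]; first exact: addr_ge0.
  rewrite !pevD opprD addrACA (le_trans (ler_normD _ _))// mulrDl.
  by apply: lerD; [exact: pM|exact: qN].
- have [B B0 pB] := pev_bounded p.
  exists (M + B) => [|x y e x1 y1 xy]; first exact: addr_ge0.
  rewrite !pevM !pevX.
  have -> : tnth x i * pev p x - tnth y i * pev p y = tnth x i * (pev p x - pev p y) +
    (tnth x i - tnth y i) * pev p y by ring.
  rewrite (le_trans (ler_normD _ _))// [leRHS]mulrDl; apply: lerD; rewrite normrM.
    by rewrite -[leRHS]mul1r; apply: ler_pM => //; exact: pM.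
  by rewrite mulrC; apply: ler_pM => //; exact: pB.
Qed.

(** The restriction of [p] to the line through [z] in direction [i]; it turns a partial derivative
    into the derivative of a univariate polynomial. *)
Definition pslice p z i : {poly R} :=
  mpoly.mmap polyC (fun j => if j == i then 'X else (tnth z j)%:P) p.

Lemma pslice_recs z i :
  [/\ forall c, pslice (mpoly.mpolyC k c) z i = c%:P,
   forall p q, pslice (p + q) z i = pslice p z i + pslice q z i,
   forall p q, pslice (p * q) z i = pslice p z i * pslice q z i &
   forall j, pslice (mvar j) z i = if j == i then 'X else (tnth z j)%:P].
Proof.
split=> [c|p q|p q|j]; rewrite /pslice.
- exact: mpoly.mmapC.
- exact: mpoly.mmapD.
- exact: rmorphM.
- by rewrite mpoly.mmapX mpoly.mmap1U.
Qed.

Lemma horner_pslice p z i s : (pslice p z i).[s] = pev p (tupd z i s).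
Proof.
have [sC sD sM sX] := pslice_recs z i.
elim/mpoly_ring_ind : p => [c|p q IHp IHq|j p IH].
- by rewrite sC pevC hornerC.
- by rewrite sD pevD hornerD IHp IHq.
- rewrite sM sX pevM pevX hornerM IH tnth_mktuple; case: ifPn => _.
    by rewrite hornerX.
  by rewrite hornerC.
Qed.

Lemma mder_var i j : mder i (mvar j : mpol k R) = mpoly.mpolyC k (i == j)%:R.
Proof.
rewrite mpoly.mderivX mpoly.mnm1E eq_sym; case: eqVneq => [->|_]; last first.
  by rewrite scale0r mpoly.mpolyC0.
rewrite scale1r mpoly.mpolyC1 -mpoly.mpolyX0; congr mpoly.mpolyX.
by apply/mpoly.mnmP => l; rewrite mpoly.mnmBE subnn mpoly.mnm0E.
Qed.

Lemma deriv_pslice p z i : (pslice p z i)^`() = pslice (mder i p) z i.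
Proof.
have [sC sD sM sX] := pslice_recs z i.
elim/mpoly_ring_ind : p => [c|p q IHp IHq|j p IH].
- by rewrite sC mpoly.mderivC derivC -[X in pslice X](mpoly.mpolyC0 k R) sC polyC0.
- by rewrite sD mpoly.mderivD sD derivD IHp IHq.
- rewrite sM sX mpoly.mderivM sD !sM sX derivM IH mder_var sC eq_sym.
  by case: eqVneq => _; rewrite ?derivX ?derivC.
Qed.

End mpoly_functions.

Lemma integral_deriv_poly (R : realType) (p : {poly R}) (a b : R) : a <= b ->
  (\int[lebesgue_measure]_(x in `[a, b]) (p^`().[x])%:E = (p.[b] - p.[a])%:E)%E.
Proof.
rewrite le_eqVlt => /orP[/eqP <-|ab].
  by rewrite set_itv1 integral_set1 subrr.
have cp : continuous (horner p) by exact: continuous_horner.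
rewrite (@continuous_FTC2 _ _ (horner p))//.
- by apply: continuous_subspaceT; exact: continuous_horner.
- split=> [x _||].
  + exact: derivable_horner.
  + by apply: cvg_at_right_filter; exact: cp.
  + by apply: cvg_at_left_filter; exact: cp.
- by move=> x _; rewrite derivE.
Qed.

(** * Integration by parts on the ball *)

Section ball_by_parts.
Context (R : realType) (n : nat).
Local Notation T := (n.+1.-tuple R).
Local Notation leb := (lebesgue_tuple R n.+1).
Local Notation mu := (@lebesgue_measure R).

Let mB : measurable (@punctured_ball R n.+1) := @measurable_punctured_ball R n.+1.

Definition mnorm2 : mpol n.+1 R := \sum_(i < n.+1) mvar i * mvar i.

Lemma pev_mnorm2 x : pev mnorm2 x = dot x x.
Proof. by rewrite pev_sum; apply: eq_bigr => i _; rewrite pevM pevX. Qed.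

(** The origin is put back so that every line meets the set in a closed interval or not at all. *)
Let cball : set T := [set x | dot x x <= 1].

Let mcball : measurable cball.
Proof.
rewrite (_ : cball = (pev mnorm2) @^-1` `]-oo, 1]); last first.
  by apply/seteqP; split => x /=; rewrite in_itv/= pev_mnorm2.
by rewrite -[X in measurable X]setTI; exact: measurable_pev.
Qed.

Let ge0_integral_cball (f : T -> \bar R) : measurable_fun setT f ->
  (forall x, (0 <= f x)%E) ->
  (\int[leb]_(x in cball) f x = \int[leb]_(x in punctured_ball) f x)%E.
Proof.
(* [z0] is the origin, written as a cube of radius 0 so that [lebesgue_cube] gives its measure. *)
move=> mf f0; pose z0 : set T := cube [tuple 0 | i < n.+1] 0.
have mz0 : measurable z0 by exact: measurable_cube.
have z0P x : z0 x <-> dot x x = 0.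
  split=> [zx|/eqP xx i].
    by rewrite /dot big1// => i _; have := zx i; rewrite tnth_mktuple subr0 normr_le0 => /eqP->; rewrite mul0r.
  rewrite tnth_mktuple subr0 normr_le0 -sqrf_eq0; move: xx; rewrite /dot psumr_eq0.
    by move=> /allP/(_ i); rewrite mem_index_enum expr2 => /(_ isT).
  by move=> j _; rewrite -expr2 sqr_ge0.
rewrite (_ : cball = punctured_ball `|` z0); last first.
  apply/seteqP; split=> x; rewrite /cball /=.
    have [x0|x0] := eqVneq (dot x x) 0; first by right; apply/z0P.
    move=> x1; left; rewrite /punctured_ball/= sqrtr_gt0 lt_def x0 dot_ge0/=.
    by rewrite -(@ler_pXn2r _ 2) ?nnegrE ?enorm_ge0// sqr_enorm expr1n.
  move=> [/andP[x0 x1]|/z0P->//]; rewrite -sqr_enorm.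
  by rewrite expr_le1// enorm_ge0.
rewrite ge0_integral_setU//; last 2 first.
- exact: measurable_funTS.
- apply/disj_set2P; rewrite -subset0 => x [/andP[x0 _] /z0P xx].
  by move: x0; rewrite sqrtr_gt0 xx ltxx.
rewrite [X in (_ + X)%E](_ : _ = 0%E) ?adde0//.
apply: null_set_integral => //; first exact: measurable_funTS.
by rewrite /z0 [LHS]lebesgue_cube// mulr0 expr0n.
Qed.

(* [q (1 - |x|^2)] vanishes at both ends of every chord of the ball. The constant
   [C] only makes the integrands nonnegative, so that Tonelli's theorem applies. *)
Lemma ball_by_parts (q : mpol n.+1 R) i :
  \int[leb]_(x in punctured_ball) pev (mder i (q * (1 - mnorm2))) x = 0.
Proof.
set G := q * (1 - mnorm2).
have [C C0 GC] := pev_bounded (mder i G).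
have pb1 x : (@punctured_ball R n.+1) x -> forall j, `|tnth x j| <= 1.
  by move=> /andP[_ x1] j; exact: le_trans (normr_tnth_le _ _) x1.
have cb1 x : cball x -> forall j, `|tnth x j| <= 1.
  move=> x1 j; apply: le_trans (normr_tnth_le _ _) _.
  by rewrite -(@ler_pXn2r _ 2) ?nnegrE ?enorm_ge0// sqr_enorm expr1n.
pose f z := ((pev (mder i G) z + C)%:E : \bar R).
have mf : measurable_fun [set: T] f.
  apply/measurable_EFinP; apply: measurable_funD => //; exact: measurable_pev.
pose fc := f \_ cball; pose gc := cst C%:E \_ cball.
have mfc : measurable_fun setT fc.
  by apply/(measurable_restrictT _ mcball); exact: measurable_funTS.
have mgc : measurable_fun setT gc by apply/(measurable_restrictT _ mcball).
have f0 x : cball x -> (0 <= f x)%E.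
  by move=> /cb1/GC; rewrite lee_fin ler_norml => /andP[+ _]; lra.
have fc0 x : (0 <= fc x)%E.
  by rewrite /fc patchE; case: ifPn => //; rewrite inE => /f0.
have gc0 x : (0 <= gc x)%E.
  by rewrite /gc patchE; case: ifPn => // _; rewrite lee_fin.
have key : (\int[leb]_x fc x = \int[leb]_x gc x)%E.
  apply: (ge0_integral_slices (i := i)) => // z.
  (* [c] is the square of half the length of the chord, and is negative when the line misses the
     ball. *)
  pose c := 1 - \sum_(j < n.+1 | j != i) tnth z j * tnth z j.
  have dotz s : dot (tupd z i s) (tupd z i s) = s ^+ 2 + (1 - c).
    rewrite /dot (bigD1 i)//= tnth_mktuple eqxx /c subKr; congr (_ + _).
    by apply: eq_bigr => j /negbTE ji; rewrite tnth_mktuple ji.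
  have [c0|c0] := ltP c 0.
    have zc s : tupd z i s \notin cball.
      rewrite notin_setE /cball/= dotz; have := sqr_ge0 s; lra.
    rewrite [LHS](_ : _ = 0%E); last first.
      by apply: integral0_eq => s _; rewrite /fc patchE (negbTE (zc s)).
    by apply/esym/integral0_eq => s _; rewrite /gc patchE (negbTE (zc s)).
  pose r := Num.sqrt c.
  have r0 : 0 <= r by exact: sqrtr_ge0.
  have r2 : r ^+ 2 = c by rewrite sqr_sqrtr.
  have zc s : (tupd z i s \in cball) = (s \in `[- r, r]%classic).
    have sr : (s \in `[- r, r]) = (s ^+ 2 <= c).
      by rewrite in_itv/= -ler_norml -(@ler_pXn2r _ 2) ?nnegrE// real_normK ?num_real// r2.
    apply/idP/idP; rewrite !inE /cball /= dotz sr; lra.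
  have NrK : - r <= r by lra.
  (* Both integrands become derivatives of polynomials, the constant [C] being that of [C *: 'X];
     the two primitives differ by the slice of [G], which is 0 at both ends. *)
  transitivity (\int[mu]_(s in `[(- r)%R, r]) (((pslice G z i + C *: 'X)^`()).[s])%R%:E)%E.
    rewrite [RHS]integral_mkcond; apply: eq_integral => s _.
    rewrite /fc !patchE zc; case: ifPn => // _.
    rewrite /f derivD derivZ derivX deriv_pslice hornerD hornerZ hornerC mulr1.
    by rewrite horner_pslice.
  transitivity (\int[mu]_(s in `[(- r)%R, r]) ((((C *: 'X) : {poly R})^`()).[s])%R%:E)%E; last first.
    rewrite [LHS]integral_mkcond; apply: eq_integral => s _.
    rewrite /gc !patchE zc; case: ifPn => // _.
    by rewrite derivZ derivX hornerZ hornerC mulr1.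
  rewrite !integral_deriv_poly// !hornerD !horner_pslice.
  have G0 s : s ^+ 2 = c -> pev G (tupd z i s) = 0.
    move=> sc; rewrite /G pevM pevB pev_mnorm2 dotz sc.
    by rewrite pev1 (_ : 1 - (c + (1 - c)) = 0) ?mulr0//; ring.
  by rewrite !G0 ?sqrrN// !add0r.
have bf : bmfun punctured_ball (pev (mder i G)).
  by split; [apply: measurable_funTS; exact: measurable_pev|exists C => x /pb1/GC].
have bC : bmfun (@punctured_ball R n.+1) (cst C) by exact: bmfun_cst.
have Boo := @lebesgue_punctured_ball R n.
have : (\int[leb]_(x in punctured_ball) f x = \int[leb]_(x in punctured_ball) C%:E)%E.
  have bc x : (@punctured_ball R n.+1) x -> x \in cball.
    by move=> /andP[x0 x1]; rewrite inE /cball/= -sqr_enorm expr_le1// enorm_ge0.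
  have fcE : (\int[leb]_(x in punctured_ball) f x = \int[leb]_x fc x)%E.
    rewrite /fc -integral_mkcond -/fc.
    rewrite (eq_integral fc) => [|x xb]; last by rewrite /fc patchE xb.
    rewrite ge0_integral_cball//; apply: eq_integral => x /[!inE] /bc xb.
    by rewrite /fc patchE xb.
  have gcE : (\int[leb]_(x in punctured_ball) C%:E = \int[leb]_x gc x)%E.
    rewrite /gc -integral_mkcond -/gc.
    rewrite [RHS](eq_integral gc) => [|x xb]; last by rewrite /gc patchE xb.
    rewrite ge0_integral_cball//; apply: eq_integral => x /[!inE] /bc xb.
    by rewrite /gc patchE xb.
  by rewrite fcE gcE.
rewrite (@fine_integral _ _ _ leb _ mB Boo (fun x => pev (mder i G) x + C)); last 2 first.
- exact: bmfunD.
- by move=> x /pb1/GC; rewrite ler_norml => /andP[+ _]; lra.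
rewrite (@fine_integral _ _ _ leb _ mB Boo (cst C))// => -[].
rewrite rintD// => /eqP; rewrite -subr_eq0 addrK => /eqP//.
Qed.

End ball_by_parts.

(** * Radial integration on the ball *)

Section radial.
Context (R : realType) (n : nat).
Local Notation T := (n.+1.-tuple R).
Local Notation leb := (lebesgue_tuple R n.+1).
Local Notation Bint f := (\int[leb]_(x in punctured_ball) f x).

Let mB : measurable (@punctured_ball R n.+1) := @measurable_punctured_ball R n.+1.
Let Boo := @lebesgue_punctured_ball R n.

Lemma bmfun_enorm : bmfun (@punctured_ball R n.+1) (@enorm R n.+1).
Proof.
split; first by apply: measurable_funTS; exact: measurable_enorm.
by exists 1 => x /andP[_ x1]; rewrite ger0_norm ?enorm_ge0.
Qed.

Section zero_homogeneous.
Variables (u : T -> R) (C : R).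
Hypotheses (mu : measurable_fun setT u) (u0 : forall x, 0 <= u x) (uC : forall x, u x <= C).
Hypothesis uh : forall (r : R) x, 0 < r -> u (tscale r x) = u x.

Let bu : bmfun (@punctured_ball R n.+1) u.
Proof.
split; first exact: measurable_funTS.
by exists C => x _; rewrite ger0_norm.
Qed.

Let Psi k := Bint (fun x => u x * enorm x ^+ k).

Let buk k : bmfun (@punctured_ball R n.+1) (fun x => u x * enorm x ^+ k).
Proof. by apply: bmfunM => //; apply: bmfunX => //; exact: bmfun_enorm. Qed.

Let chi (r : R) (x : T) : R := (enorm x <= r)%R%:R.

Let bchi r : bmfun (@punctured_ball R n.+1) (chi r).
Proof.
split; last by exists 1 => x _; rewrite /chi; case: (_ <= r); rewrite ?normr1 ?normr0.
apply: measurable_funTS.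
rewrite (_ : chi r = \1_((@enorm R n.+1) @^-1` `]-oo, r])).
  apply: measurable_indic; rewrite -[X in measurable X]setTI; exact: measurable_enorm.
apply/funext => x; rewrite indicE /chi; congr ((_ : bool)%:R).
by apply/idP/idP; rewrite inE/= in_itv.
Qed.

(** Substitution of a dilation: [u] is unchanged, [|x|^k] contributes [r^k], and the Jacobian
    contributes [r^(n+1)]. *)
Let scaling k r : 0 < r <= 1 ->
  Bint (fun x => u x * enorm x ^+ k * chi r x) = r ^+ (k + n.+1) * Psi k.
Proof.
move=> /andP[r0 r1].
have rV0 : 0 < r^-1 by rewrite invr_gt0.
pose h := (fun x => (u x * enorm x ^+ k)%:E : \bar R) \_ (@punctured_ball R n.+1).
have mh : measurable_fun setT h.
  apply/(measurable_restrictT _ mB)/measurable_EFinP; exact: (buk k).1.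
have h0 x : (0 <= h x)%E.
  by rewrite /h patchE; case: ifPn => // _; rewrite lee_fin mulr_ge0// exprn_ge0// enorm_ge0.
have := ge0_integral_tscale rV0 mh h0.
rewrite -[in RHS]integral_mkcond (@fine_integral _ _ _ leb _ mB Boo _ (buk k)); last first.
  by move=> x _; rewrite mulr_ge0// exprn_ge0// enorm_ge0.
rewrite -/(Psi k) invrK.
rewrite (_ : (fun x => _) = (fun x => (r ^- k * (u x * enorm x ^+ k * chi r x))%:E : \bar R) \_ (@punctured_ball R n.+1)); last first.
  apply/funext => x; rewrite /h !patchE.
  have -> : (tscale r^-1 x \in punctured_ball) = (0 < enorm x <= r).
    rewrite (_ : (0 < enorm x <= r) = (0 < enorm (tscale r^-1 x) <= 1)); first by apply/idP/idP; rewrite inE.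
    by rewrite enorm_tscale ?(ltW rV0)// pmulr_rgt0// ler_pdivrMl// mulr1.
  have -> : (x \in punctured_ball) = (0 < enorm x <= 1) by apply/idP/idP; rewrite inE.
  rewrite /chi uh// enorm_tscale ?(ltW rV0)//.
  have [x0|x0] := ltP 0 (enorm x) => //=.
  have [xr|xr] := leP (enorm x) r; last by rewrite mulr0 mulr0; case: ifP.
  by rewrite (le_trans xr r1) mulr1 exprMn exprVn; congr EFin; ring.
rewrite -integral_mkcond (@fine_integral _ _ _ leb _ mB Boo); last 2 first.
- by apply: bmfunZ => //; apply: bmfunM => //; exact: bchi.
- move=> x _; apply: mulr_ge0; first by rewrite invr_ge0 exprn_ge0// ltW.
  apply: mulr_ge0; first by rewrite mulr_ge0// exprn_ge0// enorm_ge0.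
  by rewrite /chi; case: (_ <= r).
rewrite rintZ//; last by apply: bmfunM => //; exact: bchi.
move=> -[] /(congr1 ( *%R (r ^+ k))).
by rewrite mulrA divff ?mul1r ?expf_neq0 ?gt_eqF// => ->; rewrite exprD mulrA.
Qed.

(* Polar integration without polar coordinates: the ball is compared with its
   scaled copy of radius [r]; divide by [1 - r] and let [r] tend to 1. *)
Lemma ge0_ball_radial k :
  Bint (fun x => u x * enorm x ^+ k) * (k + n.+1)%:R = n.+1%:R * Bint u.
Proof.
rewrite -/(Psi k).
have P0 : Psi 0 = Bint u by apply: eq_rint => // x _; rewrite expr0 mulr1.
(* On the shell [r < |x| <= 1] the factor [|x|^k] lies between [r^k] and 1. *)
have b1 (r : R) : 0 < r < 1 ->
  r ^+ k * (Psi 0 - r ^+ n.+1 * Psi 0) <= Psi k - r ^+ (k + n.+1) * Psi k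
    <= Psi 0 - r ^+ n.+1 * Psi 0.
  move=> /andP[r0 r1]; have r01 : 0 < r <= 1 by rewrite r0 ltW.
  have buc j : bmfun (@punctured_ball R n.+1) (fun x => u x * enorm x ^+ j * chi r x).
    by apply: bmfunM => //; exact: bchi.
  rewrite -(scaling k r01) (_ : r ^+ n.+1 * Psi 0 = Bint (fun x => u x * enorm x ^+ 0 * chi r x)); last first.
    by rewrite scaling.
  rewrite /Psi -!rintB// -rintZ//; last exact: bmfunB.
  apply/andP; split; apply: le_rint => //.
  - by apply: bmfunZ => //; exact: bmfunB.
  - exact: bmfunB.
  - move=> x /andP[x0 x1]; rewrite expr0 mulr1 /chi.
    have [xr|xr] := leP (enorm x) r; first by rewrite !mulr1 !subrr mulr0.
    by rewrite !mulr0 !subr0 mulrC ler_wpM2l// lerXn2r ?nnegrE ?(ltW xr)// ltW.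
  - exact: bmfunB.
  - exact: bmfunB.
  - move=> x /andP[x0 x1]; rewrite expr0 mulr1 /chi.
    have [xr|xr] := leP (enorm x) r; first by rewrite !mulr1 !subrr.
    rewrite !mulr0 !subr0 -[leRHS]mulr1 ler_wpM2l//.
    by rewrite exprn_ile1// ltW.
(* [S m] is the quotient of [1 - 'X^m] by [1 - 'X]. Once the sandwich is divided by [1 - r], both
   bounds are polynomials in [r], and the limit is their value at 1, where [S m] equals [m]. *)
pose S m : {poly R} := \sum_(i < m) 'X^i.
have Sr m r : (S m).[r] * (1 - r) = 1 - r ^+ m.
  rewrite /S horner_sum -[RHS]opprB subrX1 -mulNr opprB mulrC; congr (_ * _).
  by apply: eq_bigr => i _; rewrite hornerXn.
have S1 m : (S m).[1] = m%:R.
  rewrite /S horner_sum (eq_bigr (fun=> 1)) => [|i _]; last by rewrite hornerXn expr1n.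
  by rewrite sumr_const card_ord.
have lim (p : {poly R}) : (forall r, 0 < r < 1 -> 0 <= p.[r]) -> 0 <= p.[1].
  move=> p0; have h : horner p x @[x --> 1^'-] --> p.[1].
    by apply: cvg_at_left_filter; exact: continuous_horner.
  apply: (cvgr_to_ge h).
  near=> r; apply: p0; apply/andP; split; near: r; [exact: nbhs_left_gt|exact: nbhs_left_lt].
have h1 : 0 <= ((Psi k)%:P * S (k + n.+1)%N - 'X^k * (Psi 0)%:P * S n.+1).[1].
  apply: lim => r r01; have /andP[h _] := b1 _ r01; move/andP: r01 => [r0 r1].
  have r1' : 0 < 1 - r by rewrite subr_gt0.
  rewrite -(pmulr_lge0 _ r1') !hornerE mulrBl -!mulrA !Sr.
  by rewrite subr_ge0 !mulrBr !mulr1 in h *; lra.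
have h2 : 0 <= ((Psi 0)%:P * S n.+1 - (Psi k)%:P * S (k + n.+1)%N).[1].
  apply: lim => r r01; have /andP[_ h] := b1 _ r01; move/andP: r01 => [r0 r1].
  have r1' : 0 < 1 - r by rewrite subr_gt0.
  rewrite -(pmulr_lge0 _ r1') !hornerE mulrBl -!mulrA !Sr.
  by rewrite subr_ge0 !mulrBr !mulr1 in h *; lra.
rewrite !hornerE !S1 ?expr1n in h1 h2; rewrite -P0; lra.
Unshelve. all: by end_near.
Qed.

End zero_homogeneous.
End radial.

(** * Homogeneous polynomials and the generators of rotations *)

Section mpoly_homogeneous.
Context (R : realType) (k : nat).
Implicit Types (p q : mpol k R) (x z : k.-tuple R).

Lemma mhom_ind (m : nat) (P : mpol k R -> Prop) :
  P 0 -> (forall p q, P p -> P q -> P (p + q)) ->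
  (forall c a, mpoly.mdeg a = m -> P (c *: mpoly.mpolyX R a)) ->
  forall p, mhom m p -> P p.
Proof.
move=> P0 PD PX p /mpoly.dhomogP pm; rewrite [p]mpoly.mpolyE.
rewrite big_seq; elim/big_ind : _ => // a ap; apply: PX; exact: pm.
Qed.

Lemma pev_mhom m p r x : mhom m p -> pev p (tscale r x) = r ^+ m * pev p x.
Proof.
move: p; apply: mhom_ind => [|p q IHp IHq|c a am].
- by rewrite /pev !mpoly.meval0 mulr0.
- by rewrite !pevD IHp IHq mulrDr.
- rewrite !pevZ /pev !mpoly.mevalX -am mpoly.mdegE mulrCA; congr (_ * _).
  rewrite -prodrXr -big_split/=; apply: eq_bigr => i _.
  by rewrite tnth_mktuple exprMn.
Qed.

Lemma mder_scaleX i c a : mder i (c *: mpoly.mpolyX R a : mpol k R) =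
  (c * (a i)%:R) *: mpoly.mpolyX R (mpoly.mnm_sub a (mpoly.mnm1 i)).
Proof. by rewrite mpoly.mderivZ mpoly.mderivX scalerA. Qed.

Lemma mnm_subU1K (a : mpoly.multinom k) i : a i != 0%N ->
  mpoly.mnm_add (mpoly.mnm_sub a (mpoly.mnm1 i)) (mpoly.mnm1 i) = a.
Proof. by move=> ai; rewrite mpoly.submK// mpoly.lep1mP. Qed.

Lemma mhom_mder m i p : mhom m.+1 p -> mhom m (mder i p).
Proof.
move: p; apply: mhom_ind => [|p q IHp IHq|c a am].
- by rewrite mpoly.mderiv0 rpred0.
- by rewrite mpoly.mderivD rpredD.
- rewrite mder_scaleX; have [->|ai] := eqVneq (a i) 0%N.
    by rewrite mulr0 scale0r rpred0.
  rewrite rpredZ// mpoly.dhomogX; apply/eqP/succn_inj; rewrite -am.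
  by rewrite -[in RHS](mnm_subU1K ai) mpoly.mdegD mpoly.mdeg1 addn1.
Qed.

Lemma mhom_var i : mhom 1 (mvar i : mpol k R).
Proof. by rewrite mpoly.dhomogX; apply/eqP; exact: mpoly.mdeg1. Qed.

Lemma euler m p : mhom m p -> \sum_(i < k) mvar i * mder i p = m%:R *: p.
Proof.
move: p; apply: mhom_ind => [|p q IHp IHq|c a am].
- by rewrite scaler0 big1// => i _; rewrite mpoly.mderiv0 mulr0.
- rewrite scalerDr -IHp -IHq -big_split/=; apply: eq_bigr => i _.
  by rewrite mpoly.mderivD mulrDr.
- rewrite (eq_bigr (fun i => (a i)%:R *: (c *: mpoly.mpolyX R a))) => [|i _].
    by rewrite -scaler_suml -am mpoly.mdegE natr_sum.
  rewrite mder_scaleX; have [->|ai] := eqVneq (a i) 0%N.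
    by rewrite mulr0 !scale0r mulr0.
  rewrite -scalerAr -mpoly.mpolyXD mulrC scalerA; congr (_ *: mpoly.mpolyX _ _).
  by rewrite mpoly.addmC mnm_subU1K.
Qed.

Lemma mhomM l m p q : mhom l p -> mhom m q -> mhom (l + m) (p * q).
Proof. exact: mpoly.dhomogM. Qed.

(** The infinitesimal rotation [x_i d_j - x_j d_i] in the plane of the coordinates [i] and [j]. *)
Definition lieD i j p : mpol k R := mvar i * mder j p - mvar j * mder i p.

Lemma mhom_lieD m i j p : mhom m p -> mhom m (lieD i j p).
Proof.
case: m p => [|m] p pm; last first.
  by rewrite rpredB// -add1n mhomM ?mhom_var ?mhom_mder.
move: p pm; apply: mhom_ind => [|p q IHp IHq|c a /eqP am].
- by rewrite /lieD !mpoly.mderiv0 !mulr0 subrr rpred0.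
- by rewrite /lieD !mpoly.mderivD !mulrDr opprD addrACA rpredD.
- rewrite mpoly.mdeg_eq0 in am; move/eqP: am => ->.
  rewrite /lieD !mder_scaleX !mpoly.mnm0E !mulr0 !scale0r !mulr0 subrr.
  exact: rpred0.
Qed.

(** The rotation field is divergence-free, so [lieD i j (p * w)] is a divergence; when [w] is
    invariant it equals [lieD i j p * w]. *)
Lemma lieD_mnorm i j (w : mpol k R) p : lieD i j w = 0 ->
  lieD i j p * w = mder j (mvar i * p * w) - mder i (mvar j * p * w).
Proof.
rewrite /lieD => wD; rewrite !mpoly.mderivM !mder_var [j == i]eq_sym.
rewrite -[RHS]subr0 -[in X in _ = _ - X](mulr0 p) -wD; ring.
Qed.

End mpoly_homogeneous.

(** * Surface integrals of polynomials *)

Section surface_integral.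
Context (R : realType) (n : nat).
Local Notation T := (n.+1.-tuple R).
Local Notation sigma := (@surface_measure R n).
Local Notation leb := (lebesgue_tuple R n.+1).
Local Notation Bint f := (\int[leb]_(x in punctured_ball) f x).
Local Notation S f := (\int[sigma]_(x in sphere) f x).

Let mB : measurable (@punctured_ball R n.+1) := @measurable_punctured_ball R n.+1.
Let Boo := @lebesgue_punctured_ball R n.
Let mS : measurable (@sphere R n.+1) := @measurable_sphere R n.+1.
Let Soo := @surface_sphere_lty R n.

Lemma bmfun_pev p : bmfun (@sphere R n.+1) (pev p).
Proof.
split; first by apply: measurable_funTS; exact: measurable_pev.
have [M _ pM] := pev_bounded p.
by exists M => x xS; apply: pM => i; exact: sphere_tnth_le1.
Qed.

Lemma pev_normalize_bounded (p : mpol n.+1 R) :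
  exists2 M : R, 0 <= M & forall x, `|pev p (normalize x)| <= M.
Proof.
have [M M0 pM] := pev_bounded p; exists M => // x; apply: pM => i.
rewrite tnth_mktuple normrM normfV (ger0_norm (enorm_ge0 _)).
have [->|x0] := eqVneq (enorm x) 0; first by rewrite invr0 mulr0.
by rewrite ler_pdivrMr ?lt_def ?x0 ?enorm_ge0// mul1r normr_tnth_le.
Qed.

Lemma measurable_pev_normalize (p : mpol n.+1 R) : measurable_fun [set: T] (pev p \o normalize).
Proof. by apply: measurableT_comp; [exact: measurable_pev|exact: measurable_normalize]. Qed.

Lemma bmfun_pev_normalize p : bmfun (@punctured_ball R n.+1) (pev p \o normalize).
Proof.
split; first by apply: measurable_funTS; exact: measurable_pev_normalize.
by have [M _ pM] := pev_normalize_bounded p; exists M => x _; exact: pM.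
Qed.

Lemma bmfun_ball_pev p : bmfun (@punctured_ball R n.+1) (pev p).
Proof.
split; first by apply: measurable_funTS; exact: measurable_pev.
have [M _ pM] := pev_bounded p.
by exists M => x /andP[_ x1]; apply: pM => i; exact: le_trans (normr_tnth_le _ _) x1.
Qed.

Lemma mder_mnorm2 i : mder i (mnorm2 R n) = mvar i *+ 2.
Proof.
rewrite /mnorm2 raddf_sum (bigD1 i)//= big1 => [|j /negbTE ji].
  by rewrite mpoly.mderivM mder_var eqxx mpoly.mpolyC1 addr0; ring.
by rewrite mpoly.mderivM mder_var eq_sym ji mpoly.mpolyC0; ring.
Qed.

Lemma rint_surface p : S (pev p) = n.+1%:R * Bint (fun x => pev p (normalize x)).
Proof.
have [M M0 pM] := pev_normalize_bounded p.
have bp := bmfun_pev p; have bpn := bmfun_pev_normalize p.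
have bcS := bmfun_cst (@sphere R n.+1) M.
have bcB := bmfun_cst (@punctured_ball R n.+1) M.
have pSM x : sphere x -> 0 <= pev p x + M.
  by move=> /normalize_sphere xE; have := pM x; rewrite xE ler_norml => /andP[+ _]; lra.
have pBM x : 0 <= pev p (normalize x) + M.
  by have := pM x; rewrite ler_norml => /andP[+ _]; lra.
(* The transport to the ball holds for nonnegative functions, so it is applied to [p + M] and to
   [M], and the two identities are subtracted. *)
have h1 : S (fun x => pev p x + M) = n.+1%:R * Bint (fun x => pev p (normalize x) + M).
  apply: EFin_inj; rewrite EFinM -(@fine_integral _ _ _ sigma _ mS Soo)//; last first.
    exact: (bmfunD bp bcS).
  rewrite -(@fine_integral _ _ _ leb _ mB Boo)//; last exact: (bmfunD bpn bcB).
  rewrite ge0_integral_surface//.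
  by apply/measurable_EFinP; exact: (bmfunD bp bcS).1.
have h2 : S (fun x => M) = n.+1%:R * Bint (fun x => M).
  apply: EFin_inj; rewrite EFinM -(@fine_integral _ _ _ sigma _ mS Soo)//.
  by rewrite -(@fine_integral _ _ _ leb _ mB Boo)// ge0_integral_surface//.
move: h1; rewrite (rintD mS Soo bp bcS) (rintD mB Boo bpn bcB) mulrDr -h2.
exact: addIr.
Qed.

Lemma ball_radial p m :
  Bint (fun x => pev p (normalize x) * enorm x ^+ m) = S (pev p) / (m + n.+1)%:R.
Proof.
have [M M0 pM] := pev_normalize_bounded p.
have bpn := bmfun_pev_normalize p.
have bcB := bmfun_cst (@punctured_ball R n.+1) M.
have be := bmfunX m (@bmfun_enorm R n).
have r1 := @ge0_ball_radial R n (fun x => pev p (normalize x) + M) (2 * M).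
have r2 := @ge0_ball_radial R n (fun x => M) M (@measurable_cst _ _ _ _ _ _) (fun=> M0) (fun=> lexx _) (fun _ _ _ => erefl) m.
have {}r1 : Bint (fun x => (pev p (normalize x) + M) * enorm x ^+ m) * (m + n.+1)%:R =
    n.+1%:R * Bint (fun x => pev p (normalize x) + M).
  apply: r1.
  - by apply: measurable_funD => //; exact: measurable_pev_normalize.
  - by move=> x; have := pM x; rewrite ler_norml => /andP[+ _]; lra.
  - by move=> x; have := pM x; rewrite ler_norml => /andP[_ +]; lra.
  - by move=> r x r0; rewrite normalize_tscale.
have dn : (m + n.+1)%:R != 0 :> R by rewrite pnatr_eq0 addnS.
apply: (mulIf dn); rewrite divfK// rint_surface.
move: r1; rewrite (rintD mB Boo bpn bcB).
rewrite (_ : Bint (fun x => (pev p (normalize x) + M) * enorm x ^+ m) =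
  Bint (fun x => pev p (normalize x) * enorm x ^+ m) + Bint (fun x => M * enorm x ^+ m)).
  by rewrite mulrDl r2 mulrDr; exact: addIr.
rewrite -(rintD mB Boo (bmfunM bpn be) (bmfunM bcB be)).
by apply: eq_rint => // x _; rewrite mulrDl.
Qed.

(** In polar form this is the integral of [r^(m + n) (1 - r^2)] over [[0, 1]]. As this coefficient
    is nonzero, the weight [1 - |x|^2], which kills boundary terms, still gives access to the
    surface integral. *)
Lemma ball_mhom p m : mhom m p ->
  Bint (pev (p * (1 - mnorm2 R n))) =
  ((m + n.+1)%:R^-1 - (m.+2 + n.+1)%:R^-1) * S (pev p).
Proof.
move=> pm; rewrite mulrBl ![_^-1 * _]mulrC -!ball_radial.
have bpn := bmfun_pev_normalize p.
have be l := bmfunX l (@bmfun_enorm R n).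
rewrite -rintB; [|exact: mB|exact: Boo|exact: (bmfunM bpn (be m))|exact: (bmfunM bpn (be m.+2))].
apply: eq_rint => // x /andP[x0 x1].
rewrite -[in LHS](tscale_normalize x0) pevM pevB pev_mnorm2 (pev_mhom _ _ pm).
rewrite pev1 dot_tscalel dot_tscaler.
have /sphereP -> := sphere_normalize x0.
by rewrite -[m.+2]addn2 exprD; ring.
Qed.

(* On the ball, [lieD i j p * (1 - |x|^2)] is a difference of two partial
   derivatives of polynomials that vanish on the sphere. *)
Lemma surface_lieD i j p : S (pev (lieD i j p)) = 0.
Proof.
have lie_lin c (q r : mpol n.+1 R) : lieD i j (c *: q + r) = c *: lieD i j q + lieD i j r.
  by rewrite /lieD !mpoly.mderivD !mpoly.mderivZ !mulrDr -!scalerAr scalerBr; ring.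
elim/mpoly.mpolyind : p => [|c a p _ _ IH].
  rewrite /lieD !mpoly.mderiv0 !mulr0 subrr.
  rewrite (eq_rint _ (g := cst 0)) ?rint_cst ?mul0r// => x _.
  by rewrite /pev mpoly.meval0.
rewrite lie_lin (eq_rint _ (g := fun x => c * pev (lieD i j (mpoly.mpolyX R a)) x + pev (lieD i j p) x)); last first.
  by move=> x _; rewrite pevD pevZ.
rewrite rintD; [|exact: mS|exact: Soo|exact/bmfunZ/bmfun_pev|exact: bmfun_pev].
rewrite rintZ; [|exact: mS|exact: Soo|exact: bmfun_pev].
rewrite IH addr0.
have Xm : mhom (mpoly.mdeg a) (lieD i j (mpoly.mpolyX R a)).
  by apply: mhom_lieD; rewrite mpoly.dhomogX.
have := ball_mhom Xm; rewrite lieD_mnorm; last first.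
  by rewrite /lieD !mpoly.mderivB -mpoly.mpolyC1 !mpoly.mderivC !mder_mnorm2; ring.
rewrite (eq_rint _ (g := fun x => pev (mder j (mvar i * mpoly.mpolyX R a * (1 - mnorm2 R n))) x -
  pev (mder i (mvar j * mpoly.mpolyX R a * (1 - mnorm2 R n))) x)); last first.
  by move=> x _; rewrite pevB.
rewrite rintB; [|exact: mB|exact: Boo|exact: bmfun_ball_pev|exact: bmfun_ball_pev].
rewrite !ball_by_parts subrr => /esym/eqP; rewrite mulf_eq0 subr_eq0 => /orP[|/eqP->].
  move=> /eqP/invr_inj/eqP; rewrite eqr_nat eqn_add2r.
  by rewrite -[X in X == _]addn0 -addn2 eqn_add2l.
by rewrite mulr0.
Qed.

End surface_integral.

(** * Harmonic polynomials and invariant functionals *)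

Section harmonic.
Context (R : realType) (n : nat).
Local Notation M := (mpol n.+1 R).
Local Notation r2 := (mnorm2 R n).
Implicit Types (p q h : M).

Definition lap p : M := \sum_(i < n.+1) mder i (mder i p).

Definition mharm l p := mhom l p /\ lap p = 0.

Lemma lapD p q : lap (p + q) = lap p + lap q.
Proof. by rewrite /lap -big_split; apply: eq_bigr => i _; rewrite !mpoly.mderivD. Qed.

Lemma lapZ c p : lap (c *: p) = c *: lap p.
Proof. by rewrite /lap scaler_sumr; apply: eq_bigr => i _; rewrite !mpoly.mderivZ. Qed.

Lemma lap0 : lap 0 = 0.
Proof. by rewrite /lap big1// => i _; rewrite !mpoly.mderiv0. Qed.

Lemma mhom0_mder i p : mhom 0 p -> mder i p = 0.
Proof.
move: p; apply: mhom_ind => [|p q IHp IHq|c a /eqP].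
- by rewrite mpoly.mderiv0.
- by rewrite mpoly.mderivD IHp IHq addr0.
- rewrite mpoly.mdeg_eq0 => /eqP->.
  by rewrite mder_scaleX mpoly.mnm0E mulr0 scale0r.
Qed.

Lemma mhom_lap m p : mhom m.+2 p -> mhom m (lap p).
Proof. by move=> pm; apply: rpred_sum => i _; do 2!apply: mhom_mder. Qed.

Lemma mhom_le1_lap m p : (m <= 1)%N -> mhom m p -> lap p = 0.
Proof.
case: m => [|[|//]] _ pm; rewrite /lap big1// => i _.
  by rewrite (mhom0_mder _ pm) mpoly.mderiv0.
by rewrite mhom0_mder//; exact: mhom_mder.
Qed.

Lemma mhom_mnorm2 : mhom 2 r2.
Proof. by apply: rpred_sum => i _; rewrite -[2%N]/(1 + 1)%N mhomM ?mhom_var. Qed.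

Lemma lap_mnorm2M e q : mhom e q ->
  lap (r2 * q) = (2 * n.+1 + 4 * e)%:R *: q + r2 * lap q.
Proof.
move=> qe; rewrite /lap.
have E i : mder i (mder i (r2 * q)) =
    2%:R *: q + 4%:R *: (mvar i * mder i q) + r2 * mder i (mder i q).
  rewrite mpoly.mderivM mpoly.mderivD !mpoly.mderivM mder_mnorm2 mpoly.mderivMn mder_var eqxx.
  by rewrite mpoly.mpolyC1 !scaler_nat; ring.
rewrite (eq_bigr _ (fun i _ => E i)) !big_split/= -mulr_sumr -!scaler_sumr (euler qe).
by rewrite sumr_const card_ord -[q *+ _]scaler_nat !scalerA -scalerDl -!natrM -natrD.
Qed.

(** The polynomials that are sums of terms [|x|^(2j) h] with [h] harmonic, of total degree [m]. Only
    existence of such a decomposition is needed, so a closure suffices instead of a direct sum. *)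
Inductive fischer : nat -> M -> Prop :=
| Fischer0 m : fischer m 0
| FischerH j l h : mharm l h -> fischer (j * 2 + l) (r2 ^+ j * h)
| FischerD m p q : fischer m p -> fischer m q -> fischer m (p + q).

Lemma lap_mnorm2X j l h : mharm l h ->
  exists2 c : R, 0 < c & lap (r2 ^+ j.+1 * h) = c *: (r2 ^+ j * h).
Proof.
move=> [hl h0]; elim: j => [|j [c c0 IH]].
  exists (2 * n.+1 + 4 * l)%:R; first by rewrite ltr0n.
  by rewrite expr1 (lap_mnorm2M hl) h0 mulr0 addr0 expr0 mul1r.
have e : mhom (2 * j.+1 + l) (r2 ^+ j.+1 * h).
  by apply: mhomM => //; exact: (mpoly.dhomogMn _ mhom_mnorm2).
exists ((2 * n.+1 + 4 * (2 * j.+1 + l))%:R + c); first by rewrite ltr_wpDl// ltr0n.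
by rewrite exprS -mulrA (lap_mnorm2M e) IH -scalerAr mulrA -exprS scalerDl.
Qed.

(** A right inverse of [lap] after multiplication by [|x|^2]: on each generator this operator is a
    positive scalar, by which one divides. *)
Lemma fischer_lap m q : fischer m q ->
  exists2 r, fischer m r & lap (r2 * r) = q.
Proof.
elim=> [{}m|j l h hl|{}m p {}q _ [r rm rp] _ [s sm sq]].
- by exists 0; [exact: Fischer0|rewrite mulr0 lap0].
- have [c c0 lc] := lap_mnorm2X j hl.
  exists (r2 ^+ j * (c^-1 *: h)).
    apply: FischerH; case: hl => hl h0.
    by split; [rewrite rpredZ|rewrite lapZ h0 scaler0].
  by rewrite mulrA -exprS -scalerAr lapZ lc scalerA mulVf ?scale1r// gt_eqF.
- by exists (r + s); [exact: FischerD|rewrite mulrDr lapD rp sq].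
Qed.

Lemma fischer_mnorm2M m q : fischer m q -> fischer m.+2 (r2 * q).
Proof.
elim=> [{}m|j l h hl|{}m p {}q _ r2p _ r2q].
- by rewrite mulr0; exact: Fischer0.
- by rewrite mulrA -exprS -addn2 -addnA (addnC l) addnA -[2%N]mul1n -mulnDl addn1; exact: FischerH.
- by rewrite mulrDr; exact: FischerD.
Qed.

(** Induction in steps of two degrees: [lap p] has a decomposition, so [lap (r2 * r) = lap p] can be
    solved within the class, and [p - r2 * r] is harmonic. *)
Lemma fischer_mhom m p : mhom m p -> fischer m p.
Proof.
elim/ltn_ind: m p => m IH p pm.
have [m1|m1] := leqP m 1.
  rewrite -[p]mul1r -(expr0 r2) -[m]/(0 * 2 + m)%N; apply: FischerH.
  by split => //; exact: mhom_le1_lap pm.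
case: m m1 => [//|[//|m]] _ in IH pm *.
have /IH : mhom m (lap p) by exact: mhom_lap.
case/(_ (leqW (leqnn _)))/fischer_lap => r rm lr.
rewrite -(subrK (r2 * r) p); apply: FischerD; last exact: fischer_mnorm2M.
rewrite -[X in fischer _ X]mul1r -(expr0 r2) -[m.+2]/(0 * 2 + m.+2)%N; apply: FischerH.
split; last by rewrite -scaleN1r lapD lapZ lr scaleN1r subrr.
rewrite rpredB//; move: rm; rewrite -[m.+2]/(2 + m)%N => rm.
apply: mhomM; first exact: mhom_mnorm2.
elim: rm => [k|j l h [hl _]|k a b _ ak _ bk].
- exact: rpred0.
- by rewrite mulnC; apply: mhomM => //; exact: (mpoly.dhomogMn _ mhom_mnorm2).
- exact: rpredD.
Qed.

Lemma fischer_sphere m p : fischer m p ->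
  exists2 h : nat -> M, forall l, mharm l (h l) &
    forall x, sphere x -> pev p x = \sum_(l < m.+1) pev (h l) x.
Proof.
have m0 l : mharm l 0 by split; [exact: rpred0|exact: lap0].
have pev0 x : pev (0 : M) x = 0 by rewrite /pev mpoly.meval0.
elim=> [{}m|j l h hl|{}m {}p q _ [h1 h1m h1p] _ [h2 h2m h2p]].
- exists (fun=> 0) => // x _; rewrite pev0.
  by rewrite big1.
- exists (fun l' => if l' == l then h else 0) => [l'|x xS].
    by case: eqP => [->|].
  have lt : (l < (j * 2 + l).+1)%N by rewrite ltnS leq_addl.
  rewrite (bigD1 (Ordinal lt))//= eqxx big1 => [|i].
    rewrite addr0 pevM [pev (r2 ^+ j) x]rmorphXn/= [mpoly.meval _ _]pev_mnorm2.
    by move/sphereP : xS => ->; rewrite expr1n mul1r.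
  by rewrite -val_eqE/= => /negbTE ->.
- exists (fun l => h1 l + h2 l) => [l|x xS].
    have [? e1] := h1m l; have [? e2] := h2m l.
    by split; [exact: rpredD|rewrite lapD e1 e2 addr0].
  rewrite pevD h1p// h2p// -big_split; apply: eq_bigr => i _.
  by rewrite pevD.
Qed.

Lemma harmonic_decomposition L p : (mpoly.msize p <= L.+1)%N ->
  exists2 h : nat -> M, forall l, mharm l (h l) &
    forall x, sphere x -> pev p x = \sum_(l < L.+1) pev (h l) x.
Proof.
move=> pL.
have H m : exists h : nat -> M, (forall l, mharm l (h l)) /\
    forall x, sphere x -> pev (mpoly.pihomog mpoly.mdeg m p) x = \sum_(l < m.+1) pev (h l) x.
  have [h hm hp] := fischer_sphere (fischer_mhom (mpoly.pihomogP mpoly.mdeg m p)).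
  by exists h.
have [h hP] := choice H.
exists (fun l => \sum_(m < L.+1 | (l <= m)%N) h m l) => [l|x xS].
  split; first by apply: rpred_sum => m _; have [/(_ l)[]] := hP m.
  elim/big_rec : _ => [|m q _ IH]; first exact: lap0.
  by rewrite lapD IH addr0; have [/(_ l)[]] := hP m.
rewrite {1}(mpoly.pihomog_partitionE (mf := mpoly.mdeg) pL) pev_sum.
under [RHS]eq_bigr do rewrite pev_sum.
rewrite (exchange_big_dep xpredT)//=; apply: eq_bigr => m _.
have [_ ->//] := hP m.
rewrite (big_ord_widen L.+1 (fun l => pev (h m l) x))//.
Qed.

End harmonic.

Lemma surface_measureI (R : realType) n (A : set (n.+1.-tuple R)) :
  surface_measure (A `&` sphere) = surface_measure A.
Proof.
rewrite /surface_measure (_ : normalize @^-1` (A `&` sphere) `&` punctured_ball =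
  normalize @^-1` A `&` punctured_ball)//.
apply/seteqP; split=> [x [[]]//|x [Ax Bx]].
by split=> //; split => //; apply: sphere_normalize; case/andP: Bx.
Qed.

(** * Rotation-invariant functionals and orthogonality of degrees *)

Section lie_invariant.
Context (R : realType) (n : nat).
Hypothesis n_gt0 : (0 < n)%N.
Local Notation M := (mpol n.+1 R).
Local Notation r2 := (mnorm2 R n).
Local Notation sigma := (@surface_measure R n).
Local Notation S f := (\int[sigma]_(x in sphere) f x).
Implicit Types (p q f : M) (J : M -> R).

Let mS : measurable (@sphere R n.+1) := @measurable_sphere R n.+1.
Let Soo := @surface_sphere_lty R n.

(* Rotation invariance, stated infinitesimally, of a functional that only sees
   the restriction of a polynomial to the sphere. *)
Definition lie_inv J := [/\ forall c p q, J (c *: p + q) = c * J p + J q,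
  forall p, J (r2 * p) = J p & forall i j p, J (lieD i j p) = 0].

Section theory.
Variables (J : M -> R) (JP : lie_inv J).

Lemma lie_inv0 : J 0 = 0.
Proof. by have [/(_ (-1) 0 0) + _ _] := JP; rewrite scaler0 addr0; lra. Qed.

Lemma lie_invD p q : J (p + q) = J p + J q.
Proof. by have [/(_ 1 p q) + _ _] := JP; rewrite scale1r mul1r. Qed.

Lemma lie_invZ c p : J (c *: p) = c * J p.
Proof. by have [/(_ c p 0) + _ _] := JP; rewrite lie_inv0 !addr0. Qed.

Lemma lie_inv_sum (I : Type) (s : seq I) (P : pred I) (F : I -> M) :
  J (\sum_(i <- s | P i) F i) = \sum_(i <- s | P i) J (F i).
Proof. exact: (big_morph J lie_invD lie_inv0). Qed.

(* Apply [J] to [\sum_i lieD i j (x_i f)] and use Euler's identity. *)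
Lemma lie_inv_rec m f j : mhom m f -> (n + m)%:R * J (mvar j * f) = J (mder j f).
Proof.
move=> fm; have [_ Jr JD] := JP.
have : J (\sum_(i < n.+1) lieD i j (mvar i * f)) = 0.
  by rewrite lie_inv_sum big1.
have -> : \sum_(i < n.+1) lieD i j (mvar i * f) =
    r2 * mder j f + (1 - (n.+1 + m)%:R) *: (mvar j * f).
  rewrite (eq_bigr (fun i => (mvar i * mvar i * mder j f +
      mvar i * mpoly.mpolyC n.+1 (j == i)%:R * f) -
      (mvar j * f + mvar j * (mvar i * mder i f)))); last first.
    move=> i _; rewrite /lieD !mpoly.mderivM !mder_var eqxx mpoly.mpolyC1; ring.
  rewrite sumrB !big_split/= -!mulr_suml -!mulr_sumr (euler fm) sumr_const card_ord.
  rewrite -[mvar j *+ _]scaler_nat -!scalerAr -!scalerAl.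
  have -> : \sum_(i < n.+1) mvar i * mpoly.mpolyC n.+1 (j == i)%:R = mvar j :> M.
    rewrite (bigD1 j)//= big1 => [|i /negbTE ij].
      by rewrite eqxx mpoly.mpolyC1 mulr1 addr0.
    by rewrite eq_sym ij mpoly.mpolyC0 mulr0.
  by rewrite -/(mnorm2 R n) scalerBl scale1r natrD scalerDl; ring.
rewrite lie_invD lie_invZ Jr => h.
rewrite (_ : 1 - _ = - (n + m)%:R :> R) in h; last by rewrite addSn -natr1; ring.
lra.
Qed.

(** By [lie_inv_rec] the value at a monomial of positive degree is a multiple of the value at one of
    its second-order descendants, of degree two less, or is 0. The coefficient [n + deg b] can be
    divided out because [n > 0]. *)
Lemma lie_inv_eq0 : J 1 = 0 -> forall p, J p = 0.
Proof.
move=> J1 p; rewrite [p]mpoly.mpolyE lie_inv_sum big1// => a _; rewrite lie_invZ.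
suff -> : J (mpoly.mpolyX R a) = 0 by rewrite mulr0.
have [m] : exists m, mpoly.mdeg a = m by exists (mpoly.mdeg a).
elim/ltn_ind: m a => m IH a am.
have [a0|] := eqVneq a (mpoly.mnm0); first by rewrite a0 mpoly.mpolyX0.
rewrite -mpoly.mdeg_eq0 mpoly.mdegE sum_nat_eq0 negb_forall => /existsP[i /= ai].
rewrite -(mnm_subU1K ai) mpoly.addmC mpoly.mpolyXD.
set b := mpoly.mnm_sub a _.
have bm : (mpoly.mdeg b).+1 = m.
  by rewrite -am -(mnm_subU1K ai) mpoly.mdegD mpoly.mdeg1 addn1.
have := @lie_inv_rec (mpoly.mdeg b) (mpoly.mpolyX R b) i.
rewrite mpoly.dhomogX eqxx => /(_ isT).
rewrite -[X in mder _ X]scale1r mder_scaleX mul1r lie_invZ.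
have [->|bi] := eqVneq (b i) 0%N.
  by rewrite mul0r => /eqP; rewrite mulf_eq0 pnatr_eq0 addn_eq0 eqn0Ngt n_gt0/= => /eqP.
rewrite (IH (mpoly.mdeg (mpoly.mnm_sub b (mpoly.mnm1 i))))//; last first.
  by rewrite -bm ltnS (leq_trans (mpoly.mdegB _ _)).
by rewrite mulr0 => /eqP; rewrite mulf_eq0 pnatr_eq0 addn_eq0 eqn0Ngt n_gt0/= => /eqP.
Qed.

End theory.

Lemma surface_lie_inv : lie_inv (fun p => S (pev p)).
Proof.
split=> [c p q|p|i j p]; last exact: surface_lieD.
  rewrite (eq_rint _ (g := fun x => c * pev p x + pev q x)); last first.
    by move=> x _; rewrite pevD pevZ.
  rewrite (rintD mS Soo); [|exact/bmfunZ/bmfun_pev|exact: bmfun_pev].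
  by rewrite (rintZ mS Soo)//; exact: bmfun_pev.
by apply: eq_rint => x /sphereP xS; rewrite pevM pev_mnorm2 xS mul1r.
Qed.

Lemma surface_sphere_gt0 : 0 < S (pev 1).
Proof.
rewrite (eq_rint _ (g := cst 1)); last by move=> x _; rewrite pev1.
rewrite rint_cst// mul1r fine_gt0// Soo andbT.
pose x : n.+1.-tuple R := [tuple (i == ord0)%:R | i < n.+1].
have xS : sphere x.
  apply/sphereP; rewrite /dot (bigD1 ord0)//= big1 => [|i /negbTE i0].
    by rewrite tnth_mktuple eqxx mulr1 addr0.
  by rewrite tnth_mktuple i0 mulr0.
apply: (lt_le_trans (@surface_cube_gt0 R n x 1 xS ltr01)).
rewrite -surface_measureI; apply: le_measure; rewrite ?inE//.
by apply: measurableI => //; exact: measurable_cube.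
Qed.

(** The combination of the two functionals that vanishes at [1] is again invariant, hence zero. *)
Lemma lie_inv_surface J : lie_inv J -> forall p, J p * S (pev 1) = J 1 * S (pev p).
Proof.
move=> JP p; apply/eqP; rewrite -subr_eq0; apply/eqP.
have [SL SR SD] := surface_lie_inv; have [JL JR JD] := JP.
apply: (@lie_inv_eq0 (fun p => J p * S (pev 1) - J 1 * S (pev p))); last by rewrite subrr.
split=> [c a b|a|i j a].
- by rewrite JL SL; ring.
- by rewrite JR SR.
- by rewrite JD SD; ring.
Qed.

(* [l (n + l + m - 1) J (p q) = J (grad p . grad q)], and the right-hand side is
   symmetric in [l] and [m]. *)
Lemma mharm_orth l m p q : mharm l p -> mharm m q -> l != m -> S (pev (p * q)) = 0.
Proof.
have JP := surface_lie_inv; set J := fun p => S (pev p) in JP.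
have grad l' m' p' q' : mharm l' p' -> mharm m' q' ->
    l'%:R * ((n + (l' + m'))%:R - 1) * J (p' * q') =
    J (\sum_(i < n.+1) mder i p' * mder i q').
  move=> [pl p0] [qm q0].
  case: l' => [|l'] in pl *.
    rewrite mul0r mul0r big1 ?(lie_inv0 JP)// => i _.
    by rewrite (mhom0_mder _ pl) mul0r.
  have -> : ((n + (l'.+1 + m'))%:R - 1 : R) = (n + (l' + m'))%:R.
    by rewrite addSn addnS -natr1; ring.
  have e : l'.+1%:R * J (p' * q') = \sum_(i < n.+1) J (mvar i * (mder i p' * q')).
    rewrite -(lie_invZ JP) scalerAl -(euler pl) mulr_suml (lie_inv_sum JP).
    by apply: eq_bigr => i _; rewrite mulrA.
  rewrite mulrAC e mulrC mulr_sumr.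
  have fm i : mhom (l' + m') (mder i p' * q') by rewrite mhomM// mhom_mder.
  under eq_bigr do rewrite (lie_inv_rec JP _ (fm _)) mpoly.mderivM (lie_invD JP).
  rewrite big_split/= -!(lie_inv_sum JP) -mulr_suml.
  by rewrite [\sum_(i < n.+1) _](_ : _ = lap p')// p0 mul0r (lie_inv0 JP) add0r.
move=> pl qm lm.
have h1 := grad _ _ _ _ pl qm; have h2 := grad _ _ _ _ qm pl.
have : (l%:R - m%:R) * ((n + (l + m))%:R - 1) * J (p * q) = 0.
  rewrite mulrBl mulrBl h1 (addnC l) (mulrC p) h2.
  apply/eqP; rewrite subr_eq0; apply/eqP; congr J.
  by apply: eq_bigr => i _; rewrite mulrC.
move/eqP; rewrite !mulf_eq0 subr_eq0 eqr_nat (negbTE lm)/= => /orP[|/eqP//].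
(* The factor [n + l + m - 1] vanishes only for [l = m = 0], since [n >= 1]. *)
rewrite -[X in _ - X]/(1%:R) subr_eq0 eqr_nat => /eqP nlm.
have : (l + m <= 0)%N by rewrite -(leq_add2l n) addn0 nlm.
by rewrite leqn0 addn_eq0 => /andP[/eqP l0 /eqP m0]; rewrite l0 m0 eqxx in lm.
Qed.

End lie_invariant.

(** * Reproducing kernels *)

Section repro.
Context (R : realType) (n : nat).
Local Notation T := (n.+1.-tuple R).
Local Notation M := (mpol n.+1 R).
Local Notation sigma := (@surface_measure R n).
Local Notation S f := (\int[sigma]_(x in sphere) f x).
Implicit Types (p q g : M) (V : M -> Prop) (gs zs : seq M).

Let mS : measurable (@sphere R n.+1) := @measurable_sphere R n.+1.
Let Soo := @surface_sphere_lty R n.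

(** If [p x] is nonzero, the Lipschitz bound keeps [|p|] above [|p x| / 2] on a cube around [x], and
    its trace on the sphere has positive measure. *)
Lemma poly_eq0_sphere p : S (pev (p * p)) = 0 -> forall x, sphere x -> pev p x = 0.
Proof.
move=> pp0 x xS; apply/eqP/negP => /negP px.
have v0 : 0 < `|pev p x| / 2 by rewrite divr_gt0// normr_gt0.
set v := `|pev p x| / 2 in v0.
have [L L0 pL] := pev_lipschitz p.
pose r := v / (L + 1).
have L1 : 0 < L + 1 by lra.
have r0 : 0 < r by rewrite divr_gt0.
have rv : L * r <= v by rewrite /r mulrCA ger_pMr// ler_pdivrMr// mul1r; lra.
pose chi : T -> R := \1_(cube x r).
have bchi : bmfun (@sphere R n.+1) chi.
  split; first by apply: measurable_funTS; apply: measurable_indic; exact: measurable_cube.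
  by exists 1 => y _; rewrite /chi indicE; case: (_ \in _); rewrite ?normr1 ?normr0.
have : S (fun y => v ^+ 2 * chi y) <= S (pev (p * p)).
  apply: le_rint => //; [exact: bmfunZ|exact: bmfun_pev|move=> y yS].
  rewrite pevM -expr2 /chi indicE; have [yx|yx] := boolP (y \in cube x r); last first.
    by rewrite mulr0 sqr_ge0.
  rewrite mulr1 -[leRHS]real_normK ?num_real// lerXn2r ?nnegrE ?(ltW v0)//.
  have : `|pev p y - pev p x| <= v.
    apply: le_trans rv; apply: pL => // i; try exact: sphere_tnth_le1.
    by move: yx; rewrite inE => /(_ i).
  rewrite distrC => h; have := ler_normB (pev p x) (pev p x - pev p y).
  rewrite (_ : pev p x - (pev p x - pev p y) = pev p y); last by ring.
  have := ler_distD 0 (pev p x) (pev p y).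
  have : `|pev p x| <= `|pev p x - pev p y| + `|pev p y|.
    by rewrite -[X in `|X| <= _](subrK (pev p y)) ler_normD.
  rewrite /v in h *; lra.
rewrite pp0 rintZ// => h.
have c0 : 0 < S chi.
  have -> : S chi = fine (sigma (cube x r)).
    rewrite /Rintegral integral_indic//; last exact: measurable_cube.
    by rewrite [X in fine X]surface_measureI.
  rewrite fine_gt0// surface_cube_gt0//=.
  rewrite -surface_measureI (le_lt_trans _ Soo)// le_measure ?inE//.
  by apply: measurableI => //; exact: measurable_cube.
by move: h; rewrite leNgt mulr_gt0// exprn_gt0.
Qed.

Definition zeroS p := forall x, sphere x -> pev p x = 0.

(** Linear span modulo the polynomials that vanish on the sphere. Removing one generator at a time
    is the recursion that Gram-Schmidt follows. *)
Fixpoint spanS gs p : Prop :=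
  if gs is g :: gs then exists a : R, spanS gs (p - a *: g) else zeroS p.

Lemma spanS_lin gs c p q : spanS gs p -> spanS gs q -> spanS gs (c *: p + q).
Proof.
elim: gs p q => [|g gs IH] p q /=.
  by move=> p0 q0 x xS; rewrite pevD pevZ p0// q0// mulr0 addr0.
move=> [a pa] [b qb]; exists (c * a + b).
have := IH _ _ pa qb; congr spanS.
by rewrite scalerBr scalerA scalerDl opprD addrACA.
Qed.

Lemma zeroS_spanS gs p : zeroS p -> spanS gs p.
Proof.
elim: gs => //= g gs IH p0; exists 0; rewrite scale0r subr0; exact: IH.
Qed.

Lemma zeroS0 : zeroS 0.
Proof. by move=> x _; rewrite /pev mpoly.meval0. Qed.

Lemma spanSD gs p q : spanS gs p -> spanS gs q -> spanS gs (p + q).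
Proof. by move=> gp gq; rewrite -[p]scale1r; exact: spanS_lin. Qed.

Lemma spanSZ gs c p : spanS gs p -> spanS gs (c *: p).
Proof. by move=> gp; rewrite -[_ *: _]addr0; apply: spanS_lin => //; exact/zeroS_spanS/zeroS0. Qed.

Lemma spanS_mem gs g : g \in gs -> spanS gs g.
Proof.
elim: gs => //= h gs IH; rewrite inE => /orP[/eqP<-|/IH ?].
  by exists 1; rewrite scale1r subrr; exact/zeroS_spanS/zeroS0.
by exists 0; rewrite scale0r subr0.
Qed.

Lemma spanS_sum gs (I : Type) (s : seq I) (P : pred I) (F : I -> M) :
  (forall i, P i -> spanS gs (F i)) -> spanS gs (\sum_(i <- s | P i) F i).
Proof.
move=> h; elim/big_ind : _ => //; first exact/zeroS_spanS/zeroS0.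
exact: spanSD.
Qed.

Lemma spanS_eq gs p q : zeroS (p - q) -> spanS gs q -> spanS gs p.
Proof. by move=> pq gq; rewrite -(subrK q p); apply: spanSD => //; exact: zeroS_spanS. Qed.

Definition ip p q := S (pev (p * q)).

Lemma ipC p q : ip p q = ip q p. Proof. by rewrite /ip mulrC. Qed.

Lemma ip_linl c p q g : ip (c *: p + q) g = c * ip p g + ip q g.
Proof.
rewrite /ip mulrDl -scalerAl; have [SL _ _] := @surface_lie_inv R n.
exact: SL.
Qed.

Lemma eq_ip p q g : zeroS (p - q) -> ip p g = ip q g.
Proof.
move=> pq; apply: eq_rint => x xS; rewrite !pevM; congr (_ * _).
by apply/eqP; rewrite -subr_eq0 -pevB pq.
Qed.

Lemma ip_ge0 p : 0 <= ip p p.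
Proof. by apply: rint_ge0 => // x _; rewrite pevM -expr2 sqr_ge0. Qed.

Definition subspace V := V 0 /\ forall c p q, V p -> V q -> V (c *: p + q).

(** An orthonormal basis of the restrictions of [V] to the sphere: different polynomials may have
    the same restriction, so the expansion is asserted modulo [zeroS]. *)
Definition orthobasis V zs := [/\ {in zs, forall z, V z},
  pairwise (fun z w => ip z w == 0) zs, {in zs, forall z, ip z z = 1} &
  forall p, V p -> zeroS (p - \sum_(z <- zs) ip p z *: z)].

Lemma subspace_sum V (I : eqType) (s : seq I) (F : I -> M) : subspace V ->
  {in s, forall i, V (F i)} -> V (\sum_(i <- s) F i).
Proof.
move=> [V0 VD] VF; rewrite big_seq; elim/big_ind : _ => // p q Vp Vq.
by rewrite -[p]scale1r; exact: VD.
Qed.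

Lemma subspaceZ V c p : subspace V -> V p -> V (c *: p).
Proof. by move=> [V0 VD] Vp; rewrite -[_ *: _]addr0; exact: VD. Qed.

Lemma ip_suml (I : Type) (s : seq I) (P : pred I) (F : I -> M) g :
  ip (\sum_(i <- s | P i) F i) g = \sum_(i <- s | P i) ip (F i) g.
Proof.
elim/big_rec2 : _ => [|i p q _ <-].
  by have := ip_linl (-1) 0 0 g; rewrite scaler0 addr0; lra.
by rewrite -[F i]scale1r ip_linl scale1r mul1r.
Qed.

Lemma ipZl c p q : ip (c *: p) q = c * ip p q.
Proof.
have ip0 : ip 0 q = 0 by have := ip_linl (-1) 0 0 q; rewrite scaler0 addr0; lra.
by rewrite -[_ *: _]addr0 ip_linl ip0 addr0.
Qed.

Lemma orthobasis_ip V zs z (c : M -> R) : orthobasis V zs -> uniq zs -> z \in zs ->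
  ip (\sum_(w <- zs) c w *: w) z = c z.
Proof.
move=> [_ po on _] uz zz; rewrite ip_suml (bigD1_seq z)//= ipZl on// mulr1.
rewrite big_seq_cond big1 ?addr0// => w /andP[wz wNz]; rewrite ipZl.
suff -> : ip w z = 0 by rewrite mulr0.
elim: zs po {uz on} zz wz => //= a s IH /andP[/allP as0 po].
rewrite !inE => /orP[/eqP az|zs] /orP[/eqP aw|ws].
- by rewrite aw az eqxx in wNz.
- by rewrite ipC az; apply/eqP/as0.
- by rewrite aw; apply/eqP/as0.
- exact: IH.
Qed.

Lemma orthobasis_uniq V zs : orthobasis V zs -> uniq zs.
Proof.
move=> [_ + on _]; elim: zs on => //= a s IH on /andP[/allP as0 po].
rewrite IH ?andbT//; last by move=> z zs; apply: on; rewrite inE zs orbT.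
apply/negP => /as0; rewrite on ?inE ?eqxx// oner_eq0//.
Qed.

(** Gram-Schmidt by induction on the generators. The part [V'] of [V] spanned without [g] has
    codimension at most one in [V]; a vector outside it, made orthogonal to the basis of [V'] and
    normalized, is the one element to add. *)
Lemma orthobasis_exists V gs : subspace V -> (forall p, V p -> spanS gs p) ->
  exists2 zs, orthobasis V zs & (size zs <= size gs)%N.
Proof.
elim: gs V => [|g gs IH] V VS Vg.
  exists [::] => //; split=> // p /Vg /= p0; rewrite big_nil subr0; exact: p0.
pose V' p := V p /\ spanS gs p.
have [V0 VD] := VS.
have V'S : subspace V'.
  split; first by split=> //; exact/zeroS_spanS/zeroS0.
  by move=> c p q [Vp gp] [Vq gq]; split; [exact: VD|exact: spanS_lin].
have [zs zsV' zsg] := IH V' V'S (fun p => @proj2 _ _).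
have uzs := orthobasis_uniq zsV'.
have [zV' po on ex] := zsV'.
have [allV'|] := pselect (forall p, V p -> spanS gs p).
  exists zs; last exact: leqW.
  by split=> // [z /zV'[]//|p Vp]; apply: ex; split => //; exact: allV'.
move=> /existsNP[v /not_implyP[Vv vNg]].
pose w := v - \sum_(z <- zs) ip v z *: z.
have sV' : V' (\sum_(z <- zs) ip v z *: z).
  by apply: (subspace_sum V'S) => z /zV' ?; exact: subspaceZ.
have Vw : V w by rewrite /w addrC -scaleN1r; apply: VD => //; case: sV'.
have wNg : ~ spanS gs w.
  move=> gw; apply: vNg; rewrite -[v](subrK (\sum_(z <- zs) ip v z *: z)).
  by apply: spanSD => //; case: sV'.
have w0 : 0 < ip w w.
  rewrite lt_def ip_ge0 andbT; apply/eqP => /poly_eq0_sphere w0.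
  by apply: wNg; exact: zeroS_spanS.
have wz z : z \in zs -> ip w z = 0.
  move=> zz; rewrite /w addrC -scaleN1r ip_linl (orthobasis_ip _ zsV')//; ring.
have [b wb] := Vg _ Vw.
have b0 : b != 0.
  by apply/eqP => b0; apply: wNg; rewrite b0 scale0r subr0 in wb.
pose s := Num.sqrt (ip w w).
have s0 : 0 < s by rewrite sqrtr_gt0.
have ss : s * s = ip w w by rewrite -expr2 sqr_sqrtr// ltW.
pose z0 := s^-1 *: w.
have z0z z : z \in zs -> ip z0 z = 0 by move=> zz; rewrite ipZl wz// mulr0.
have z00 : ip z0 z0 = 1.
  by rewrite ipZl ipC ipZl -ss; field; rewrite gt_eqF.
have Vz0 : V z0 by exact: subspaceZ.
exists (z0 :: zs) => //; split.
- by move=> z; rewrite inE => /orP[/eqP->//|/zV'[]].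
- by rewrite /= po andbT; apply/allP => z /z0z ->.
- by move=> z; rewrite inE => /orP[/eqP->//|/on].
- move=> p Vp; have [a pa] := Vg _ Vp.
  (* Since [w = s *: z0], subtracting [t *: z0] removes [a / b] times [w] and cancels the
     coefficient of [g]; orthogonality to [V'] then identifies [t] with [ip p z0]. *)
  pose t := a / b * s.
  have V'p : V' (p - t *: z0).
    split; first by rewrite addrC -scaleNr; apply: VD.
    have := spanS_lin (- (a / b)) wb pa; congr spanS.
    rewrite /t /z0 scalerA -mulrA divff ?gt_eqF// mulr1 scalerBr scalerA mulNr divfK//.
    by rewrite !scaleNr opprK; ring.
  have tE : t = ip p z0.
    have e := eq_ip z0 (ex _ V'p).
    have : ip (p - t *: z0) z0 = 0.
      rewrite e ip_suml big_seq big1// => z zz.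
      by rewrite ipZl [ip z _]ipC z0z// mulr0.
    by rewrite addrC -scaleNr ip_linl z00; lra.
  have := ex _ V'p; rewrite big_cons -tE.
  have -> : \sum_(z <- zs) ip (p - t *: z0) z *: z = \sum_(z <- zs) ip p z *: z.
    apply: eq_big_seq => z zz; congr (_ *: _).
    by rewrite addrC -scaleNr ip_linl z0z// mulr0 add0r.
  by rewrite opprD addrA.
Qed.

End repro.

Section repro_kernel.
Context (R : realType) (n : nat).
Local Notation T := (n.+1.-tuple R).
Local Notation M := (mpol n.+1 R).
Local Notation sigma := (@surface_measure R n).
Local Notation S f := (\int[sigma]_(x in sphere) f x).
Implicit Types (p q g : M) (V : M -> Prop) (gs zs : seq M) (K : T -> T -> R).

Let mS : measurable (@sphere R n.+1) := @measurable_sphere R n.+1.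
Let Soo := @surface_sphere_lty R n.

Definition rk V K :=
  (forall x, sphere x -> exists2 p, V p & forall y, sphere y -> K x y = pev p y) /\
  (forall p x, V p -> sphere x -> S (fun y => K x y * pev p y) = pev p x).

(** The integral of [K x] against [K' y] is evaluated by either reproducing property; symmetry and
    uniqueness both follow. *)
Lemma rk_transpose V K K' x y : rk V K -> rk V K' -> sphere x -> sphere y -> K x y = K' y x.
Proof.
move=> [K1 K2] [K1' K2'] xS yS.
have [p Vp pK] := K1 x xS; have [q Vq qK] := K1' y yS.
rewrite pK// qK// -(K2' _ _ Vp yS) -(K2 _ _ Vq xS); apply: eq_rint => z zS.
by rewrite pK// qK// mulrC.
Qed.

Lemma rk_sym V K x y : rk V K -> sphere x -> sphere y -> K x y = K y x.
Proof. by move=> rK; apply: (rk_transpose rK rK). Qed.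

Lemma rk_uniq V K K' x y : rk V K -> rk V K' -> sphere x -> sphere y -> K x y = K' x y.
Proof. by move=> rK rK' xS yS; rewrite (rk_transpose rK rK')// (rk_sym rK'). Qed.

Lemma ipE p q : S (fun y => pev p y * pev q y) = ip p q.
Proof. by apply: eq_rint => y _; rewrite pevM. Qed.

Lemma rk_orthobasis V zs : subspace V -> orthobasis V zs ->
  rk V (fun x y => \sum_(z <- zs) pev z x * pev z y).
Proof.
move=> VS zsV; have [zV _ _ ex] := zsV; split=> [x xS|p x Vp xS].
  exists (\sum_(z <- zs) pev z x *: z).
    by apply: (subspace_sum VS) => z /zV ?; exact: subspaceZ.
  by move=> y yS; rewrite pev_sum; apply: eq_bigr => z _; rewrite pevZ.
have /eqP := ex _ Vp x xS; rewrite pevB subr_eq0 => /eqP ->; rewrite pev_sum.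
transitivity (ip (\sum_(z <- zs) pev z x *: z) p).
  rewrite -ipE; apply: eq_rint => y _; rewrite pev_sum; congr (_ * _).
  by apply: eq_bigr => z _; rewrite pevZ.
rewrite ip_suml; apply: eq_bigr => z _.
by rewrite ipZl pevZ mulrC ipC.
Qed.

Lemma mhom_msize l p : mhom l p -> (mpoly.msize p <= l.+1)%N.
Proof.
move=> /mpoly.dhomogP pl; rewrite mpoly.msizeE big_seq.
by elim/big_ind : _ => // [a b al bl|m /pl /= ->//]; rewrite geq_max al.
Qed.

Lemma spanS_msize L p : (mpoly.msize p <= L)%N ->
  spanS [seq mpoly.mpolyX R (mpoly.bmnm m) | m <- enum {: mpoly.bmultinom n.+1 L}] p.
Proof.
move=> pL; rewrite (mpoly.mpolywE pL); apply: spanS_sum => m _.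
by apply: spanSZ; apply: spanS_mem; apply: map_f; rewrite mem_enum.
Qed.

Lemma subspace_mharm l : subspace (@mharm R n l).
Proof.
split; first by split; [exact: rpred0|exact: lap0].
move=> c p q [pl p0] [ql q0]; split; first by rewrite rpredD// rpredZ.
by rewrite lapD lapZ p0 q0 scaler0 addr0.
Qed.

Lemma spherical_harmonicP l (f : T -> R) : spherical_harmonic l f <->
  exists2 p, mharm l p & forall x, sphere x -> f x = pev p x.
Proof. by split=> [[p [? ? ?]]|[p [? ?] ?]]; exists p. Qed.

(** [|f b| <= B (f^2 + 1)], and the sphere has finite measure. *)
Lemma integrable_mul_bm (f b : T -> R) : square_integrable f ->
  bmfun (@sphere R n.+1) b -> sigma.-integrable sphere (EFin \o (fun x => f x * b x)).
Proof.
move=> [mf f2] [mb [B bB]].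
have i1 : sigma.-integrable sphere (EFin \o (fun x => B * (f x ^+ 2 + 1))).
  apply: (eq_integrable _ (fun x => B%:E * ((f x ^+ 2)%:E + (EFin \o cst 1%R) x))%E) => //.
  apply: integrableZl => //; apply: integrableD => //.
  by apply: bmfun_integrable => //; exact: bmfun_cst.
apply: le_integrable i1 => //.
  by apply/measurable_EFinP; exact: measurable_funM.
move=> x xS /=; rewrite lee_fin !normrM mulrC.
have B0 : 0 <= B by apply: le_trans (bB _ xS).
have F0 : 0 <= f x ^+ 2 + 1 by rewrite addr_ge0 ?sqr_ge0.
rewrite (ger0_norm B0) (ger0_norm F0) ler_pM// ?bB//.
rewrite -[f x ^+ 2]real_normK ?num_real//; have := sqr_ge0 (`|f x| - 1); have := normr_ge0 (f x).
nra.
Qed.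

Lemma square_integrable_bm (f : T -> R) : bmfun (@sphere R n.+1) f -> square_integrable f.
Proof.
move=> bf; split; first exact: bf.1.
have := bmfun_integrable mS Soo (bmfunX 2 bf); exact.
Qed.

Lemma integrable_scale c (f : T -> R) : sigma.-integrable sphere (EFin \o f) ->
  sigma.-integrable sphere (EFin \o (fun x => c * f x)).
Proof.
move=> fi; apply: (eq_integrable _ (fun x => c%:E * (EFin \o f) x)%E) => //.
exact: integrableZl.
Qed.

Lemma rint_sum_integrable (I : Type) (s : seq I) (F : I -> T -> R) :
  (forall i, sigma.-integrable sphere (EFin \o F i)) ->
  S (fun x => \sum_(i <- s) F i x) = \sum_(i <- s) S (F i).
Proof.
move=> Fi; elim: s => [|i s IH].
  rewrite big_nil (eq_rint _ (g := cst 0)) ?rint_cst ?mul0r// => y _.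
  by rewrite big_nil.
rewrite big_cons -IH -RintegralD//; first by apply: eq_rint => y _; rewrite big_cons.
apply: (eq_integrable _ (fun x => \sum_(i <- s) (EFin \o F i) x)%E) => //.
  by move=> x _; rewrite /= sumEFin.
exact: integrable_sum.
Qed.

(** This gives content to [proj_kernel], which is chosen by [xget]. The function [f] is only square
    integrable, so its projection is built from its Fourier coefficients in an orthonormal basis. *)
Lemma is_proj_kernel_exists l : exists K, is_proj_kernel l K.
Proof.
have [zs zsV _] := orthobasis_exists (@subspace_mharm l) (fun p lp => spanS_msize (mhom_msize lp.1)).
have [zV _ _ ex] := zsV.
have [K1 K2] := rk_orthobasis (@subspace_mharm l) zsV.
exists (fun x y => \sum_(z <- zs) pev z x * pev z y); split.
  by move=> x /K1; rewrite spherical_harmonicP.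
move=> f f2.
have fz z : sigma.-integrable sphere (EFin \o (fun x => f x * pev z x)).
  by apply: integrable_mul_bm => //; exact: bmfun_pev.
pose c z := S (fun y => f y * pev z y).
pose g := \sum_(z <- zs) c z *: z.
have gE x : S (fun y => (\sum_(z <- zs) pev z x * pev z y) * f y) = pev g x.
  transitivity (S (fun y => \sum_(z <- zs) pev z x * (f y * pev z y))).
    by apply: eq_rint => y _; rewrite mulr_suml; apply: eq_bigr => z _; ring.
  rewrite /g pev_sum {g}.
  rewrite rint_sum_integrable; last by move=> z; exact: integrable_scale.
  by apply: eq_bigr => z _; rewrite RintegralZl// pevZ mulrC.
split.
  rewrite spherical_harmonicP; exists g => // .
  by apply: (subspace_sum (@subspace_mharm l)) => z /zV ?; apply: subspaceZ => //; exact: subspace_mharm.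
move=> h /spherical_harmonicP[q ql hq].
transitivity (S (fun x => f x * pev q x - pev g x * pev q x)).
  by apply: eq_rint => x xS; rewrite gE hq// mulrBl.
rewrite RintegralB//; last first.
  by apply: bmfun_integrable => //; apply: bmfunM; exact: bmfun_pev.
rewrite ipE {1}/g ip_suml.
have qE x : sphere x -> pev q x = \sum_(z <- zs) ip q z * pev z x.
  move=> xS; have /eqP := ex _ ql x xS; rewrite pevB subr_eq0 => /eqP->.
  by rewrite pev_sum; apply: eq_bigr => z _; rewrite pevZ.
rewrite (eq_rint _ (g := fun x => \sum_(z <- zs) ip q z * (f x * pev z x))); last first.
  by move=> x xS; rewrite qE// mulr_sumr; apply: eq_bigr => z _; ring.
rewrite rint_sum_integrable; last by move=> z; exact: integrable_scale.
apply/eqP; rewrite subr_eq0; apply/eqP; apply: eq_bigr => z _.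
by rewrite RintegralZl// ipZl mulrC ipC.
Qed.

(** For [p] harmonic of degree [l], the difference between [p] and its projection is itself a
    legitimate test function, hence orthogonal to itself and zero on the sphere. *)
Lemma rk_proj_kernel l : rk (@mharm R n l) (@proj_kernel R n l).
Proof.
have [K KP] := is_proj_kernel_exists l.
have : is_proj_kernel l (@proj_kernel R n l).
  exact: (@xgetPex _ _ [set K | is_proj_kernel l K] (ex_intro _ K KP)).
move=> [P1 P2]; split => [x /P1/spherical_harmonicP//|p x lp xS].
have [] := P2 (pev p) (square_integrable_bm (bmfun_pev p)).
move=> /spherical_harmonicP[q lq qE] orth.
have lpq : mharm l (p - q).
  have [_ VD] := subspace_mharm l.
  by rewrite addrC -scaleN1r; exact: VD.
have := orth (pev (p - q)) => /(_ _)/wrap[].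
  by apply/spherical_harmonicP; exists (p - q).
move=> pq0; have : zeroS (p - q).
  apply: poly_eq0_sphere; rewrite -[RHS]pq0; apply: eq_rint => y yS.
  by rewrite pevM [in RHS]qE// -pevB.
by move=> /(_ x xS); rewrite pevB qE// => /eqP; rewrite subr_eq0 => /eqP.
Qed.

Definition mdeg_le L p := (mpoly.msize p <= L.+1)%N.

Lemma subspace_mdeg_le L : subspace (fun p => mdeg_le L p).
Proof.
split; first by rewrite /mdeg_le mpoly.msize0.
move=> c p q pL qL; apply: (leq_trans (mpoly.msizeD_le _ _)).
rewrite geq_max; apply/andP; split; last exact: qL.
by apply: leq_trans pL; exact: mpoly.msizeZ_le.
Qed.

Lemma mharm_mdeg_le L l p : (l <= L)%N -> mharm l p -> mdeg_le L p.
Proof. by move=> lL [pl _]; rewrite /mdeg_le (leq_trans (mhom_msize pl)). Qed.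

Definition proj_le L x y := \sum_(l < L.+1) @proj_kernel R n l x y.

Lemma proj_kernel_bm l x : sphere x -> bmfun (@sphere R n.+1) (@proj_kernel R n l x).
Proof.
move=> xS; have [P _] := rk_proj_kernel l; have [p _ pE] := P x xS.
apply: (eq_bmfun (f := pev p)) => [y yS|]; first by rewrite pE.
exact: bmfun_pev.
Qed.

Hypothesis n_gt0 : (0 < n)%N.

Lemma proj_kernel_orth l m x p : l != m -> sphere x -> mharm m p ->
  S (fun y => @proj_kernel R n l x y * pev p y) = 0.
Proof.
move=> lm xS pm; have [P _] := rk_proj_kernel l; have [q lq qE] := P x xS.
rewrite -(mharm_orth n_gt0 lq pm lm); apply: eq_rint => y yS.
by rewrite pevM qE.
Qed.

Lemma rk_proj_le L : rk (fun p => mdeg_le L p) (proj_le L).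
Proof.
have VS := subspace_mdeg_le L.
split=> [x xS|p x pL xS].
  have H l : exists p, mharm l p /\ forall y, sphere y -> @proj_kernel R n l x y = pev p y.
    by have [P _] := rk_proj_kernel l; have [p ? ?] := P x xS; exists p.
  have [h hP] := choice H.
  exists (\sum_(l < L.+1) h l).
    by apply: (subspace_sum VS) => l _; apply: (@mharm_mdeg_le L l); [exact: (ltn_ord l)|case: (hP l)].
  by move=> y yS; rewrite pev_sum; apply: eq_bigr => l _; have [_ ->] := hP l.
have [h hm hp] := harmonic_decomposition pL.
transitivity (S (fun y => \sum_(l < L.+1) \sum_(m < L.+1) @proj_kernel R n l x y * pev (h m) y)).
  apply: eq_rint => y yS; rewrite hp// mulr_suml; apply: eq_bigr => l _.
  by rewrite mulr_sumr.
have bm l m : bmfun (@sphere R n.+1) (fun y => @proj_kernel R n l x y * pev (h m) y).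
  by apply: bmfunM; [exact: proj_kernel_bm|exact: bmfun_pev].
rewrite rint_sum//; last by move=> l _; apply: bmfun_sum.
rewrite hp//; apply: eq_bigr => l _; rewrite rint_sum// (bigD1 l)//= big1 ?addr0.
  by have [_ ->] := rk_proj_kernel l.
by move=> m ml; apply: proj_kernel_orth => //; rewrite eq_sym.
Qed.

End repro_kernel.

(** * The diagonal of the reproducing kernel *)

Section diagonal.
Context (R : realType) (n : nat).
Local Notation T := (n.+1.-tuple R).
Local Notation M := (mpol n.+1 R).
Local Notation sigma := (@surface_measure R n).
Local Notation S f := (\int[sigma]_(x in sphere) f x).
Implicit Types (p q g : M) (x y : T).

Let mS : measurable (@sphere R n.+1) := @measurable_sphere R n.+1.
Let Soo := @surface_sphere_lty R n.

Lemma lieD_lin i j c p q : lieD i j (c *: p + q) = c *: lieD i j p + lieD i j q.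
Proof. by rewrite /lieD !mpoly.mderivD !mpoly.mderivZ !mulrDr -!scalerAr scalerBr; ring. Qed.

Lemma lieD0 i j : lieD i j (0 : M) = 0.
Proof. by rewrite /lieD !mpoly.mderiv0 !mulr0 subrr. Qed.

Lemma lieDD i j p q : lieD i j (p + q) = lieD i j p + lieD i j q.
Proof. by have := lieD_lin i j 1 p q; rewrite !scale1r. Qed.

Lemma lieDM i j p q : lieD i j (p * q) = lieD i j p * q + p * lieD i j q.
Proof. by rewrite /lieD !mpoly.mderivM; ring. Qed.

Lemma lieD_sum i j (I : Type) (s : seq I) (F : I -> M) :
  lieD i j (\sum_(l <- s) F l) = \sum_(l <- s) lieD i j (F l).
Proof. exact: (big_morph _ (lieDD i j) (lieD0 i j)). Qed.

Lemma mdeg_le_lieD L i j p : mdeg_le L p -> mdeg_le L (lieD i j p).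
Proof.
move=> pL; rewrite [p]mpoly.mpolyE lieD_sum.
apply: (subspace_sum (@subspace_mdeg_le R n L)) => a ap.
rewrite -[_ *: _]addr0 lieD_lin lieD0 addr0; apply: (subspaceZ (V := fun p => mdeg_le L p)); first exact: subspace_mdeg_le.
have Xa : mhom (mpoly.mdeg a) (lieD i j (mpoly.mpolyX R a)).
  by apply: mhom_lieD; rewrite mpoly.dhomogX.
rewrite /mdeg_le (leq_trans (mhom_msize Xa))//.
by rewrite (leq_trans (mpoly.msize_mdeg_lt ap)).
Qed.

Lemma ip_lieD i j p q : ip (lieD i j p) q = - ip p (lieD i j q).
Proof.
apply/eqP; rewrite -subr_eq0 opprK; apply/eqP.
have [SL _ SD] := @surface_lie_inv R n.
have := SL 1 (lieD i j p * q) (p * lieD i j q).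
by rewrite scale1r mul1r -lieDM SD.
Qed.

Hypothesis n_gt0 : (0 < n)%N.

(* On the sphere every [lieD] annihilates [u], the sum of the squares of the
   basis, because [lieD] is antisymmetric; so integration against [u] is again
   an invariant functional, and [u] is constant on the sphere. *)
Lemma orthobasis_diag L (zs : seq M) x : orthobasis (fun p => mdeg_le L p) zs -> sphere x ->
  (\sum_(z <- zs) pev z x * pev z x) * S (pev 1) = (size zs)%:R.
Proof.
move=> zsO xS; have [zV _ on ex] := zsO.
pose u := \sum_(z <- zs) z * z.
have Du i j : zeroS (lieD i j u).
  (* The matrix of [lieD i j] in the basis is antisymmetric, while [pev z y * pev w y] is symmetric
     in [z] and [w], so the double sum vanishes. *)
  pose B (z w : M) := ip (lieD i j z) w.
  have BN z w : B z w = - B w z by rewrite /B ip_lieD ipC.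
  have e y : sphere y -> pev (lieD i j u) y =
      2 * \sum_(z <- zs) \sum_(w <- zs) B z w * (pev z y * pev w y).
    move=> yS; rewrite /u lieD_sum pev_sum mulr_sumr [LHS]big_seq [RHS]big_seq.
    apply: eq_bigr => z zz; rewrite lieDM pevD !pevM.
    have /eqP := ex _ (mdeg_le_lieD i j (zV _ zz)) y yS.
    rewrite pevB subr_eq0 => /eqP ->; rewrite pev_sum.
    rewrite [pev z y * _]mulrC -mulr2n -[_ *+ 2]mulr_natl; congr (_ * _).
    by rewrite mulr_suml; apply: eq_bigr => w _; rewrite pevZ /B; ring.
  move=> y yS; rewrite e//.
  set s := \sum_(z <- zs) _.
  suff : s = - s by lra.
  rewrite {1}/s exchange_big/= /s -sumrN; apply: eq_bigr => z _.
  by rewrite -sumrN; apply: eq_bigr => w _; rewrite BN; ring.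
pose J p := S (pev (u * p)).
have [SL SR SD] := @surface_lie_inv R n.
have JP : lie_inv J.
  split=> [c p q|p|i j p]; rewrite /J.
  - by rewrite mulrDr -scalerAr SL.
  - by rewrite mulrCA SR.
  - have := SL 1 (lieD i j u * p) (u * lieD i j p).
    rewrite scale1r mul1r -lieDM SD (_ : S (pev (lieD i j u * p)) = 0) ?add0r//.
    rewrite (eq_rint _ (g := cst 0)) ?rint_cst ?mul0r// => y yS.
    by rewrite pevM Du// mul0r.
have JE := lie_inv_surface n_gt0 JP.
have S1 := @surface_sphere_gt0 R n.
have S1n : S (pev 1) != 0 by rewrite gt_eqF.
have J1 : J 1 = (size zs)%:R.
  rewrite /J mulr1 /u.
  rewrite (_ : S _ = \sum_(z <- zs) S (pev (z * z))).
    rewrite big_seq (eq_bigr (fun=> 1)) => [|z /on//].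
    by rewrite -big_seq big_const_seq count_predT iter_addr addr0.
  rewrite -rint_sum//; last by move=> z _; exact: bmfun_pev.
  by apply: eq_rint => y _; rewrite pev_sum.
pose c := J 1 / S (pev 1).
(* The square is split as [u (u - c) - c (u - c)]; by uniqueness of the invariant functional,
   integration against [u] is [c] times integration, and the two parts cancel. *)
have : S (pev ((u - mpoly.mpolyC n.+1 c) * (u - mpoly.mpolyC n.+1 c))) = 0.
  have -> : (u - mpoly.mpolyC n.+1 c) * (u - mpoly.mpolyC n.+1 c) =
      (- c) *: (u - mpoly.mpolyC n.+1 c) + u * (u - mpoly.mpolyC n.+1 c).
    by rewrite -mpoly.mul_mpolyC mpoly.mpolyCN; ring.
  rewrite SL -/(J _) (_ : J (u - _) = c * S (pev (u - mpoly.mpolyC n.+1 c))).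
    by rewrite mulNr addNr.
  by apply: (mulIf S1n); rewrite JE /c mulrAC divfK.
move=> /poly_eq0_sphere/(_ x xS)/eqP; rewrite pevB pevC subr_eq0 /u pev_sum => /eqP h.
transitivity (c * S (pev 1)); last by rewrite /c divfK.
by rewrite -h; congr (_ * _); apply: eq_bigr => z _; rewrite pevM.
Qed.

Definition mono (b : nat) (f : 'I_n -> nat) : M :=
  mvar ord0 ^+ b * \prod_(i < n) mvar (lift ord0 i) ^+ f i.

(** The first variable occurs to a power at most 1, which saves a dimension: the list has about
    [L^n] members instead of [L^(n+1)]. The other exponents range over a box, which is larger than
    needed but easy to count. *)
Definition mono_span L : seq M :=
  [seq mono (bf.1 : bool) (fun i => bf.2 i : nat) |
    bf : bool * {ffun 'I_n -> 'I_L.+1} <- enum {: bool * {ffun 'I_n -> 'I_L.+1}}].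

Lemma size_mono_span L : size (mono_span L) = (2 * L.+1 ^ n)%N.
Proof. by rewrite size_map -cardT card_prod card_bool card_ffun !card_ord. Qed.

Lemma pev_mono b f x :
  pev (mono b f) x = tnth x ord0 ^+ b * \prod_(i < n) tnth x (lift ord0 i) ^+ f i.
Proof.
rewrite /mono pevM [pev (_ ^+ _) x]rmorphXn/= -/(pev _ _) pevX; congr (_ * _).
rewrite [LHS]rmorph_prod; apply: eq_bigr => i _.
by rewrite rmorphXn/= -/(pev _ _) pevX.
Qed.

(* On the sphere the even powers of x_0 can be eliminated. *)
Lemma spanS_mono L b f : (b + \sum_(i < n) f i <= L)%N -> spanS (mono_span L) (mono b f).
Proof.
elim/ltn_ind: b f => b IH f bfL.
have [b1|b1] := leqP b 1.
  have fL i : (f i < L.+1)%N.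
    rewrite ltnS (leq_trans _ bfL)// (leq_trans _ (leq_addl _ _))//.
    by rewrite (bigD1 i)//= leq_addr.
  apply: spanS_mem; apply/mapP.
  exists (b == 1%N, [ffun i => Ordinal (fL i)]); first by rewrite mem_enum.
  rewrite /mono /=; congr (_ * _).
    by case: (b) b1 => [|[]].
  by apply: eq_bigr => i _; rewrite ffunE.
case: b b1 => [//|[//|b]] _ in IH bfL *.
pose f2 i := fun j => (f j + 2 * (j == i))%N.
apply: (@spanS_eq _ _ _ _ (mono b f - \sum_(i < n) mono b (f2 i))).
  move=> x xS; rewrite pevB pevB pev_sum !pev_mono.
  have f2E i : pev (mono b (f2 i)) x = tnth x (lift ord0 i) ^+ 2 * pev (mono b f) x.
    rewrite !pev_mono mulrCA; congr (_ * _).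
    rewrite (bigD1 i)//= [in RHS](bigD1 i)//= /f2 eqxx muln1 exprD mulrA [_ ^+ 2 * _]mulrC.
    congr (_ * _); apply: eq_bigr => j /negbTE ji.
    by rewrite ji muln0 addn0.
  rewrite (eq_bigr _ (fun i _ => f2E i)) -mulr_suml pev_mono.
  move/sphereP: xS; rewrite /dot big_ord_recl.
  rewrite (eq_bigr (fun i => tnth x (lift ord0 i) ^+ 2)); last by move=> i _; rewrite expr2.
  set s := \sum_(i < n) _; move=> xS.
  have -> : s = 1 - tnth x ord0 * tnth x ord0 by rewrite -xS; ring.
  by rewrite !exprS; ring.
rewrite -[mono b f]scale1r -[- _]scaleN1r.
apply: spanSD; apply: spanSZ.
  by apply: IH => //; rewrite (leq_trans _ bfL)// leq_add2r -addn2 leq_addr.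
apply: spanS_sum => i _; apply: IH => //.
rewrite /f2 big_split/= -big_distrr/= [X in (2 * X)%N](bigD1 i)//= eqxx.
rewrite [X in (true + X)%N]big1 => [|j /negbTE->//].
by rewrite addn0 muln1 addnA addnAC addn2.
Qed.

Lemma spanS_mdeg_le L p : mdeg_le L p -> spanS (mono_span L) p.
Proof.
move=> pL; rewrite [p]mpoly.mpolyE big_seq; apply: spanS_sum => a ap.
apply: spanSZ; rewrite mpoly.mpolyXE_id big_ord_recl; apply: spanS_mono.
have := mpoly.msize_mdeg_lt ap; rewrite mpoly.mdegE big_ord_recl/= => aL.
by rewrite -ltnS (leq_trans aL).
Qed.

Lemma proj_le_diag_le L x : sphere x ->
  proj_le L x x * S (pev 1) <= 2 * L.+1%:R ^+ n.
Proof.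
move=> xS; have VS := @subspace_mdeg_le R n L.
have [zs zsO zsL] := orthobasis_exists VS (@spanS_mdeg_le L).
rewrite (rk_uniq (@rk_proj_le R n n_gt0 L) (rk_orthobasis VS zsO) xS xS).
rewrite (orthobasis_diag zsO xS) (_ : 2 * _ = (2 * L.+1 ^ n)%:R); last by rewrite natrM natrX.
by rewrite ler_nat -size_mono_span.
Qed.

End diagonal.

(** * A localized polynomial kernel *)

Section dyadic_chebyshev.
Context (R : realType).
Implicit Type t : R.

(* [cheb j] is the Chebyshev polynomial T_(2^j). *)
Fixpoint cheb j t : R := if j is j'.+1 then 2 * cheb j' t ^+ 2 - 1 else t.

(** For [t = cos u] each factor is [cos^2 (2^j u / 2)], and the product is the normalized Fejer
    kernel [(sin (2^k u / 2) / (2^k sin (u / 2)))^2]. *)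
Definition loc k t : R := \prod_(j < k) ((1 + cheb j t) / 2).

Lemma cheb_itv j t : -1 <= t <= 1 -> -1 <= cheb j t <= 1.
Proof. by move=> t1; elim: j => //= j /andP[? ?]; apply/andP; split; nra. Qed.

Lemma cheb1 j : cheb j 1 = 1.
Proof. by elim: j => //= j ->; ring. Qed.

Lemma loc1 k : loc k 1 = 1.
Proof. by rewrite /loc big1// => j _; rewrite cheb1; field. Qed.

Lemma loc_itv k t : -1 <= t <= 1 -> 0 <= loc k t <= 1.
Proof.
move=> t1; rewrite /loc; apply/andP; split.
  by apply: prodr_ge0 => j _; have /andP[? ?] := cheb_itv j t1; lra.
apply: prodr_ile1 => j _; have /andP[? ?] := cheb_itv j t1.
by apply/andP; split; lra.
Qed.

(* The product telescopes, as [T_(2N) - 1 = 2 (T_N + 1) (T_N - 1)]. *)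
Lemma locE k t : 4 ^+ k * (1 - t) * loc k t = 1 - cheb k t.
Proof.
elim: k => [|k IH]; first by rewrite /loc big_ord0 expr0 /=; ring.
rewrite /loc big_ord_recr/= -/(loc k t) exprS.
transitivity (2 * (1 + cheb k t) * (1 - cheb k t)); last by ring.
by rewrite -IH; field.
Qed.

Lemma loc_decay k t (r : R) : -1 <= t <= 1 -> 0 < r -> r ^+ 2 < 2 - 2 * t ->
  loc k t <= 4 / (4 ^+ k * r ^+ 2).
Proof.
move=> t1 r0 rt; have /andP[l0 _] := loc_itv k t1.
have /andP[c1 _] := cheb_itv k t1.
have k0 : 0 < 4 ^+ k :> R by rewrite exprn_gt0.
have r20 : 0 < r ^+ 2 by rewrite exprn_gt0.
rewrite ler_pdivlMr ?mulr_gt0//.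
have h := locE k t.
have : 4 ^+ k * loc k t * r ^+ 2 <= 4 ^+ k * loc k t * (2 - 2 * t).
  by rewrite ler_wpM2l ?mulr_ge0// ltW.
have -> : 4 ^+ k * loc k t * (2 - 2 * t) = 2 * (4 ^+ k * (1 - t) * loc k t) by ring.
rewrite h => ?; rewrite mulrA [loc k t * _]mulrC; lra.
Qed.

End dyadic_chebyshev.

Section localized_kernel.
Context (R : realType) (n : nat).
Local Notation T := (n.+1.-tuple R).
Local Notation M := (mpol n.+1 R).
Local Notation sigma := (@surface_measure R n).
Local Notation S f := (\int[sigma]_(x in sphere) f x).
Implicit Types (x y : T).

Let mS : measurable (@sphere R n.+1) := @measurable_sphere R n.+1.
Let Soo := @surface_sphere_lty R n.

(** The power [n + 1] makes the decay [4^(-(n+1) j)] at distance [2^j / 2^k] stronger than the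
    growth [2^(n j)] of caps and the growth [2^((n+1) j)] of the packing bound. *)
Definition lker k x y : R := loc k (dot x y) ^+ n.+1.

Definition lin y : M := \sum_(i < n.+1) tnth y i *: mvar i.

Fixpoint chebm j y : M :=
  if j is j'.+1 then 2%:R *: (chebm j' y * chebm j' y) - 1 else lin y.

Definition lkerm k y : M := (\prod_(j < k) (2^-1 *: (1 + chebm j y))) ^+ n.+1.

Lemma pev_chebm j x y : pev (chebm j y) x = cheb j (dot x y).
Proof.
elim: j => /= [|j IH].
  rewrite pev_sum; apply: eq_bigr => i _.
  by rewrite pevZ pevX mulrC.
by rewrite pevB pevZ pevM pev1 IH expr2.
Qed.

Lemma pev_lkerm k x y : pev (lkerm k y) x = lker k x y.
Proof.
rewrite /lkerm /lker [LHS]rmorphXn/=; congr (_ ^+ _).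
rewrite /loc [LHS]rmorph_prod; apply: eq_bigr => j _.
by rewrite -[LHS]/(pev (2^-1 *: (1 + chebm j y)) x) pevZ pevD pev1 pev_chebm mulrC.
Qed.

Lemma mdeg_leM a b (p q : M) : mdeg_le a p -> mdeg_le b q -> mdeg_le (a + b) (p * q).
Proof.
have [->|p0] := eqVneq p 0; first by rewrite mul0r /mdeg_le mpoly.msize0.
have [->|q0] := eqVneq q 0; first by rewrite mulr0 /mdeg_le mpoly.msize0.
move=> pa qb; rewrite /mdeg_le mpoly.msizeM// -subn1 leq_subLR add1n.
by rewrite -addSn -addnS leq_add.
Qed.

Lemma mdeg_le1 : mdeg_le 0 (1 : M).
Proof. by rewrite /mdeg_le mpoly.msize1. Qed.

Lemma mdeg_leX a m (p : M) : mdeg_le a p -> mdeg_le (m * a) (p ^+ m).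
Proof.
move=> pa; elim: m => [|m IH]; first by rewrite mul0n expr0 mdeg_le1.
by rewrite exprS mulSn; exact: mdeg_leM.
Qed.

Lemma mdeg_leW a b (p : M) : (a <= b)%N -> mdeg_le a p -> mdeg_le b p.
Proof. by move=> ab pa; rewrite /mdeg_le (leq_trans pa). Qed.

Lemma mdeg_leZD a c (p q : M) : mdeg_le a p -> mdeg_le a q -> mdeg_le a (c *: p + q).
Proof. by have [_] := @subspace_mdeg_le R n a; apply. Qed.

Lemma mdeg_le_chebm j y : mdeg_le (2 ^ j) (chebm j y).
Proof.
elim: j => /= [|j IH].
  rewrite expn0; apply: (subspace_sum (@subspace_mdeg_le R n 1)) => i _.
  apply: (subspaceZ (V := fun p => mdeg_le 1 p)); first exact: subspace_mdeg_le.
  by rewrite /mdeg_le mpoly.msizeX mpoly.mdeg1.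
apply: mdeg_leZD; first by rewrite expnS mul2n -addnn; exact: mdeg_leM.
rewrite -scaleN1r; apply: (subspaceZ (V := fun p => mdeg_le (2 ^ j.+1) p)).
  exact: subspace_mdeg_le.
by apply: mdeg_leW mdeg_le1.
Qed.

Lemma mdeg_le_lkerm k y : mdeg_le (n.+1 * 2 ^ k) (lkerm k y).
Proof.
have H : mdeg_le (2 ^ k) (\prod_(j < k) (2^-1 *: (1 + chebm j y))).
  elim: k => [|k IH]; first by rewrite big_ord0; apply: mdeg_leW mdeg_le1.
  rewrite big_ord_recr/= expnS mul2n -addnn; apply: mdeg_leM => //.
  apply: (subspaceZ (V := fun p => mdeg_le (2 ^ k) p)); first exact: subspace_mdeg_le.
  rewrite -[1]scale1r; apply: mdeg_leZD; last exact: mdeg_le_chebm.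
  by apply: mdeg_leW mdeg_le1.
exact: mdeg_leX.
Qed.

Lemma lkerC k x y : lker k x y = lker k y x.
Proof. by rewrite /lker dotC. Qed.

Lemma lker_xx k x : sphere x -> lker k x x = 1.
Proof. by move=> /sphereP xx; rewrite /lker xx loc1 expr1n. Qed.

Lemma sphere_dot_itv x y : sphere x -> sphere y -> -1 <= dot x y <= 1.
Proof. by move=> xS yS; rewrite -ler_norml; exact: sphere_dot_le1. Qed.

Lemma lker_itv k x y : sphere x -> sphere y -> 0 <= lker k x y <= 1.
Proof.
move=> xS yS; have /andP[l0 l1] := loc_itv k (sphere_dot_itv xS yS).
by rewrite /lker exprn_ge0// exprn_ile1.
Qed.

(** Dyadic radii in units of [2^-k]. The factor 2 makes the bound of [loc_decay] exactly [4^-j], and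
    gives [rad k k = 2], so that the last cube contains the whole sphere. *)
Definition rad k j : R := 2 * 2 ^+ j / 2 ^+ k.

Lemma rad_gt0 k j : 0 < rad k j.
Proof. by rewrite divr_gt0 ?mulr_gt0 ?exprn_gt0. Qed.

Lemma lker_far k j x y : sphere x -> sphere y -> ~ cube x (rad k j) y ->
  lker k x y <= 4^-1 ^+ (n.+1 * j).
Proof.
move=> xS yS /(sphere_far_cube (ltW (rad_gt0 k j)) xS yS) far.
have xy1 := sphere_dot_itv xS yS.
have := loc_decay k xy1 (rad_gt0 k j) far.
have -> : 4 / (4 ^+ k * rad k j ^+ 2) = 4^-1 ^+ j :> R.
  have h4 e : 4 ^+ e = (2 ^+ e) ^+ 2 :> R.
    by rewrite -exprM mulnC exprM (_ : 2 ^+ 2 = 4)//; ring.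
  by rewrite exprVn !h4 /rad; field; rewrite !expf_neq0.
move=> h; rewrite /lker mulnC exprM lerXn2r ?nnegrE ?exprn_ge0//.
by have /andP[] := loc_itv k xy1.
Qed.

(** A point first caught by the cube of index [j] is only known to lie outside the one of index
    [j - 1]; the factor [4 ^+ n.+1] pays for this shift. *)
Definition shell k j x y : R := 4 ^+ n.+1 * 4^-1 ^+ (n.+1 * j) * \1_(cube x (rad k j)) y.

Lemma shell_ge0 k j x y : 0 <= shell k j x y.
Proof. by rewrite /shell !mulr_ge0// ?exprn_ge0. Qed.

Lemma rad_mono k i j : (i <= j)%N -> rad k i <= rad k j.
Proof.
move=> ij; rewrite /rad ler_wpM2r ?invr_ge0 ?exprn_ge0// ler_wpM2l//.
by rewrite ler_weXn2l// ler1n.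
Qed.

Lemma lker_shell k m x y : sphere x -> sphere y ->
  (forall j, (j < m)%N -> ~ cube x (rad k j) y) ->
  lker k x y <= \sum_(m <= j < k.+1) shell k j x y.
Proof.
move=> xS yS far.
have ex : exists j, y \in cube x (rad k j).
  exists k; rewrite inE => i; rewrite /rad mulfK ?expf_neq0//.
  rewrite (le_trans (ler_normB _ _))// (_ : 2 = 1 + 1) ?lerD ?sphere_tnth_le1//.
have kin : y \in cube x (rad k k).
  rewrite inE => i; rewrite /rad mulfK ?expf_neq0//.
  by rewrite (le_trans (ler_normB _ _))// (_ : 2 = 1 + 1) ?lerD ?sphere_tnth_le1//.
(* The least [j] whose cube contains [y]: this single term of the sum already dominates the kernel,
   and for [j = 0] the bound [lker <= 1] is used. *)
have [j jin jmin] := ex_minnP ex.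
have mj : (m <= j)%N by rewrite leqNgt; apply/negP => /far; apply; rewrite inE in jin.
have jk : (j < k.+1)%N by rewrite ltnS jmin.
rewrite (big_cat_nat (n := j))//=; last exact: ltnW.
rewrite [X in _ + X]big_ltn//= addrCA.
apply: (@le_trans _ _ (shell k j x y)); last first.
  by rewrite lerDl addr_ge0//; apply: sumr_ge0 => i _; exact: shell_ge0.
rewrite /shell indicE jin mulr1.
case: j jin jmin mj jk => [|j] jin jmin mj jk.
  rewrite muln0 expr0 mulr1; have /andP[_ h] := lker_itv k xS yS.
  by rewrite (le_trans h)// exprn_ege1// ler1n.
rewrite mulnS exprD mulrA -exprMn divff// expr1n mul1r.
apply: lker_far => // yj; have := jmin j; rewrite mem_set// => /(_ isT).
by rewrite ltnn.
Qed.

(** The factors come, in order, from [shell], from the measure of a cube, from the 2 in [rad], and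
    from the geometric series. *)
Definition shell_cst : R := 4 ^+ n.+1 * (n.+1%:R * (3 * 4 ^+ n.+1)) * 2 ^+ n * 2.

Lemma sum_geo (m k : nat) : \sum_(m <= j < k) 2^-1 ^+ j <= 2 * 2^-1 ^+ m :> R.
Proof.
have [mk|mk] := leqP m k; last by rewrite big_geq ?mulr_ge0 ?exprn_ge0// ltnW.
apply: (@le_trans _ _ (2 * 2^-1 ^+ m - 2 * 2^-1 ^+ k)); last first.
  by rewrite gerBl mulr_ge0// exprn_ge0.
elim: k mk => [|k IH]; first by rewrite leqn0 => /eqP->; rewrite big_geq// subrr.
rewrite leq_eqVlt => /orP[/eqP->|mk]; first by rewrite big_geq// subrr.
rewrite big_nat_recr//= exprS mulrA divff// mul1r.
by have := IH mk; lra.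
Qed.

Lemma geo_bound j : 4^-1 ^+ (n.+1 * j) * (2 ^+ j) ^+ n <= 2^-1 ^+ j :> R.
Proof.
rewrite exprM -[X in _ * X]exprM mulnC exprM -exprMn lerXn2r ?nnegrE ?mulr_ge0 ?exprn_ge0//.
rewrite exprS -mulrA -exprMn (_ : 4^-1 * 2 = 2^-1 :> R); last by field.
have : 2^-1 ^+ n <= 1 :> R by rewrite exprn_ile1//; lra.
have : 0 <= 2^-1 ^+ n :> R by rewrite exprn_ge0.
lra.
Qed.

Lemma bmfun_lker k x : sphere x -> bmfun (@sphere R n.+1) (lker k x).
Proof.
move=> xS; apply: (eq_bmfun (f := pev (lkerm k x))) => [y _|]; last exact: bmfun_pev.
by rewrite pev_lkerm lkerC.
Qed.

Lemma rint_lker k x : sphere x -> S (lker k x) <= shell_cst * (2 ^- k) ^+ n.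
Proof.
move=> xS.
have bsh j : bmfun (@sphere R n.+1) (shell k j x).
  apply: bmfunZ; split; last first.
    by exists 1 => y _; rewrite indicE; case: (_ \in _); rewrite ?normr1 ?normr0.
  by apply: measurable_funTS; apply: measurable_indic; exact: measurable_cube.
apply: (@le_trans _ _ (S (fun y => \sum_(0 <= j < k.+1) shell k j x y))).
  apply: le_rint => //; [exact: bmfun_lker|exact: bmfun_sum|move=> y yS].
  exact: lker_shell.
rewrite rint_sum//.
apply: (@le_trans _ _ (\sum_(0 <= j < k.+1)
    4 ^+ n.+1 * (n.+1%:R * (3 * 4 ^+ n.+1)) * 2 ^+ n * (2 ^- k) ^+ n * 2^-1 ^+ j)).
  rewrite big_nat [leRHS]big_nat; apply: ler_sum => j /andP[_ jk].
  have radj : rad k j <= 2.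
    by rewrite -[leRHS](_ : rad k k = 2) ?rad_mono//; rewrite /rad mulfK// expf_neq0.
  rewrite rintZ//; last first.
    split; last first.
      by exists 1 => y _; rewrite indicE; case: (_ \in _); rewrite ?normr1 ?normr0.
    by apply: measurable_funTS; apply: measurable_indic; exact: measurable_cube.
  have -> : S (\1_(cube x (rad k j)) : T -> R) = fine (sigma (cube x (rad k j))).
    rewrite /Rintegral integral_indic//; last exact: measurable_cube.
    by rewrite [X in fine X]surface_measureI.
  have := @surface_cube_le R n x (rad k j) xS; rewrite rad_gt0 radj => /(_ isT) sc.
  have {}sc : fine (sigma (cube x (rad k j))) <= n.+1%:R * (3 * 4 ^+ n.+1 * rad k j ^+ n).
    rewrite -lee_fin fineK// ge0_fin_numE//; exact: (le_lt_trans sc (ltry _)).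
  apply: (@le_trans _ _ (4 ^+ n.+1 * 4^-1 ^+ (n.+1 * j) * (n.+1%:R * (3 * 4 ^+ n.+1 * rad k j ^+ n)))).
    by rewrite ler_wpM2l// mulr_ge0 ?exprn_ge0.
  rewrite /rad !exprMn.
  set c := 4 ^+ n.+1; set e := 2 ^+ n; set w := (2 ^- k) ^+ n.
  have -> : c * 4^-1 ^+ (n.+1 * j) * (n.+1%:R * (3 * c * (e * (2 ^+ j) ^+ n * w))) =
    c * (n.+1%:R * (3 * c)) * e * w * (4^-1 ^+ (n.+1 * j) * (2 ^+ j) ^+ n) by ring.
  by rewrite ler_wpM2l ?geo_bound// !mulr_ge0 ?exprn_ge0 ?invr_ge0 ?exprn_ge0.
rewrite -mulr_sumr.
have := sum_geo 0 k.+1; rewrite expr0 mulr1 => sg.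
rewrite /shell_cst [leRHS]mulrAC; apply: ler_wpM2l sg.
by rewrite !mulr_ge0 ?exprn_ge0 ?invr_ge0 ?exprn_ge0.
Qed.

End localized_kernel.

(** * Separated sets *)

Section packing.
Context (R : realType) (n : nat).
Local Notation T := (n.+1.-tuple R).
Local Notation d := n.+1.
Local Notation sigma := (@surface_measure R n).
Local Notation S f := (\int[sigma]_(x in sphere) f x).
Implicit Types (x y : T) (X : seq T).

Let mS : measurable (@sphere R n.+1) := @measurable_sphere R n.+1.
Let Soo := @surface_sphere_lty R n.

(** Turns Euclidean separation into separation in one coordinate, which is what a grid detects, at
    the cost of the factor [n + 1]. *)
Lemma far_coord x y (delta : R) : 0 < delta ->
  delta ^+ 2 <= \sum_(i < d) (tnth x i - tnth y i) ^+ 2 ->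
  exists l, delta / d%:R <= `|tnth x l - tnth y l|.
Proof.
move=> d0 h; apply/not_existsP => H.
have d1 : 1 <= d%:R :> R by rewrite ler1n.
have dp : 0 < d%:R :> R by lra.
have : \sum_(i < d) (tnth x i - tnth y i) ^+ 2 < \sum_(i < d) (delta / d%:R) ^+ 2.
  apply: ltr_sum => [|i _]; first by apply/hasP; exists ord0; rewrite ?mem_index_enum.
  have /negP := H i; rewrite -ltNge => Hi.
  by rewrite -real_normK ?num_real// ltrXn2r// nnegrE divr_ge0// ltW.
rewrite sumr_const card_ord -[X in _ < X]mulr_natl.
apply/negP; rewrite -leNgt (le_trans _ h)//.
rewrite (_ : d%:R * _ = delta ^+ 2 / d%:R); last by field; rewrite gt_eqF.
by rewrite ler_pdivrMr// ler_peMr// exprn_ge0// ltW.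
Qed.

(** Pigeonhole on a grid of mesh [delta]: two points in one cell differ by less than [delta] in
    every coordinate. *)
Lemma packing (I : eqType) (s : seq I) (f : I -> T) (c : T) (delta r : R) :
  uniq s -> 0 < delta -> 0 <= r -> {in s, forall i, cube c r (f i)} ->
  {in s &, forall i j, i != j -> exists l, delta <= `|tnth (f i) l - tnth (f j) l|} ->
  (size s)%:R <= (2 * r / delta + 1) ^+ d.
Proof.
move=> us d0 r0 fc sep.
pose K := Num.truncn (2 * r / delta).
have K0 : 0 <= 2 * r / delta by rewrite divr_ge0 ?mulr_ge0// ltW.
pose u i l := (tnth (f i) l - tnth c l + r) / delta.
have u0 i l : i \in s -> 0 <= u i l.
  by move=> /fc/(_ l); rewrite ler_norml => /andP[? ?]; rewrite divr_ge0 ?(ltW d0)//; lra.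
have uK i l : i \in s -> (Num.truncn (u i l) < K.+1)%N.
  move=> si; rewrite ltnS le_truncn// ler_pM2r ?invr_gt0//.
  by have /fc/(_ l) := si; rewrite ler_norml => /andP[? ?]; lra.
pose cell i : {ffun 'I_d -> 'I_K.+1} := [ffun l => inord (Num.truncn (u i l))].
have cinj : {in s &, injective cell}.
  move=> i j si sj /ffunP ij; apply/eqP/negP => /negP inj.
  have [l] := sep _ _ si sj inj; rewrite leNgt => /negP; apply.
  have := ij l; rewrite !ffunE => /(congr1 val)/=.
  rewrite !inordK ?uK// => e.
  have /andP[a1 a2] := truncn_itv (u0 i l si).
  have /andP[b1 b2] := truncn_itv (u0 j l sj).
  rewrite e -natr1 in a1 a2; rewrite -natr1 in b2.
  have : `|u i l - u j l| < 1 by rewrite ltr_norml; apply/andP; split; lra.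
  rewrite /u -mulrBl normrM (ger0_norm (_ : 0 <= delta^-1)) ?invr_ge0 ?(ltW d0)//.
  rewrite ltr_pdivrMr// mul1r.
  by rewrite (_ : _ - _ = tnth (f i) l - tnth (f j) l)//; ring.
have : (size s <= #|{: {ffun 'I_d -> 'I_K.+1}}|)%N.
  rewrite -(size_map cell); have /card_uniqP <- : uniq (map cell s) by rewrite map_inj_in_uniq.
  exact: max_card.
rewrite card_ffun !card_ord => h.
apply: (@le_trans _ _ (K.+1 ^ d)%:R); first by rewrite ler_nat.
rewrite natrX lerXn2r ?nnegrE ?addr_ge0//.
by rewrite -natr1 lerD2r; have /andP[] := truncn_itv K0.
Qed.

(** [2 - 2 * dot x y] is the squared chord, so the separation is chordal. *)
Definition separated (delta : R) X := [/\ uniq X, {in X, forall x, sphere x} &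
  {in X &, forall x y, x != y -> delta ^+ 2 <= 2 - 2 * dot x y}].

Variables (delta : R) (X : seq T).
Hypotheses (delta0 : 0 < delta) (Xsep : separated delta X).

Let uX : uniq X. Proof. by have [] := Xsep. Qed.
Let XS : {in X, forall x, sphere x}. Proof. by have [] := Xsep. Qed.

Let Xfar : {in X &, forall x y, x != y -> exists l, delta / d%:R <= `|tnth x l - tnth y l|}.
Proof.
move=> x y xX yX xy; apply: far_coord => //; have [_ _ sp] := Xsep.
by rewrite sqdist_sphere; [exact: sp|exact: XS|exact: XS].
Qed.

(* About [1 / delta] homothetic copies of [X], with radii in [1/2, 1], still form
   a separated set, to which the packing bound of R^(n+1) applies. *)
Lemma card_separated : delta <= 1 -> (size X)%:R * delta ^+ n <= 2 * (4 * d%:R + 1) ^+ d.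
Proof.
move=> delta1.
have d0 : 0 < d%:R :> R by rewrite ltr0n.
pose J := Num.truncn delta^-1.
have dV : 1 <= delta^-1 by rewrite invf_ge1.
have /andP[J1 J2] := truncn_itv (le_trans ler01 dV).
rewrite -/J -natr1 in J1 J2.
have J0 : 1 <= J%:R :> R by rewrite ler1n /J truncn_gt0.
have Jd : J%:R * delta <= 1 by rewrite -ler_pdivlMr// div1r.
pose f (i : nat * T) := tscale (2^-1 + i.1%:R * (delta / 2)) i.2.
pose s := [seq (j, x) | j <- iota 0 J, x <- X].
have us : uniq s by apply: allpairs_uniq => //; [exact: iota_uniq|case=> ? ? [] ].
have sz : size s = (J * size X)%N by rewrite size_allpairs size_iota.
have tb (j : nat) : (j < J)%N -> 2^-1 <= 2^-1 + j%:R * (delta / 2) <= 1.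
  move=> jJ; have : j%:R * delta <= J%:R * delta.
    by rewrite ler_wpM2r ?(ltW delta0)// ler_nat ltnW.
  have : 0 <= j%:R * delta by rewrite mulr_ge0// ltW.
  by move=> ? ?; apply/andP; split; lra.
have := @packing _ s f [tuple 0 | i < d] (delta / 2 / d%:R) 1 us.
have -> : 0 < delta / 2 / d%:R by rewrite !divr_gt0.
move=> /(_ isT ler01 _)/wrap[].
  move=> _ /allpairsP[[j x] [/= + xX ->]] l; rewrite mem_iota add0n => /andP[_ /tb/andP[t1 t2]].
  rewrite !tnth_mktuple subr0 normrM -[leRHS]mulr1 ler_pM//.
    by rewrite ger0_norm//; lra.
  exact/sphere_tnth_le1/XS.
move=> /(_ _)/wrap[].
  move=> _ _ /allpairsP[[j x] [/= jJ xX ->]] /allpairsP[[i y] [/= iJ yX ->]] ne.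
  rewrite !mem_iota !add0n /= in iJ jJ.
  have /andP[t1 _] := tb _ jJ; have /andP[t2 _] := tb _ iJ.
  apply: far_coord; first by rewrite divr_gt0.
  rewrite /f/=; set t := _ + _ in t1 *; set t' := _ + _ in t2 *.
  (* In this form both cases are visible: for equal directions the radii differ by at least
     [delta / 2]; for different ones [t * t' >= 1/4] leaves at least [delta^2 / 4]. *)
  have -> : \sum_(l < d) (tnth (tscale t x) l - tnth (tscale t' y) l) ^+ 2 =
      (t - t') ^+ 2 + t * t' * (2 - 2 * dot x y).
    have /sphereP xx := XS xX; have /sphereP yy := XS yX.
    transitivity (t ^+ 2 * dot x x + t' ^+ 2 * dot y y - 2 * t * t' * dot x y).
      rewrite /dot !mulr_sumr -sumrN -!big_split/=; apply: eq_bigr => l _.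
      by rewrite !tnth_mktuple; ring.
    by rewrite xx yy; ring.
  have tt : 4^-1 <= t * t'.
    rewrite (_ : 4^-1 = 2^-1 * 2^-1); last by field.
    by rewrite ler_pM.
  have [xy|xy] := eqVneq x y.
    have ij : j != i by apply/eqP => ji; rewrite xy ji eqxx in ne.
    rewrite xy; have /sphereP -> := XS yX.
    rewrite (_ : t * t' * _ = 0) ?addr0; last by ring.
    rewrite /t /t' (_ : _ - _ = (j%:R - i%:R) * (delta / 2)); last by ring.
    rewrite [leRHS]exprMn ler_peMl ?sqr_ge0//.
    have : 1 <= `|j%:R - i%:R : R|.
      move: ij; rewrite neq_ltn => /orP[ji|ij].
        rewrite distrC ger0_norm ?subr_ge0 ?ler_nat ?(ltnW ji)//.
        by rewrite lerBrDl natr1 ler_nat.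
      rewrite ger0_norm ?subr_ge0 ?ler_nat ?(ltnW ij)//.
      by rewrite lerBrDl natr1 ler_nat.
    by move=> h; rewrite -real_normK ?num_real// expr_ge1.
  have [_ _ sp] := Xsep; have := sp _ _ xX yX xy.
  have := sqr_ge0 (t - t'); have := sqr_ge0 delta; nra.
rewrite sz natrM => h.
have {}h : J%:R * (size X)%:R <= (4 * d%:R + 1) ^+ d * delta^-1 ^+ d.
  apply: (le_trans h); rewrite -exprMn lerXn2r ?nnegrE//.
  - by rewrite addr_ge0// !divr_ge0// ?divr_ge0// ltW.
  - by rewrite mulr_ge0 ?addr_ge0 ?mulr_ge0// ?invr_ge0 ltW.
  rewrite (_ : 2 * 1 / _ = 4 * d%:R / delta); last first.
    by field; rewrite !gt_eqF.
  by rewrite [leRHS]mulrDl mul1r lerD2l.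
rewrite exprVn in h.
have dn : delta ^+ d != 0 by rewrite expf_neq0// gt_eqF.
have dd0 : 0 < delta ^+ d by rewrite exprn_gt0.
have {}h : J%:R * (size X)%:R * delta ^+ d <= (4 * d%:R + 1) ^+ d.
  by rewrite -ler_pdivlMr.
rewrite exprS in h.
(* The number [J] of copies absorbs one of the [n + 1] factors [delta], which lowers the exponent to
   [n]. *)
have : 1 <= 2 * (J%:R * delta).
  by move: J2; rewrite -(ltr_pM2r delta0) mulVf ?gt_eqF// mulrDl mul1r; nra.
have s0 : 0 <= (size X)%:R * delta ^+ n by rewrite mulr_ge0// exprn_ge0// ltW.
nra.
Qed.

Section kernel_sums.
Variable k : nat.
Hypothesis kdelta : 16 * d%:R / delta < 2 ^+ k.

(** By [kdelta] and the packing bound, the cube of index [j] contains at most [(2^j / 4 + 1)^d]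
    points of [X]; each is weighted by the value of the shell. *)
Lemma sum_lker_shells (P : pred T) m x : sphere x ->
  {in X, forall y, P y -> forall j, (j < m)%N -> ~ cube x (rad R k j) y} ->
  \sum_(y <- X | P y) lker k x y <=
  \sum_(m <= j < k.+1) (4 * 4^-1 ^+ j * (2 ^+ j / 4 + 1)) ^+ d.
Proof.
move=> xS far.
apply: (@le_trans _ _ (\sum_(y <- X | P y) \sum_(m <= j < k.+1) shell k j x y)).
  rewrite big_seq_cond [leRHS]big_seq_cond; apply: ler_sum => y /andP[yX Py].
  by apply: lker_shell => //; [exact: XS|exact: far].
rewrite exchange_big/=; apply: ler_sum => j _.
rewrite /shell -mulr_sumr 2!exprMn mulnC exprM ler_wpM2l ?mulr_ge0 ?exprn_ge0//.
apply: (@le_trans _ _ (\sum_(y <- X) \1_(cube x (rad R k j)) y)).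
  by rewrite [leRHS](bigID P)/= lerDl; apply: sumr_ge0.
pose s := [seq y <- X | y \in cube x (rad R k j)].
have -> : \sum_(y <- X) \1_(cube x (rad R k j)) y = (size s)%:R :> R.
  rewrite size_filter -sum1_count natr_sum [RHS]big_mkcond/=.
  by apply: eq_bigr => y _; rewrite indicE; case: ifP.
have sub y : y \in s -> y \in X /\ cube x (rad R k j) y.
  by rewrite mem_filter => /andP[+ ?]; rewrite inE.
have d0 : 0 < d%:R :> R by rewrite ltr0n.
have := @packing _ s id x (delta / d%:R) (rad R k j) (filter_uniq _ uX).
rewrite divr_gt0// => /(_ isT (ltW (rad_gt0 _ _ _)) _)/wrap[].
  by move=> y /sub[].
move=> /(_ _)/wrap[].
  by move=> y z /sub[yX _] /sub[zX _]; exact: Xfar.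
have P1 : 0 <= 2 * rad R k j / (delta / d%:R).
  by rewrite ltW// divr_gt0 ?mulr_gt0 ?rad_gt0// divr_gt0.
have P2 : 0 <= 2 ^+ j / 4 :> R by rewrite divr_ge0 ?exprn_ge0.
move=> h; apply: (le_trans h); rewrite lerXn2r ?nnegrE ?addr_ge0//.
rewrite lerD2r /rad.
have k0 : 0 < 2 ^+ k :> R by rewrite exprn_gt0.
have -> : 2 * (2 * 2 ^+ j / 2 ^+ k) / (delta / d%:R) = (16 * d%:R / delta) / 2 ^+ k * (2 ^+ j / 4).
  by field; rewrite !gt_eqF.
by rewrite ler_piMl ?divr_ge0 ?exprn_ge0// ler_pdivrMr// mul1r ltW.
Qed.

Lemma sum_lker_le x : sphere x -> \sum_(y <- X) lker k x y <= 2 * 8 ^+ d.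
Proof.
move=> xS; apply: (le_trans (@sum_lker_shells xpredT 0 x xS _)) => //.
apply: (@le_trans _ _ (\sum_(0 <= j < k.+1) 8 ^+ d * 2^-1 ^+ j)); last first.
  rewrite -mulr_sumr mulrC ler_wpM2r ?exprn_ge0//.
  by have := sum_geo R 0 k.+1; rewrite expr0 mulr1.
apply: ler_sum => j _.
have j0 : 1 <= 2 ^+ j :> R by rewrite exprn_ege1// ler1n.
have jV : 0 <= (2^-1 : R) ^+ j <= 1.
  by rewrite exprn_ge0//= exprn_ile1//; lra.
have e : 4^-1 ^+ j * 2 ^+ j = 2^-1 ^+ j :> R by rewrite -exprMn; congr (_ ^+ _); field.
have V0 : 0 <= 4^-1 ^+ j :> R by rewrite exprn_ge0.
apply: (@le_trans _ _ ((8 * 2^-1 ^+ j) ^+ d)).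
  rewrite lerXn2r ?nnegrE ?mulr_ge0 ?addr_ge0 ?divr_ge0 ?exprn_ge0//.
  by rewrite -e; nra.
move/andP: jV => [v0 v1].
by rewrite exprMn ler_wpM2l ?exprn_ge0// [leLHS]exprS ler_piMr// exprn_ile1.
Qed.

(** By [kdelta] the cube of radius [rad k 3] around [x] contains no other point of [X], so the
    shells start at 4. From there [2^j >= 16] bounds each term by [(5/4) 2^-j], and the tail by
    [5/32]. *)
Lemma sum_lker_off x : x \in X -> \sum_(y <- X | y != x) lker k x y <= 2^-1.
Proof.
move=> xX; have xS := XS xX.
have k0 : 0 < 2 ^+ k :> R by rewrite exprn_gt0.
have d0 : 0 < d%:R :> R by rewrite ltr0n.
apply: (le_trans (@sum_lker_shells (fun y => y != x) 4 x xS _)).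
  move=> y yX yx j j4; have [l hl] := Xfar yX xX yx => /(_ l).
  apply/negP; rewrite -ltNge (lt_le_trans _ hl)//.
  apply: (@le_lt_trans _ _ (rad R k 3)); first by apply: rad_mono; rewrite -ltnS.
  rewrite /rad ltr_pdivrMr// mulrAC ltr_pdivlMr// [ltRHS]mulrC.
  by move: kdelta; rewrite ltr_pdivrMr//; lra.
apply: (@le_trans _ _ (\sum_(4 <= j < k.+1) 5 / 4 * 2^-1 ^+ j)); last first.
  rewrite -mulr_sumr; have := sum_geo R 4 k.+1.
  by rewrite (_ : 2^-1 ^+ 4 = 16^-1 :> R) => [h|]; [lra|rewrite exprVn; congr (_^-1); ring].
rewrite big_nat [leRHS]big_nat; apply: ler_sum => j /andP[j4 _].
have e : 4^-1 ^+ j * 2 ^+ j = 2^-1 ^+ j :> R by rewrite -exprMn; congr (_ ^+ _); field.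
have V0 : 0 <= 4^-1 ^+ j :> R by rewrite exprn_ge0.
have j0 : 16 <= 2 ^+ j :> R.
  by rewrite (_ : 16 = 2 ^+ 4) ?ler_weXn2l ?ler1n//; ring.
have jV : 2^-1 ^+ j <= 16^-1 :> R.
  by rewrite exprVn lef_pV2 ?posrE// exprn_gt0.
have jV0 : 0 <= 2^-1 ^+ j :> R by rewrite exprn_ge0.
apply: (@le_trans _ _ ((5 / 4 * 2^-1 ^+ j) ^+ d)).
  rewrite lerXn2r ?nnegrE ?mulr_ge0 ?addr_ge0 ?divr_ge0 ?exprn_ge0//.
  by rewrite -e; nra.
rewrite exprS ler_piMr ?mulr_ge0//.
by rewrite exprn_ile1 ?mulr_ge0//; lra.
Qed.

Variable a : T -> R.
Let h x := \sum_(y <- X) a y * lker k x y.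
Let a2 := \sum_(y <- X) a y ^+ 2.

(** Diagonal dominance: the matrix of [lker] has diagonal 1 and off-diagonal row sums at most 1/2,
    while each cross term is split by [|a_x a_y| <= (a_x^2 + a_y^2) / 2]. *)
Lemma lker_comb_diag : a2 / 2 <= \sum_(x <- X) a x * h x.
Proof.
have e x : x \in X -> a x * h x >= a x ^+ 2 - \sum_(y <- X | y != x) (a x ^+ 2 + a y ^+ 2) / 2 * lker k x y.
  move=> xX; have xS := XS xX; rewrite /h (bigD1_seq x)//= lker_xx// mulr1 mulrDr -expr2 lerD2l.
  rewrite mulr_sumr -sumrN big_seq_cond [leRHS]big_seq_cond; apply: ler_sum => y /andP[yX _].
  have /andP[l0 _] := lker_itv k (XS xX) (XS yX).
  rewrite mulrA -mulNr ler_wpM2r//; have := sqr_ge0 (a x + a y); nra.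
apply: (@le_trans _ _ (\sum_(x <- X) (a x ^+ 2 - \sum_(y <- X | y != x) (a x ^+ 2 + a y ^+ 2) / 2 * lker k x y))); last first.
  by rewrite big_seq [leRHS]big_seq; apply: ler_sum => x /e.
rewrite sumrB -/a2.
suff : \sum_(x <- X) \sum_(y <- X | y != x) (a x ^+ 2 + a y ^+ 2) / 2 * lker k x y <= a2 / 2 by lra.
pose B := \sum_(x <- X) \sum_(y <- X | y != x) a x ^+ 2 * lker k x y.
have BB : B <= a2 * 2^-1.
  rewrite /B /a2 mulr_suml big_seq [leRHS]big_seq; apply: ler_sum => x xX.
  by rewrite -mulr_sumr ler_wpM2l ?sqr_ge0// sum_lker_off.
have BC : \sum_(x <- X) \sum_(y <- X | y != x) a y ^+ 2 * lker k x y = B.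
  rewrite (exchange_big_dep xpredT)//=; apply: eq_bigr => x _.
  by apply: eq_big => [y|y _]; [rewrite eq_sym|rewrite lkerC].
have -> : \sum_(x <- X) \sum_(y <- X | y != x) (a x ^+ 2 + a y ^+ 2) / 2 * lker k x y = (B + B) / 2.
  rewrite -{2}BC -big_split/= mulr_suml; apply: eq_bigr => x _.
  rewrite -big_split/= mulr_suml; apply: eq_bigr => y _; ring.
lra.
Qed.

(** Cauchy-Schwarz at each point with the weights [lker k x y] gives
    [h^2 <= (\sum lker) (\sum a^2 lker)]; the first sum is bounded uniformly, the second is
    integrated term by term. *)
Lemma lker_comb_L2 : S (fun x => h x ^+ 2) <= 2 * 8 ^+ d * (shell_cst R n * (2 ^- k) ^+ n) * a2.
Proof.
have blk y : y \in X -> bmfun (@sphere R n.+1) (fun x => lker k x y).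
  move=> /XS/(@bmfun_lker R n k); apply: eq_bmfun => x _; exact: lkerC.
apply: (@le_trans _ _ (S (fun x => \sum_(y <- X | y \in X) 2 * 8 ^+ d * (a y ^+ 2 * lker k x y)))).
  apply: le_rint => //.
  - apply: (eq_bmfun (f := fun x => (\sum_(y <- X | y \in X) a y * lker k x y) ^+ 2)).
      by move=> x _; rewrite /h [in RHS]big_seq.
    by apply/bmfunX/bmfun_sum => y yX; apply: bmfunZ; exact: blk.
  - by apply: bmfun_sum => y yX; do 2!apply: bmfunZ; exact: blk.
  move=> x xS.
  have w0 y : y \in X -> 0 <= lker k x y by move=> /XS/(lker_itv k xS)/andP[].
  have W0 : 0 <= \sum_(y <- X) lker k x y by rewrite big_seq; apply: sumr_ge0.
  have W1 := sum_lker_le xS.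
  rewrite -mulr_sumr -big_seq.
  set Q := \sum_(y <- X) a y ^+ 2 * lker k x y.
  have Q0 : 0 <= Q by rewrite /Q big_seq; apply: sumr_ge0 => y yX; rewrite mulr_ge0 ?sqr_ge0// w0.
  suff : h x ^+ 2 <= (\sum_(y <- X) lker k x y) * Q.
    by move=> hx; apply: (le_trans hx); rewrite ler_wpM2r.
  set W := \sum_(y <- X) lker k x y in W0 W1 *.
  have q t : 0 <= Q - 2 * t * h x + t ^+ 2 * W.
    rewrite /Q /h /W !mulr_sumr -sumrN -!big_split/= big_seq; apply: sumr_ge0 => y yX.
    rewrite (_ : _ + _ = (a y - t) ^+ 2 * lker k x y); last by ring.
    by rewrite mulr_ge0 ?sqr_ge0// w0.
  have [W00|Wn] := eqVneq W 0.
    have [->|hn] := eqVneq (h x) 0; first by rewrite expr0n/= mulr_ge0.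
    have := q ((Q + 1) / (2 * h x)); rewrite W00 mulr0 addr0.
    rewrite (_ : 2 * _ * _ = Q + 1); last by field.
    lra.
  have Wp : 0 < W by rewrite lt_def Wn.
  have := q (h x / W); rewrite -(pmulr_rge0 _ Wp).
  have -> : W * (Q - 2 * (h x / W) * h x + (h x / W) ^+ 2 * W) = W * Q - h x ^+ 2.
    by field.
  by rewrite subr_ge0.
rewrite rint_sum//; last by move=> y yX; do 2!apply: bmfunZ; exact: blk.
rewrite /a2 mulr_sumr [leRHS]big_seq; apply: ler_sum => y yX.
rewrite !rintZ//; [|exact: blk|by apply: bmfunZ; exact: blk].
rewrite -[leRHS]mulrA ler_wpM2l ?mulr_ge0 ?exprn_ge0// mulrC ler_wpM2r ?sqr_ge0//.
rewrite (eq_rint _ (g := lker k y)); last by move=> x _; exact: lkerC.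
by apply: rint_lker; exact: XS.
Qed.

End kernel_sums.
End packing.

(** Bounded convergence, for approximations whose integrals are eventually constant; it will be
    applied to the partial sums of the zonal expansion. *)
Lemma rint_bounded_cvg d (X : measurableType d) (R : realType)
    (mu : {measure set X -> \bar R}) (D : set X) (f_ : nat -> X -> R) (f : X -> R) (C c : R) (N0 : nat) :
  measurable D -> (mu D < +oo)%E -> (forall N, measurable_fun D (f_ N)) ->
  (forall N x, D x -> `|f_ N x| <= C) -> (forall x, D x -> f_ ^~ x @ \oo --> f x) ->
  (forall N, (N0 <= N)%N -> \int[mu]_(x in D) f_ N x = c) ->
  bmfun D f /\ \int[mu]_(x in D) f x = c.
Proof.
move=> mD Doo mf_ fC ff intf.
have mf : measurable_fun D f by apply: measurable_fun_cvg ff.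
have bf : bmfun D f.
  split => //; exists C => x Dx.
  have h : `|f_ N x| @[N --> \oo] --> `|f x| by apply: cvg_norm; exact: ff.
  by apply: (cvgr_to_le h); apply: nearW => N; exact: fC.
have bC : bmfun D (cst C) by exact: bmfun_cst.
split => //; apply: EFin_inj.
have bf_ N : bmfun D (f_ N) by split => //; exists C; exact: fC.
have rE (h : X -> R) : bmfun D h -> (\int[mu]_(x in D) h x)%:E = (\int[mu]_(x in D) (h x)%:E)%E.
  move=> bh; rewrite /Rintegral fineK//; apply: integrable_fin_num => //.
  exact: bmfun_integrable.
have cv : (\int[mu]_(x in D) (f_ N x)%:E)%E @[N --> \oo] --> (\int[mu]_(x in D) (f x)%:E)%E.
  apply: (@dominated_cvg _ _ _ mu D mD _ _ (EFin \o cst C)) => //.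
  - by move=> N; apply/measurable_EFinP.
  - by move=> x Dx; apply: cvg_EFin; [exact: nearW|exact: ff].
  - exact: bmfun_integrable.
have cv2 : (\int[mu]_(x in D) (f_ N x)%:E)%E @[N --> \oo] --> c%:E.
  by apply: cvg_near_cst; exists N0 => // N /= N0N; rewrite -rE// intf.
by rewrite rE// -(cvg_lim (@ereal_hausdorff R) cv) (cvg_lim (@ereal_hausdorff R) cv2).
Qed.

(** * Stability in terms of the L1 and L2 norms *)

Section sbf_analysis.
Context (R : realType) (n : nat).
Hypothesis n_gt0 : (0 < n)%N.
Local Notation T := (n.+1.-tuple R).
Local Notation d := n.+1.
Local Notation M := (mpol n.+1 R).
Local Notation sigma := (@surface_measure R n).
Local Notation S f := (\int[sigma]_(x in sphere) f x).
Local Notation P := (@proj_kernel R n).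

Let mS : measurable (@sphere R n.+1) := @measurable_sphere R n.+1.
Let Soo := @surface_sphere_lty R n.

Lemma proj_kernel_mul l m x y : sphere x -> sphere y ->
  S (fun z => P l x z * P m y z) = (l == m)%:R * P l x y.
Proof.
move=> xS yS; have [P1 P2] := rk_proj_kernel R n m.
have [p mp pE] := P1 y yS.
transitivity (S (fun z => P l x z * pev p z)).
  by apply: eq_rint => z zS; rewrite pE.
have [lm|lm] := eqVneq l m.
  rewrite mul1r lm in mp *; rewrite P2// -pE//.
  exact: (rk_sym (rk_proj_kernel R n m)).
by rewrite mul0r; exact: (proj_kernel_orth n_gt0 lm xS mp).
Qed.

Lemma proj_kernel_diag_ge0 l x : sphere x -> 0 <= P l x x.
Proof.
move=> xS; have := proj_kernel_mul l l xS xS; rewrite eqxx mul1r => <-.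
by apply: rint_ge0 => // z _; rewrite -expr2 sqr_ge0.
Qed.

(** The squares of [P l x + P l y] and [P l x - P l y] have nonnegative integrals; expanding them
    gives both signs. *)
Lemma normr_proj_kernel_le l x y : sphere x -> sphere y ->
  `|P l x y| <= (P l x x + P l y y) / 2.
Proof.
move=> xS yS.
have bx := proj_kernel_bm l xS; have bL := proj_kernel_bm l yS.
have H (c : R) : 0 <= P l x x + (2 * c) * P l x y + c ^+ 2 * P l y y.
  have e u v : sphere u -> sphere v -> P l u v = S (fun z => P l u z * P l v z).
    by move=> uS vS; rewrite proj_kernel_mul// eqxx mul1r.
  rewrite (e x x)// (e x y)// (e y y)//.
  rewrite -(rintZ mS Soo (2 * c) (bmfunM bx bL)) -(rintZ mS Soo (c ^+ 2) (bmfunM bL bL)).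
  rewrite -(rintD mS Soo (bmfunM bx bx) (bmfunZ (2 * c) (bmfunM bx bL))).
  rewrite -(rintD mS Soo (bmfunD (bmfunM bx bx) (bmfunZ (2 * c) (bmfunM bx bL))) (bmfunZ (c ^+ 2) (bmfunM bL bL))).
  apply: rint_ge0 => // z _.
  by rewrite (_ : _ + _ = (P l x z + c * P l y z) ^+ 2) ?sqr_ge0//; ring.
have := H 1; have := H (-1); rewrite ler_norml => ? ?.
by apply/andP; split; lra.
Qed.

Variables (phi : R -> R) (phihat : nat -> R).
Hypothesis phiE : @sbf R n phi phihat.

Let phihat0 l : 0 < phihat l. Proof. by have [_] := phiE. Qed.

Let part N x y := \sum_(l < N) phihat l * P l x y.

(** The expansion is only assumed to converge pointwise. Positivity of [phihat] makes the partial
    sums increase to [phi 1] on the diagonal, and the diagonal dominates the rest; this is the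
    uniform bound that integration term by term requires. *)
Lemma zonal_partial_le N x y : sphere x -> sphere y -> `|part N x y| <= phi 1.
Proof.
move=> xS yS; have [cvphi _] := phiE.
have diag z : sphere z -> part N z z <= phi 1.
  move=> zS; have := cvphi z z zS zS; move/sphereP : (zS) => -> cv.
  have nd : nondecreasing_seq (fun N => part N z z).
    apply/nondecreasing_seqP => m; rewrite /part big_ord_recr/= lerDl.
    by rewrite mulr_ge0 ?(ltW (phihat0 _))// proj_kernel_diag_ge0.
  have := nondecreasing_cvgn_le nd (cvgP _ cv) N.
  by rewrite (cvg_lim _ cv).
apply: (@le_trans _ _ ((part N x x + part N y y) / 2)); last first.
  by have := diag x xS; have := diag y yS; lra.
rewrite (le_trans (ler_norm_sum _ _ _))// /part -big_split/= mulr_suml.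
apply: ler_sum => l _; rewrite normrM (gtr0_norm (phihat0 l)) -mulrDr -mulrA.
by rewrite ler_wpM2l ?(ltW (phihat0 _))// normr_proj_kernel_le.
Qed.

Let bpart N x : sphere x -> bmfun (@sphere R n.+1) (part N x).
Proof. by move=> xS; apply: bmfun_sum => l _; apply: bmfunZ; exact: proj_kernel_bm. Qed.

Lemma bmfun_zonal xi : sphere xi -> bmfun (@sphere R n.+1) (fun x => phi (dot x xi)).
Proof.
move=> xiS; have [cvphi _] := phiE.
split.
  apply: (measurable_fun_cvg (h := fun N x => part N xi x)).
    by move=> N; have [] := bpart N xiS.
  by move=> x xS; rewrite dotC; exact: cvphi.
exists (phi 1) => x xS.
have h : `|part N xi x| @[N --> \oo] --> `|phi (dot x xi)|.
  by apply: cvg_norm; rewrite dotC; exact: cvphi.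
by apply: (cvgr_to_le h); apply: nearW => N; exact: zonal_partial_le.
Qed.

(** A Funk-Hecke formula: integrated against [P l], the partial sums of the expansion are stationary
    beyond index [l]. *)
Lemma rint_zonal_proj l xi eta : sphere xi -> sphere eta ->
  S (fun x => phi (dot x xi) * P l eta x) = phihat l * P l xi eta.
Proof.
move=> xiS etaS; have [cvphi _] := phiE.
have [mP [B PB]] := proj_kernel_bm l etaS.
have [] // := @rint_bounded_cvg _ _ _ sigma sphere (fun N x => part N xi x * P l eta x)
  (fun x => phi (dot x xi) * P l eta x) (phi 1 * B) (phihat l * P l xi eta) l.+1.
- by move=> N; apply: measurable_funM => //; have [] := bpart N xiS.
- by move=> N x xS; rewrite normrM ler_pM ?PB// zonal_partial_le.
- by move=> x xS; apply: cvgM; [rewrite dotC; exact: cvphi|exact: cvg_cst].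
move=> N lN; rewrite (eq_rint _ (g := fun x => \sum_(m < N) phihat m * (P m xi x * P l eta x))); last first.
  by move=> x _; rewrite /part mulr_suml; apply: eq_bigr => m _; rewrite mulrA.
have bb m : bmfun (@sphere R n.+1) (fun x => P m xi x * P l eta x).
  by apply: bmfunM; exact: proj_kernel_bm.
rewrite rint_sum//; last by move=> m _; exact: bmfunZ.
rewrite (bigD1 (Ordinal lN))//= big1 ?addr0 => [|m].
  by rewrite rintZ// proj_kernel_mul// eqxx mul1r.
rewrite -val_eqE/= => /negbTE ml.
by rewrite rintZ// proj_kernel_mul// ml mul0r mulr0.
Qed.

Variables (X : seq T) (a : T -> R) (delta : R) (k L : nat) (fmin : R).
Hypotheses (Xsep : separated delta X) (delta0 : 0 < delta).
Hypotheses (kdelta : 16 * d%:R / delta < 2 ^+ k) (kL : (d * 2 ^ k <= L)%N).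
Hypotheses (fmin0 : 0 < fmin) (fminE : forall l, (l <= L)%N -> fmin <= phihat l).

Let XS : {in X, forall x, sphere x}. Proof. by have [] := Xsep. Qed.
Let g x := \sum_(xi <- X) a xi * phi (dot x xi).
Let F x := \sum_(xi <- X) a xi * proj_le L xi x.
Let h x := \sum_(y <- X) a y * lker k x y.
Let a2 := \sum_(y <- X) a y ^+ 2.
Let Q l := \sum_(xi <- X) \sum_(eta <- X) a xi * a eta * P l xi eta.

Let bm_sumX (u : T -> T -> R) : (forall y, sphere y -> bmfun (@sphere R n.+1) (u y)) ->
  bmfun (@sphere R n.+1) (fun x => \sum_(y <- X) a y * u y x).
Proof.
move=> bu; apply: (eq_bmfun (f := fun x => \sum_(y <- X | y \in X) a y * u y x)).
  by move=> x _; rewrite [RHS]big_seq.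
by apply: bmfun_sum => y yX; apply: bmfunZ; apply: bu; exact: XS.
Qed.

Let rint_sumX (u : T -> T -> R) (v : T -> R) : (forall y, sphere y -> bmfun (@sphere R n.+1) (u y)) ->
  bmfun (@sphere R n.+1) v ->
  S (fun x => (\sum_(y <- X) a y * u y x) * v x) = \sum_(y <- X) a y * S (fun x => u y x * v x).
Proof.
move=> bu bv; rewrite (eq_rint _ (g := fun x => \sum_(y <- X | y \in X) a y * (u y x * v x))); last first.
  by move=> x _; rewrite big_seq mulr_suml; apply: eq_bigr => y _; rewrite mulrA.
rewrite rint_sum//; last by move=> y yX; apply: bmfunZ; apply: bmfunM => //; apply: bu; exact: XS.
rewrite [RHS]big_seq; apply: eq_bigr => y yX; rewrite rintZ//.
by apply: bmfunM => //; apply: bu; exact: XS.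
Qed.

Let bproj_le y : sphere y -> bmfun (@sphere R n.+1) (proj_le L y).
Proof. by move=> yS; apply: bmfun_sum => l _; exact: proj_kernel_bm. Qed.

Let bF : bmfun (@sphere R n.+1) F. Proof. exact: bm_sumX. Qed.

Lemma bmfun_kernel_comb : bmfun (@sphere R n.+1) g.
Proof.
apply: (eq_bmfun (f := fun x => \sum_(y <- X) a y * phi (dot x y))) => //.
by apply: (bm_sumX (u := fun y x => phi (dot x y))) => y; exact: bmfun_zonal.
Qed.

Let bh : bmfun (@sphere R n.+1) h.
Proof.
apply: (bm_sumX (u := fun y x => lker k x y)) => y yS.
by apply: eq_bmfun (bmfun_lker k yS) => x _; exact: lkerC.
Qed.

(** [Q l] is the squared L2 norm of the degree [l] component of [F]. *)
Let Q_ge0 l : 0 <= Q l.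
Proof.
have -> : Q l = S (fun x => (\sum_(y <- X) a y * P l y x) * (\sum_(y <- X) a y * P l y x)).
  have bu y : sphere y -> bmfun (@sphere R n.+1) (P l y) by exact: proj_kernel_bm.
  rewrite (rint_sumX bu (bm_sumX bu)) /Q big_seq [RHS]big_seq; apply: eq_bigr => xi xiX.
  under eq_Rintegral do rewrite mulrC.
  rewrite (rint_sumX bu (bu _ (XS xiX))) mulr_sumr big_seq [RHS]big_seq.
  apply: eq_bigr => eta etaX; rewrite proj_kernel_mul ?eqxx ?mul1r; [|exact: XS|exact: XS].
  by rewrite mulrA (rk_sym (rk_proj_kernel R n l) (XS etaX) (XS xiX)).
by apply: rint_ge0 => // x _; rewrite -expr2 sqr_ge0.
Qed.

Let S_gF : S (fun x => g x * F x) = \sum_(l < L.+1) phihat l * Q l.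
Proof.
have bphi y : sphere y -> bmfun (@sphere R n.+1) (fun x => phi (dot x y)) by exact: bmfun_zonal.
rewrite (rint_sumX (u := fun y x => phi (dot x y)))//.
transitivity (\sum_(xi <- X) \sum_(eta <- X) \sum_(l < L.+1) phihat l * (a xi * a eta * P l xi eta)).
  rewrite big_seq [RHS]big_seq; apply: eq_bigr => xi xiX.
  under eq_Rintegral do rewrite mulrC.
  rewrite rint_sumX//; last exact/bphi/XS.
  rewrite mulr_sumr big_seq [RHS]big_seq; apply: eq_bigr => eta etaX.
  transitivity (a xi * (a eta * \sum_(l < L.+1) phihat l * P l xi eta)).
    congr (_ * (_ * _)).
    rewrite (eq_rint _ (g := fun x => \sum_(l < L.+1) phi (dot x xi) * P l eta x)); last first.
      by move=> x _; rewrite /proj_le mulrC mulr_sumr.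
    rewrite rint_sum//.
      by apply: eq_bigr => l _; rewrite rint_zonal_proj//; exact: XS.
    by move=> l _; apply: bmfunM; [exact/bphi/XS|apply: proj_kernel_bm; exact: XS].
  by rewrite !mulr_sumr; apply: eq_bigr => l _; ring.
under eq_bigr do rewrite exchange_big/=.
rewrite exchange_big/=; apply: eq_bigr => l _; rewrite /Q mulr_sumr.
by apply: eq_bigr => xi _; rewrite mulr_sumr.
Qed.

Let proj_le_rk := @rk_proj_le R n n_gt0 L.

Let S_Fpoly p : mdeg_le L p -> S (fun x => F x * pev p x) = \sum_(xi <- X) a xi * pev p xi.
Proof.
move=> pL; rewrite rint_sumX//; last exact: bmfun_pev.
rewrite big_seq [RHS]big_seq; apply: eq_bigr => xi xiX; congr (_ * _).
by have [_ ->] := proj_le_rk; last exact: XS.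
Qed.

Let F_poly : exists2 p, mdeg_le L p & forall x, sphere x -> F x = pev p x.
Proof.
have [P1 _] := proj_le_rk.
have H y : exists p, y \in X -> mdeg_le L p /\ forall x, sphere x -> proj_le L y x = pev p x.
  have [yX|yX] := boolP (y \in X); last by exists 0.
  by have [p ? ?] := P1 y (XS yX); exists p.
have [p pP] := choice H.
exists (\sum_(y <- X) a y *: p y).
  apply: (subspace_sum (@subspace_mdeg_le R n L)) => y yX.
  by apply: (subspaceZ (V := fun p => mdeg_le L p)); [exact: subspace_mdeg_le|have [] := pP _ yX].
move=> x xS; rewrite pev_sum /F big_seq [RHS]big_seq; apply: eq_bigr => y yX.
by rewrite pevZ; have [_ ->] := pP _ yX.
Qed.

Let FF := S (fun x => F x ^+ 2).

Let S_FF : FF = \sum_(l < L.+1) Q l.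
Proof.
have [p pL pE] := F_poly.
transitivity (S (fun x => F x * pev p x)).
  by apply: eq_rint => x xS; rewrite -pE// expr2.
rewrite S_Fpoly//.
transitivity (\sum_(xi <- X) \sum_(eta <- X) \sum_(l < L.+1) a xi * a eta * P l xi eta).
  rewrite big_seq [RHS]big_seq; apply: eq_bigr => xi xiX.
  rewrite -pE; last exact: XS.
  rewrite /F mulr_sumr big_seq [RHS]big_seq; apply: eq_bigr => eta etaX.
  rewrite (rk_sym proj_le_rk (XS etaX) (XS xiX)) mulrA /proj_le mulr_sumr.
  exact: eq_bigr.
under eq_bigr do rewrite exchange_big/=.
by rewrite exchange_big.
Qed.

(** Both integrals are sums of the nonnegative [Q l], with weights [phihat l] on one side and 1 on
    the other. *)
Let gF_ge : fmin * FF <= S (fun x => g x * F x).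
Proof.
rewrite S_gF S_FF mulr_sumr; apply: ler_sum => l _.
by rewrite ler_wpM2r ?Q_ge0// fminE// -ltnS.
Qed.

Let FF0 : 0 <= FF. Proof. by apply: rint_ge0 => // x _; exact: sqr_ge0. Qed.

Let B := 2 * 8 ^+ d * (shell_cst R n * (2 ^- k) ^+ n).

Let a2_le : a2 <= 4 * B * FF.
Proof.
have a20 : 0 <= a2 by apply: sumr_ge0 => y _; exact: sqr_ge0.
have B0 : 0 <= B.
  by rewrite /B /shell_cst !mulr_ge0 ?exprn_ge0 ?invr_ge0 ?exprn_ge0.
have hL : mdeg_le L (\sum_(y <- X) a y *: lkerm k y).
  apply: (subspace_sum (@subspace_mdeg_le R n L)) => y yX.
  apply: (subspaceZ (V := fun p => mdeg_le L p)); first exact: subspace_mdeg_le.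
  exact: mdeg_leW (mdeg_le_lkerm k y).
have hE x : pev (\sum_(y <- X) a y *: lkerm k y) x = h x.
  by rewrite pev_sum; apply: eq_bigr => y _; rewrite pevZ pev_lkerm.
have e1 : a2 / 2 <= S (fun x => F x * h x).
  have := lker_comb_diag delta0 Xsep kdelta a.
  rewrite -/a2 => /le_trans; apply.
  rewrite [leRHS](_ : _ = S (fun x => F x * pev (\sum_(y <- X) a y *: lkerm k y) x)).
    by rewrite S_Fpoly//; apply: ler_sum => x _; rewrite hE.
  by apply: eq_rint => x _; rewrite hE.
have e2 : S (fun x => h x ^+ 2) <= B * a2 by exact: (lker_comb_L2 delta0 Xsep kdelta a).
have e3 := rint_CS mS Soo bF bh; rewrite -/FF in e3.
have [->|an] := eqVneq a2 0; first by rewrite !mulr_ge0.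
have ap : 0 < a2 by rewrite lt_def an.
have e4 : FF * S (fun x => h x ^+ 2) <= FF * (B * a2) by rewrite ler_wpM2l.
have : a2 ^+ 2 <= (4 * B * FF) * a2.
  set s := S (fun x => F x * h x) in e1 e3.
  have : (a2 / 2) ^+ 2 <= s ^+ 2 by rewrite lerXn2r ?nnegrE ?divr_ge0//; lra.
  nra.
by rewrite expr2 ler_pM2r.
Qed.

Lemma stability_L2 : fmin ^+ 2 * a2 <= 4 * B * S (fun x => g x ^+ 2).
Proof.
have B0 : 0 <= B.
  by rewrite /B /shell_cst !mulr_ge0 ?exprn_ge0 ?invr_ge0 ?exprn_ge0.
have G0 : 0 <= S (fun x => g x ^+ 2) by apply: rint_ge0 => // x _; exact: sqr_ge0.
suff e : fmin ^+ 2 * FF <= S (fun x => g x ^+ 2).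
  have : fmin ^+ 2 * a2 <= fmin ^+ 2 * (4 * B * FF) by rewrite ler_wpM2l ?sqr_ge0// a2_le.
  move=> /le_trans; apply; rewrite mulrCA.
  by rewrite ler_wpM2l ?mulr_ge0.
have e3 := rint_CS mS Soo bmfun_kernel_comb bF; rewrite -/FF in e3.
have [->|Fn] := eqVneq FF 0; first by rewrite mulr0.
have Fp : 0 < FF by rewrite lt_def Fn.
have : (fmin * FF) ^+ 2 <= S (fun x => g x * F x) ^+ 2.
  by rewrite lerXn2r ?nnegrE ?mulr_ge0 ?(ltW fmin0)//; have := gF_ge; have := mulr_ge0 (ltW fmin0) FF0; lra.
move=> /le_trans/(_ e3).
by rewrite exprMn [FF ^+ 2]expr2 mulrA ler_pM2r.
Qed.

Lemma stability_L1 : fmin ^+ 2 * a2 <=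
  4 * B * (2 * L.+1%:R ^+ n / S (pev 1)) * S (fun x => `|g x|) ^+ 2.
Proof.
have B0 : 0 <= B.
  by rewrite /B /shell_cst !mulr_ge0 ?exprn_ge0 ?invr_ge0 ?exprn_ge0.
have S1 := @surface_sphere_gt0 R n.
pose kap := 2 * L.+1%:R ^+ n / S (pev 1).
have kap0 : 0 <= kap by rewrite divr_ge0 ?mulr_ge0 ?exprn_ge0// ltW.
rewrite -/kap.
pose G := S (fun x => `|g x|); rewrite -/G.
have G0 : 0 <= G by apply: rint_ge0.
suff e : fmin ^+ 2 * FF <= kap * G ^+ 2.
  have : fmin ^+ 2 * a2 <= fmin ^+ 2 * (4 * B * FF) by rewrite ler_wpM2l ?sqr_ge0// a2_le.
  move=> /le_trans; apply; rewrite mulrCA -[leRHS]mulrA.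
  by rewrite ler_wpM2l ?mulr_ge0.
(* Cauchy-Schwarz in the reproducing formula for [F], whose kernel has squared norm
   [proj_le L x x]. *)
have Fx x : sphere x -> F x ^+ 2 <= kap * FF.
  move=> xS; have [p pL pE] := F_poly; have [_ K2] := proj_le_rk.
  have bK := bproj_le xS.
  have -> : F x = S (fun y => proj_le L x y * F y).
    rewrite pE// -K2//; apply: eq_rint => y yS; by rewrite pE.
  apply: (le_trans (rint_CS mS Soo bK bF)); rewrite -/FF ler_wpM2r//.
  have [q qL qE] := proj_le_rk.1 x xS.
  have -> : S (fun y => proj_le L x y ^+ 2) = proj_le L x x.
    rewrite [RHS]qE// -K2//; apply: eq_rint => y yS; by rewrite -qE// expr2.
  by rewrite ler_pdivlMr// proj_le_diag_le.
pose s := Num.sqrt (kap * FF).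
have s0 : 0 <= s by exact: sqrtr_ge0.
have ss : s ^+ 2 = kap * FF by rewrite sqr_sqrtr// mulr_ge0.
have gFs : S (fun x => g x * F x) <= s * G.
  rewrite /G -rintZ//; last exact: (bmfun_norm bmfun_kernel_comb).
  apply: le_rint => //.
  - exact: (bmfunM bmfun_kernel_comb bF).
  - exact: (bmfunZ s (bmfun_norm bmfun_kernel_comb)).
  move=> x xS; apply: (le_trans (ler_norm _)); rewrite normrM mulrC ler_wpM2r//.
  by rewrite -(@ler_pXn2r _ 2) ?nnegrE// real_normK ?num_real// ss Fx.
have [->|Fn] := eqVneq FF 0; first by rewrite mulr0 mulr_ge0 ?sqr_ge0.
have Fp : 0 < FF by rewrite lt_def Fn.
have : (fmin * FF) ^+ 2 <= (s * G) ^+ 2.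
  rewrite lerXn2r ?nnegrE ?mulr_ge0 ?(ltW fmin0)//; exact: le_trans gF_ge gFs.
rewrite !exprMn ss [FF ^+ 2]expr2 => e.
by rewrite -(ler_pM2r Fp); nra.
Qed.

End sbf_analysis.

(** * Separation radius and mesh ratio *)

Section trigonometry.
Context (R : realType).
Implicit Types x t : R.

Lemma sin_le_id x : 0 <= x -> sin x <= x.
Proof.
move=> x0.
have [c _ e] := @MVT_segment R sin cos 0 x x0 (fun y _ => is_derive_sin y)
  (continuous_subspaceT (@continuous_sin R)).
rewrite sin0 !subr0 in e; rewrite e -[leRHS]mul1r ler_wpM2r//; exact: cos_le1.
Qed.

Lemma sin_ge_quarter x : 0 <= x <= pi / 2 -> x / 4 <= sin x.
Proof.
move=> /andP[x0 x1].
have [c] := @MVT_segment R sin cos 0 (x / 2) (divr_ge0 x0 (ler0n R 2)) (fun y _ => is_derive_sin y)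
  (continuous_subspaceT (@continuous_sin R)).
rewrite in_itv/= => /andP[c0 c1]; rewrite sin0 !subr0 => e.
(* On this range [cos (2 t) >= 0], so [cos t ^+ 2 >= 1/2]; the bound serves both for the mean value
   theorem and in [sin x = 2 sin (x/2) cos (x/2)]. *)
have half t : 0 <= t <= x / 2 -> 2^-1 <= cos t.
  move=> /andP[t0 t1].
  have p0 : 0 <= cos t by apply: cos_ge0_pihalf; apply/andP; split; lra.
  have : 0 <= cos (t *+ 2) by apply: cos_ge0_pihalf; rewrite -mulr_natr; apply/andP; split; lra.
  rewrite cos_mulr2n -mulr_natr => h; nra.
have h1 : 2^-1 <= cos c by apply: half; rewrite c0.
have h2 : 2^-1 <= cos (x / 2) by apply: half; rewrite lexx andbT; lra.
have -> : sin x = cos (x / 2) * sin (x / 2) *+ 2.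
  by rewrite -sin_mulr2n -(mulr_natr (x / 2) 2) divfK.
rewrite e -[leRHS]mulr_natr.
have h3 : x / 4 <= cos c * (x / 2) by nra.
have : 2^-1 * (cos c * (x / 2)) <= cos (x / 2) * (cos c * (x / 2)).
  by rewrite ler_wpM2r//; lra.
lra.
Qed.

Lemma cos_half x : cos x = 1 - 2 * sin (x / 2) ^+ 2.
Proof.
have e : (x / 2) *+ 2 = x by rewrite -(mulr_natr (x / 2) 2) divfK.
by rewrite -[X in cos X]e cos_mulr2n cos2sin2 -mulr_natr; ring.
Qed.

Lemma chord_acosE t : -1 <= t <= 1 -> 2 - 2 * t = 4 * sin (acos t / 2) ^+ 2.
Proof.
move=> t1; have e : cos (acos t) = t by apply: acosK; rewrite in_itv.
by rewrite -{1}e cos_half; ring.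
Qed.

Lemma chord_acos_le t : -1 <= t <= 1 -> 2 - 2 * t <= acos t ^+ 2.
Proof.
move=> t1; have a0 := acos_ge0 t1; have a1 := acos_lepi t1.
rewrite chord_acosE//.
have h0 : 0 <= sin (acos t / 2) by apply: sin_ge0_pi; apply/andP; split; lra.
have h1 : sin (acos t / 2) <= acos t / 2 by apply: sin_le_id; lra.
nra.
Qed.

Lemma chord_acos_ge t : -1 <= t <= 1 -> acos t ^+ 2 / 16 <= 2 - 2 * t.
Proof.
move=> t1; have a0 := acos_ge0 t1; have a1 := acos_lepi t1.
rewrite chord_acosE//.
have h1 : acos t / 2 / 4 <= sin (acos t / 2).
  by apply: sin_ge_quarter; apply/andP; split; lra.
nra.
Qed.

End trigonometry.

Section centers_geometry.
Context (R : realType) (n : nat).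
Hypothesis n_gt0 : (0 < n)%N.
Local Notation T := (n.+1.-tuple R).
Implicit Types (x y : T) (X : {fset T}).

Lemma geodesic_dist_ge0 x y : sphere x -> sphere y -> 0 <= geodesic_dist x y.
Proof. by move=> xS yS; apply: acos_ge0; exact: sphere_dot_itv. Qed.

Lemma geodesic_dist_lepi x y : sphere x -> sphere y -> geodesic_dist x y <= pi.
Proof. by move=> xS yS; apply: acos_lepi; exact: sphere_dot_itv. Qed.

Lemma sphere_dot_lt1 x y : sphere x -> sphere y -> x != y -> dot x y < 1.
Proof.
move=> xS yS xy; rewrite lt_neqAle; have /andP[_ ->] := sphere_dot_itv xS yS.
rewrite andbT; apply: contra_neq xy => xy1.
have /eqP := sqdist_sphere xS yS; rewrite xy1 mulr1 subrr psumr_eq0; last first.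
  by move=> i _; exact: sqr_ge0.
move=> /allP h; apply: eq_from_tnth => i; apply/eqP; rewrite -subr_eq0.
by have := h i; rewrite mem_index_enum sqrf_eq0 => /(_ isT).
Qed.

Lemma seq_pos_lb (s : seq R) : {in s, forall r : R, 0 < r} ->
  exists2 m : R, 0 < m & {in s, forall r : R, m <= r}.
Proof.
elim: s => [|r s IH] s0; first by exists 1.
have [|m m0 ms] := IH; first by move=> t ts; apply: s0; rewrite inE ts orbT.
exists (Num.min r m); first by rewrite lt_min m0 andbT s0// inE eqxx.
move=> t; rewrite inE => /orP[/eqP->|/ms mt]; first by rewrite ge_min lexx.
by rewrite ge_min mt orbT.
Qed.

Section centers.
Variables (X : {fset T}) (XC : centers X).

Let XS : {in X, forall x, sphere x}. Proof. by case: XC. Qed.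

Let q := separation_radius X.

Lemma centers_two : exists x y, [/\ x \in X, y \in X & x != y].
Proof.
have [+ _] := XC; have := fset_uniq X.
have sub z : z \in enum_fset X -> z \in X by [].
case: (enum_fset X) sub => [|x [|y s]] //= sub /andP[xy _] _.
exists x, y; split; [by apply: sub; rewrite inE eqxx|by apply: sub; rewrite !inE eqxx orbT|].
by apply: contraNneq xy => ->; rewrite inE eqxx.
Qed.

Let pairs : set R := [set geodesic_dist z.1 z.2 | z in
  [set z : T * T | [/\ z.1 \in X, z.2 \in X & z.1 != z.2]]].

Let pairs_lb : has_lbound pairs.
Proof. by exists 0 => _ [[x y] [/= xX yX _] <-]; apply: geodesic_dist_ge0; exact: XS. Qed.

Lemma separation_radius_le x y : x \in X -> y \in X -> x != y ->
  2 * q <= geodesic_dist x y.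
Proof.
move=> xX yX xy; rewrite /q /separation_radius -/pairs mulrC divfK//.
by apply: ge_inf => //; exists (x, y).
Qed.

Lemma separation_radius_gt0 : 0 < q.
Proof.
rewrite divr_gt0//.
have [x [y [xX yX xy]]] := centers_two.
have [|m m0 ms] := @seq_pos_lb [seq geodesic_dist z.1 z.2 |
    z <- [seq z <- [seq (u, v) | u <- enum_fset X, v <- enum_fset X] | z.1 != z.2]].
  move=> r /mapP[z]; rewrite mem_filter => /andP[zz /allpairsP[[u v] [/= uX vX e]]] ->.
  rewrite e /= in zz *; apply: acos_gt0.
  have uS := XS uX; have vS := XS vX.
  by rewrite sphere_dot_lt1// andbT; have /andP[] := sphere_dot_itv uS vS.
apply: (lt_le_trans m0); apply: lb_le_inf; first by exists (geodesic_dist x y), (x, y).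
move=> _ [[u v] [/= uX vX uv] <-]; apply: ms; apply/mapP; exists (u, v) => //.
by rewrite mem_filter uv/=; apply/allpairsP; exists (u, v).
Qed.

Lemma separation_radius_le2 : q <= 2.
Proof.
have [x [y [xX yX xy]]] := centers_two.
have := separation_radius_le xX yX xy.
have := geodesic_dist_lepi (XS xX) (XS yX).
by have /andP[_] := @pihalf_02 R; lra.
Qed.

(** A chord is at least a quarter of its arc, and arcs between centers are at least [2 q]. *)
Lemma centers_separated : separated (q / 2) (enum_fset X).
Proof.
split=> [||x y xX yX xy]; [exact: fset_uniq|exact: XS|].
have xy1 := sphere_dot_itv (XS xX) (XS yX).
apply: le_trans (chord_acos_ge xy1).
have := separation_radius_le xX yX xy; have := separation_radius_gt0.
rewrite /geodesic_dist => ? ?; nra.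
Qed.

Lemma sphere_orth x : sphere x -> exists2 e : T, sphere e & dot x e = 0.
Proof.
move=> /sphereP xS.
have [i xi] : exists i, tnth x i != 0.
  apply/not_existsP => H; move: xS; rewrite /dot big1 => [/eqP|i _]; first by rewrite eq_sym oner_eq0.
  by have /negP := H i; rewrite negbK => /eqP->; rewrite mul0r.
have [j ji] : exists j : 'I_n.+1, j != i.
  have [->|] := eqVneq i ord0; last by exists ord0; rewrite eq_sym.
  by exists (inord 1); rewrite -val_eqE/= inordK.
pose w : T := [tuple if l == i then - tnth x j else if l == j then tnth x i else 0 | l < n.+1].
have two (z : T) : dot z w = - tnth z i * tnth x j + tnth z j * tnth x i.
  rewrite /dot (bigD1 i)//= (bigD1 j)//= big1 => [|l /andP[/negbTE li /negbTE lj]].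
    by rewrite !tnth_mktuple eqxx (negbTE ji) eqxx; ring.
  by rewrite tnth_mktuple li lj mulr0.
have w0 : 0 < enorm w.
  rewrite sqrtr_gt0 two !tnth_mktuple eqxx (negbTE ji) eqxx.
  have : 0 < tnth x i ^+ 2 by rewrite exprn_even_gt0.
  by have := sqr_ge0 (tnth x j); rewrite !expr2; lra.
exists (normalize w); first exact: sphere_normalize.
by rewrite normalizeE dot_tscaler two; ring.
Qed.

(* A point at chordal distance q/4 from a centre is far from all the centres. *)
Lemma mesh_ratio_ge : 4^-1 <= mesh_ratio X.
Proof.
have q0 := separation_radius_gt0; have q2 := separation_radius_le2.
rewrite /mesh_ratio ler_pdivlMr -/q//.
have [x [x' [xX x'X xx']]] := centers_two.
have xS := XS xX.
have [e eS xe] := sphere_orth xS.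
pose delta := q / 2.
(* The cosine for which the squared chord from [x] to [y] is [2 - 2 c = delta^2 / 4], that is,
   [(q / 4)^2]. *)
pose c := 1 - delta ^+ 2 / 8.
have c01 : 0 <= c <= 1.
  by rewrite /c /delta; apply/andP; split; nra.
pose s := Num.sqrt (1 - c ^+ 2).
have ss : s ^+ 2 = 1 - c ^+ 2 by rewrite sqr_sqrtr//; move/andP: c01 => [? ?]; nra.
pose y : T := [tuple c * tnth x i + s * tnth e i | i < n.+1].
have doty z : dot z y = c * dot z x + s * dot z e.
  rewrite /dot !mulr_sumr -big_split/=; apply: eq_bigr => i _.
  by rewrite tnth_mktuple; ring.
have dotxy : dot x y = c by rewrite doty xe; move/sphereP: xS => ->; ring.
have yS : sphere y.
  apply/sphereP; rewrite doty dotC dotxy [dot y e]dotC doty [dot e x]dotC xe.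
  by move/sphereP: eS => ->; rewrite mulr0 add0r mulr1 -!expr2 ss; ring.
(* For another center, [|xi - x|^2 <= 2 |xi - y|^2 + 2 |x - y|^2] leaves
   [|xi - y|^2 >= delta^2 / 2 - delta^2 / 4]. *)
have far xi : xi \in X -> delta ^+ 2 / 4 <= 2 - 2 * dot xi y.
  move=> xiX; have xiS := XS xiX.
  have [->|xix] := eqVneq xi x; first by rewrite dotxy /c; lra.
  have [_ _ sp] := centers_separated; have := sp _ _ xiX xX xix.
  rewrite -/delta -!sqdist_sphere//.
  have : \sum_(i < n.+1) (tnth xi i - tnth x i) ^+ 2 <=
      2 * \sum_(i < n.+1) (tnth xi i - tnth y i) ^+ 2 + 2 * \sum_(i < n.+1) (tnth x i - tnth y i) ^+ 2.
    rewrite !mulr_sumr -big_split/=; apply: ler_sum => i _.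
    have := sqr_ge0 (tnth xi i + tnth x i - 2 * tnth y i); nra.
  rewrite (sqdist_sphere xS yS) dotxy /c; lra.
pose D y := inf [set geodesic_dist xi y | xi in [set` X]].
have geo xi : xi \in X -> delta / 2 <= geodesic_dist xi y.
  move=> xiX; have xiy := sphere_dot_itv (XS xiX) yS.
  have := far _ xiX; have := chord_acos_le xiy; have := acos_ge0 xiy.
  by rewrite /geodesic_dist /delta => ? ? ?; nra.
have Dy : delta / 2 <= D y.
  apply: lb_le_inf; first by exists (geodesic_dist x y), x.
  by move=> _ [xi xiX <-]; exact: geo.
apply: (@le_trans _ _ (D y)).
  by apply: le_trans Dy; rewrite /delta; lra.
apply: ub_le_sup; last by exists y.
exists pi => _ [z zS <-]; apply: (@le_trans _ _ (geodesic_dist x z)).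
  apply: ge_inf; last by exists x.
  by exists 0 => _ [xi xiX <-]; apply: geodesic_dist_ge0 => //; exact: XS.
exact: geodesic_dist_lepi.
Qed.

End centers.
End centers_geometry.

(** * Discrete and continuous p-norms *)

Section discrete_norms.
Context (R : realType) (I : eqType).
Implicit Types (s : seq I) (a : I -> R).

Lemma sum_powR_scale s a (r b : R) : 0 < b ->
  \sum_(i <- s) `|a i| `^ r = b `^ r * \sum_(i <- s) (`|a i| / b) `^ r.
Proof.
move=> b0; rewrite mulr_sumr; apply: eq_bigr => i _.
rewrite -powRM ?divr_ge0 ?(ltW b0)//; congr (_ `^ _).
by rewrite mulrC divfK// gt_eqF.
Qed.

Lemma powR_le_sqr (z r : R) : 0 <= z -> 2 <= r -> z <= 1 -> z `^ r <= z ^+ 2.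
Proof.
move=> z0 r2 z1; rewrite -powR_mulrn//.
have [->|zn] := eqVneq z 0; first by rewrite !powR0// gt_eqF//; lra.
by apply: ger_powR => //; rewrite lt_def zn z0.
Qed.

Lemma powR_le_1Dsqr (z r : R) : 0 <= z -> 0 <= r <= 2 -> z `^ r <= 1 + z ^+ 2.
Proof.
move=> z0 /andP[r0 r2]; have [z1|/ltW z1] := leP z 1.
  have : z `^ r <= 1 `^ r by apply: ge0_ler_powR; rewrite ?nnegrE.
  by rewrite powR1; have := sqr_ge0 z; lra.
have : z `^ r <= z `^ 2 by apply: ler_powR.
by rewrite powR_mulrn//; lra.
Qed.

Lemma powR_root (x y r : R) : 0 < r -> 0 <= x -> 0 <= y -> x <= y `^ r -> x `^ r^-1 <= y.
Proof.
move=> r0 x0 y0 xy.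
have -> : y = (y `^ r) `^ r^-1 by rewrite -powRrM divff ?gt_eqF// powRr1.
by apply: ge0_ler_powR; rewrite ?nnegrE ?powR_ge0 ?invr_ge0 ?(ltW r0).
Qed.

Lemma sqr_le_sum s a i : i \in s -> a i ^+ 2 <= \sum_(j <- s) a j ^+ 2.
Proof.
move=> si; rewrite (big_rem i)//= lerDl; apply: sumr_ge0 => j _; exact: sqr_ge0.
Qed.

Lemma sum0_all0 s a : \sum_(j <- s) a j ^+ 2 = 0 -> {in s, forall i, a i = 0}.
Proof.
move=> a0 i /(sqr_le_sum a); rewrite a0 => h.
by apply/eqP; rewrite -sqrf_eq0 eq_le h sqr_ge0.
Qed.

(** After division by the 2-norm all entries are at most 1, where [z^r <= z^2]. *)
Lemma sum_powR_ge2 s a (r : R) : 2 <= r ->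
  (\sum_(i <- s) `|a i| `^ r) `^ r^-1 <= Num.sqrt (\sum_(i <- s) a i ^+ 2).
Proof.
move=> r2; have r0 : 0 < r by lra.
set A2 := \sum_(i <- s) a i ^+ 2.
have A20 : 0 <= A2 by apply: sumr_ge0 => i _; exact: sqr_ge0.
have sp0 : 0 <= \sum_(i <- s) `|a i| `^ r by apply: sumr_ge0 => i _; exact: powR_ge0.
apply: powR_root => //.
have [A0|An] := eqVneq A2 0.
  rewrite big_seq big1 ?powR_ge0// => i /(sum0_all0 A0) ->.
  by rewrite normr0 powR0// gt_eqF.
set A := Num.sqrt A2; have Ap : 0 < A by rewrite sqrtr_gt0 lt_def An.
have AA : A ^+ 2 = A2 by rewrite sqr_sqrtr.
rewrite (sum_powR_scale s a r Ap) ger_pMr ?powR_gt0//.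
apply: (@le_trans _ _ (\sum_(i <- s) (`|a i| / A) ^+ 2)).
  rewrite big_seq [leRHS]big_seq; apply: ler_sum => i si.
  apply: powR_le_sqr => //; first by rewrite divr_ge0// ltW.
  rewrite ler_pdivrMr// mul1r -(@ler_pXn2r _ 2) ?nnegrE ?(ltW Ap)// AA.
  by rewrite real_normK ?num_real// sqr_le_sum.
rewrite (eq_bigr (fun i => a i ^+ 2 / A2)) => [|i _]; last first.
  by rewrite exprMn exprVn AA real_normK ?num_real.
by rewrite -mulr_suml divff.
Qed.

(* Once [|a i|] is divided by the root mean square of [a], the inequality
   [z^r <= 1 + z^2] replaces Hoelder's at the cost of a factor 2. *)
Lemma sum_powR_le2 s a (r : R) : 1 <= r <= 2 -> (0 < size s)%N ->
  (\sum_(i <- s) `|a i| `^ r) `^ r^-1 <=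
  2 * (size s)%:R `^ (r^-1 - 2^-1) * Num.sqrt (\sum_(i <- s) a i ^+ 2).
Proof.
move=> /andP[r1 r2] s0; have r0 : 0 < r by lra.
set A2 := \sum_(i <- s) a i ^+ 2.
have A20 : 0 <= A2 by apply: sumr_ge0 => i _; exact: sqr_ge0.
have sp0 : 0 <= \sum_(i <- s) `|a i| `^ r by apply: sumr_ge0 => i _; exact: powR_ge0.
have [A0|An] := eqVneq A2 0.
  rewrite big_seq big1 => [|i /(sum0_all0 A0) ->]; last first.
    by rewrite normr0 powR0// gt_eqF.
  by rewrite powR0 ?invr_eq0 ?gt_eqF// !mulr_ge0 ?powR_ge0 ?sqrtr_ge0.
set A := Num.sqrt A2; have Ap : 0 < A by rewrite sqrtr_gt0 lt_def An.
have AA : A ^+ 2 = A2 by rewrite sqr_sqrtr.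
set m : R := (size s)%:R.
have m0 : 0 < m by rewrite ltr0n.
pose b := A * m `^ (- 2^-1).
have b0 : 0 < b by rewrite mulr_gt0// powR_gt0.
have bb : b ^+ 2 = A2 / m.
  rewrite exprMn AA; congr (_ * _).
  rewrite -powR_mulrn ?powR_ge0// -powRrM mulNr mulVf// powR_inv1// ltW//.
have sumz : \sum_(i <- s) (`|a i| / b) `^ r <= 2 * m.
  apply: (@le_trans _ _ (\sum_(i <- s) (1 + (`|a i| / b) ^+ 2))).
    apply: ler_sum => i _; apply: powR_le_1Dsqr; first by rewrite divr_ge0// ltW.
    by rewrite (ltW r0).
  rewrite big_split/= big_const_seq count_predT iter_addr addr0 -/m.
  rewrite (eq_bigr (fun i => a i ^+ 2 / (A2 / m))) => [|i _]; last first.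
    by rewrite exprMn exprVn bb real_normK ?num_real.
  rewrite -mulr_suml -/A2 (_ : A2 / (A2 / m) = m); first by lra.
  by field; rewrite An gt_eqF.
apply: powR_root => //; first by rewrite !mulr_ge0 ?powR_ge0 ?sqrtr_ge0.
rewrite (sum_powR_scale s a r b0).
apply: (@le_trans _ _ (b `^ r * (2 * m))); first by rewrite ler_wpM2l ?powR_ge0.
have -> : 2 * m `^ (r^-1 - 2^-1) * A = b * (2 * m `^ r^-1).
  rewrite /b powRD; first by ring.
  by apply/implyP => _; rewrite gt_eqF.
rewrite [leRHS]powRM ?mulr_ge0 ?powR_ge0 ?(ltW b0)//.
rewrite ler_wpM2l ?powR_ge0// powRM ?powR_ge0// -powRrM mulVf ?gt_eqF// powRr1 ?(ltW m0)//.
rewrite ler_wpM2r ?(ltW m0)//.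
  by rewrite -[leLHS]powRr1//; apply: ler_powR => //; lra.
exact: ltW.
Qed.

End discrete_norms.

Section Lp_norms.
Context (R : realType) (n : nat).
Local Notation T := (n.+1.-tuple R).
Local Notation sigma := (@surface_measure R n).
Local Notation S f := (\int[sigma]_(x in sphere) f x).

Let mS : measurable (@sphere R n.+1) := @measurable_sphere R n.+1.
Let Soo := @surface_sphere_lty R n.

Lemma rint_pev1 : S (pev 1) = fine (sigma sphere).
Proof.
rewrite (eq_rint _ (g := cst 1)); last by move=> x _; rewrite pev1.
by rewrite rint_cst// mul1r.
Qed.

(* [z^j <= 1 + z^r] for [z = |g| / tau]. *)
Lemma Lp_norm_bound (p : \bar R) (g : T -> R) (j : nat) (tau : R) :
  bmfun (@sphere R n.+1) g -> (0 < j)%N -> (j%:R%:E <= p)%E -> (@Lp_norm R n p g < tau%:E)%E ->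
  S (fun x => `|g x| ^+ j) <= (S (pev 1) + 1) * tau ^+ j.
Proof.
move=> bg j0 jp Ntau.
have N0 : (0 <= @Lp_norm R n p g)%E by exact: Lnorm_ge0.
have tau0 : 0 < tau by rewrite -lte_fin; exact: le_lt_trans N0 Ntau.
have S1 := @surface_sphere_gt0 R n.
have bgj : bmfun (@sphere R n.+1) (fun x => `|g x| ^+ j) by apply: bmfunX; exact: bmfun_norm.
have rcst c : S (fun=> c) = c * S (pev 1) by rewrite rint_pev1 -(rint_cst sigma _ c).
have jR0 : 0 < j%:R :> R by rewrite ltr0n.
case: p jp Ntau N0 => [r| |] jp Ntau N0 //.
- rewrite lee_fin in jp.
  have r0 : 0 < r by exact: lt_le_trans jp.
  have bgr : bmfun (@sphere R n.+1) (fun x => `|g x| `^ r).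
    have [mg [M gM]] := bmfun_norm bg; split.
      exact: (measurableT_comp (measurable_powR r) mg).
    exists (M `^ r) => x xS; rewrite ger0_norm ?powR_ge0//.
    have := gM x xS; rewrite normr_id => h.
    by apply: ge0_ler_powR; rewrite ?nnegrE ?(ltW r0)// (le_trans _ h).
  set I := S (fun x => `|g x| `^ r).
  have IE : (@Lp_norm R n r%:E g `^ r = I%:E)%E.
    rewrite poweR_Lnorm ?gt_eqF// /I -(@fine_integral _ _ _ sigma _ mS Soo _ bgr); last first.
      by move=> x _; exact: powR_ge0.
    rewrite [RHS]integral_mkcond; apply: eq_integral => x _.
    rewrite /= !patchE; case: ifPn => // _.
    by rewrite normr0 powR0// gt_eqF.
  have [t tE] : exists t, @Lp_norm R n r%:E g = t%:E.
    by exists (fine (@Lp_norm R n r%:E g)); rewrite fineK// ge0_fin_numE// (lt_trans Ntau)// ltry.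
  rewrite tE lte_fin in Ntau; rewrite tE lee_fin in N0; rewrite tE poweR_EFin in IE.
  have It : I <= tau `^ r.
    by case: IE => <-; apply: ge0_ler_powR; rewrite ?nnegrE ?(ltW r0) ?(ltW tau0) ?(ltW Ntau).
  have tr0 : 0 < tau `^ r by rewrite powR_gt0.
  apply: (@le_trans _ _ (S (fun x => tau ^+ j * (1 + (tau `^ r)^-1 * `|g x| `^ r)))).
    apply: le_rint => //.
      by apply: bmfunZ; apply: bmfunD; [exact: bmfun_cst|exact: bmfunZ].
    move=> x _; set G := `|g x|.
    have G0 : 0 <= G by exact: normr_ge0.
    rewrite -ler_pdivrMl ?exprn_gt0// -exprVn -exprMn.
    have -> : (tau `^ r)^-1 * G `^ r = (tau^-1 * G) `^ r.
      rewrite powRM ?invr_ge0 ?(ltW tau0)//; congr (_ * _).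
      by rewrite -(powR_inv1 (ltW tau0)) -powRrM mulN1r powRN.
    set z := tau^-1 * G; have z0 : 0 <= z by rewrite mulr_ge0// invr_ge0 ltW.
    have [z1|/ltW z1] := leP z 1.
      by have := exprn_ile1 j z0 z1; have := powR_ge0 z r; lra.
    rewrite -powR_mulrn//; have : z `^ j%:R <= z `^ r by exact: ler_powR.
    lra.
  rewrite rintZ//; last by apply: bmfunD; [exact: bmfun_cst|exact: bmfunZ].
  rewrite rintD//; [|exact: bmfun_cst|exact: bmfunZ].
  rewrite rintZ// rcst mul1r mulrC ler_wpM2r ?exprn_ge0 ?(ltW tau0)//.
  by rewrite lerD2l -/I mulrC ler_pdivrMr// mul1r.
- rewrite /Lp_norm unlock in Ntau.
  (* The norm for [p = +oo] is the essential supremum only on a space of positive measure, and 0 by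
     convention otherwise. *)
  have sT : (0 < sigma [set: T])%E.
    rewrite -surface_measureI setTI.
    rewrite -(fineK (x := sigma sphere)); last by rewrite ge0_fin_numE.
    by rewrite lte_fin -rint_pev1.
  rewrite sT in Ntau.
  have ae := (ess_sup_ge sigma (abse \o (EFin \o (g \_ sphere)))).
  apply: (@le_trans _ _ (S (fun=> tau ^+ j))); last first.
    by rewrite rcst mulrC ler_wpM2r ?exprn_ge0 ?(ltW tau0)// lerDl.
  rewrite -lee_fin -(@fine_integral _ _ _ sigma _ mS Soo _ bgj) => [|x _]; last exact: exprn_ge0.
  have bc : bmfun (@sphere R n.+1) (fun=> tau ^+ j) by exact: bmfun_cst.
  rewrite -(@fine_integral _ _ _ sigma _ mS Soo _ bc) => [|x _]; last exact/exprn_ge0/ltW.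
  apply: ae_ge0_le_integral => //.
  + by apply/measurable_EFinP; exact: bgj.1.
  + by move=> x _; rewrite lee_fin exprn_ge0// ltW.
  + apply: filterS ae => x /= h xS; rewrite lee_fin lerXn2r ?nnegrE ?(ltW tau0)//.
    move: h; rewrite patchE mem_set// => /le_lt_trans/(_ Ntau).
    by rewrite lte_fin => /ltW.
Qed.

End Lp_norms.

(** * Conjugate exponents and the choice of frequency *)

Section exponents.
Context (R : realType).
Implicit Types p : \bar R.

Lemma expo_inv_conjugate p : (1 <= p)%E -> expo_inv (hoelder_conjugate p) = 1 - expo_inv p.
Proof.
move=> p1; have pNy : (-oo < p)%E by rewrite (lt_le_trans _ p1)// ltNyr.
have pn0 : p != 0%E by rewrite gt_eqF// (lt_le_trans _ p1)// lte01.
have := hoelder_conjugate_eq1 pNy pn0; rewrite /expo_inv.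
have : (p^-1)%E \is a fin_num.
  case: p {pNy} p1 pn0 => [r| |]//; rewrite lee_fin => r1 rn0.
  by rewrite inver; move: rn0; rewrite eqe => /negbTE ->.
case: (p^-1)%E => //= x _; case: ((hoelder_conjugate p)^-1)%E => //= y [] xy.
by rewrite -xy; ring.
Qed.

Lemma exists_scale (x : R) : 1 <= x -> exists2 k, x < 2 ^+ k & 2 ^+ k <= 2 * x.
Proof.
move=> x1.
have ex : exists k, x < 2 ^+ k.
  have x0 : 0 <= x by lra.
  exists (Num.bound x); apply: (lt_le_trans (archi_boundP x0)).
  by rewrite -natrX ler_nat ltnW// ltn_expl.
case: (ex_minnP ex) => -[|k] xk kmin; first by move: xk; rewrite expr0; lra.
exists k.+1 => //; rewrite exprS ler_pM2l// leNgt; apply/negP => /kmin.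
by rewrite ltnn.
Qed.

Section phihat_min.
Variables (phihat : nat -> R) (L : int).
Hypothesis phihat0 : forall l, 0 < phihat l.

Lemma phihat_min_le l : (l%:Z <= L)%R -> phihat_min phihat L <= phihat l.
Proof.
move=> lL; apply: ge_inf; last by exists l.
by exists 0 => _ [j _ <-]; exact: ltW.
Qed.

Lemma phihat_min_gt0 : 0 <= L -> 0 < phihat_min phihat L.
Proof.
move=> L0; pose s := [seq phihat l | l <- iota 0 `|L|.+1].
have [|m m0 ms] := @seq_pos_lb R s; first by move=> _ /mapP[l _ ->].
apply: (lt_le_trans m0); apply: lb_le_inf; first by exists (phihat 0%N), 0%N.
move=> _ [l lL <-]; apply: ms; apply: map_f.
by rewrite mem_iota leq0n add0n ltnS -lez_nat gez0_abs.
Qed.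

End phihat_min.

End exponents.

Section scale.
Context (R : realType) (n : nat).
Hypothesis n_gt0 : (0 < n)%N.
Local Notation d := (n.+1%:R : R).

(** With this constant [2 / (c q)] is [128 d^2 / q]: half of it covers the degree
    [d 2^k <= 64 d^2 / q] of the localized kernel, and the rest exceeds [lambda_n <= d] and the
    rounding. *)
Definition freq_cst : R := (64 * d ^+ 2)^-1.

Variable q : R.
Hypotheses (q0 : 0 < q) (q2 : q <= 2).
Local Notation L := (Num.floor (2 / (freq_cst * q) - lambda_ R n)).

(** The dyadic scale has [2^k] of order [d / q]: fine enough for separation [q / 2], yet of degree
    at most [L], with [L] of order [1 / q]. *)
Lemma scale_frequency : exists k, [/\ 16 * d / (q / 2) < 2 ^+ k, 2 ^- k <= q,
  (n.+1 * 2 ^ k <= `|L|)%N, 0 <= L & `|L|.+1%:R <= 130 * d ^+ 2 / q].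
Proof.
have d2 : 2 <= d by rewrite ler_nat ltnS.
have iq : q^-1 * q = 1 by rewrite mulVf// gt_eqF.
have iq2 : 2^-1 <= q^-1 by rewrite lef_pV2 ?posrE.
have iq0 : 0 < q^-1 by rewrite invr_gt0.
have eqx : 16 * d / (q / 2) = 32 * (d * q^-1) by rewrite invf_div; ring.
have dq : d * 2^-1 <= d * q^-1 by rewrite ler_pM2l// ltr0n.
have [k xk kx] : exists2 k, 16 * d / (q / 2) < 2 ^+ k & 2 ^+ k <= 2 * (16 * d / (q / 2)).
  by apply: exists_scale; rewrite eqx; lra.
rewrite eqx in xk kx *.
have E : 2 / (freq_cst * q) = 128 * (d * (d * q^-1)).
  by rewrite /freq_cst; field; rewrite !gt_eqF//; lra.
have ddq : 2 * (d * q^-1) <= d * (d * q^-1) by rewrite ler_pM2r//; lra.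
have qdq : q^-1 <= d * q^-1 by rewrite ler_peMl ?(ltW iq0)//; lra.
have dk : d * 2 ^+ k <= d * (64 * (d * q^-1)) by rewrite ler_pM2l//; lra.
have lam : 0 <= lambda_ R n <= d.
  rewrite /lambda_ -(natr1 n); have : 1 <= n%:R :> R by rewrite ler1n.
  by move=> ?; apply/andP; split; lra.
have ddq' : d <= d * (d * q^-1) by rewrite -[leLHS]mulr1 ler_pM2l; lra.
have LE : (n.+1 * 2 ^ k)%:Z <= L.
  by rewrite floor_ge_int E -pmulrn natrM natrX; lra.
have L0 : 0 <= L by exact: le_trans LE.
exists k; split => //.
- rewrite -[leRHS]invrK lef_pV2 ?posrE ?exprn_gt0//; lra.
- by rewrite -lez_nat gez0_abs.
rewrite -natr1 natr_absz ger0_norm//.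
have := floor_le (2 / (freq_cst * q) - lambda_ R n); rewrite {2}E.
have -> : 130 * d ^+ 2 / q = 130 * (d * (d * q^-1)) by rewrite expr2; ring.
lra.
Qed.

End scale.

(** * Coefficient bounds in the p-norm *)

Section stability.
Context (R : realType) (n : nat).
Hypothesis n_gt0 : (0 < n)%N.
Local Notation T := (n.+1.-tuple R).
Local Notation d := (n.+1%:R : R).
Local Notation S f := (\int[@surface_measure R n]_(x in sphere) f x).
Local Notation S1 := (S (pev 1)).

Variables (phi : R -> R) (phihat : nat -> R).
Hypothesis phiE : @sbf R n phi phihat.
Variables (X : {fset T}) (a : T -> R).
Hypothesis XC : centers X.

Local Notation q := (separation_radius X).
Local Notation L := (Num.floor (2 / (freq_cst R n * q) - lambda_ R n)).
Local Notation fmin := (phihat_min phihat L).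
Local Notation g := (kernel_comb phi X a).
Local Notation A := (Num.sqrt (\sum_(y <- X) a y ^+ 2)).

Definition comb_cst : R := 4 * (2 * 8 ^+ n.+1 * shell_cst R n).
(** The bound of [card_separated] at [delta = q / 2], whence the factor [2 ^+ n]. *)
Definition card_cst : R := 2 ^+ n * (2 * (4 * d + 1) ^+ n.+1).

Let q0 : 0 < q := separation_radius_gt0 XC.
Let q2 : q <= 2 := separation_radius_le2 XC.
Let Xsep := centers_separated XC.
Let S10 : 0 < S1 := surface_sphere_gt0 R n.
Let d0 : 0 < d. Proof. by rewrite ltr0n. Qed.

Lemma fmin_gt0 : 0 < fmin.
Proof.
have [k [_ _ _ L0 _]] := scale_frequency n_gt0 q0 q2.
by apply: phihat_min_gt0 => //; case: phiE.
Qed.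

Let bg : bmfun (@sphere R n.+1) g := bmfun_kernel_comb n_gt0 phiE a Xsep.

Lemma comb_cst_ge0 : 0 <= comb_cst.
Proof. by rewrite /comb_cst /shell_cst; rewrite !mulr_ge0// ?exprn_ge0// ltW. Qed.

Let fminE l : (l <= `|L|)%N -> fmin <= phihat l.
Proof.
have [k [_ _ _ L0 _]] := scale_frequency n_gt0 q0 q2.
move=> lL; apply: phihat_min_le; first by case: phiE.
by rewrite -(gez0_abs L0) lez_nat.
Qed.

Let scaled_comb_le k (z : R) : 0 <= z -> 2 ^- k <= q ->
  4 * (2 * 8 ^+ n.+1 * (shell_cst R n * 2 ^- k ^+ n)) * z <= comb_cst * q ^+ n * z.
Proof.
move=> z0 kq; rewrite ler_wpM2r//.
have -> : 4 * (2 * 8 ^+ n.+1 * (shell_cst R n * 2 ^- k ^+ n)) = comb_cst * (2 ^- k) ^+ n :> R.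
  by rewrite /comb_cst; ring.
by rewrite ler_wpM2l ?comb_cst_ge0// lerXn2r// nnegrE ?(ltW q0)// invr_ge0 exprn_ge0.
Qed.

Lemma coef_L2_bound : (fmin * A) ^+ 2 <= comb_cst * q ^+ n * S (fun x => `|g x| ^+ 2).
Proof.
have [k [kd kq kL L0 Lq]] := scale_frequency n_gt0 q0 q2.
rewrite exprMn sqr_sqrtr; last by apply: sumr_ge0 => y _; exact: sqr_ge0.
apply: le_trans (scaled_comb_le _ kq); last by apply: rint_ge0 => x _; exact: sqr_ge0.
rewrite (eq_rint _ (g := fun x => g x ^+ 2)) => [|x _]; last by rewrite real_normK ?num_real.
by apply: (stability_L2 n_gt0 phiE a Xsep _ kd kL fmin_gt0 fminE); rewrite divr_gt0.
Qed.

(** The factor [q^n] from the localized kernel cancels [L^n] from the diagonal of the reproducing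
    kernel, so no power of [q] is left. *)
Lemma coef_L1_bound : (fmin * A) ^+ 2 <=
  comb_cst * (2 * (130 * d ^+ 2) ^+ n / S1) * S (fun x => `|g x|) ^+ 2.
Proof.
have [k [kd kq kL L0 Lq]] := scale_frequency n_gt0 q0 q2.
rewrite exprMn sqr_sqrtr; last by apply: sumr_ge0 => y _; exact: sqr_ge0.
apply: le_trans (stability_L1 n_gt0 phiE a Xsep _ kd kL fmin_gt0 fminE) _.
  by rewrite divr_gt0.
rewrite -mulrA; apply: le_trans (scaled_comb_le _ kq) _.
  by rewrite mulr_ge0 ?sqr_ge0// divr_ge0 ?(ltW S10)// mulr_ge0// exprn_ge0.
rewrite mulrA ler_wpM2r ?sqr_ge0// -mulrA ler_wpM2l ?comb_cst_ge0//.
rewrite [leLHS]mulrA ler_wpM2r ?invr_ge0 ?(ltW S10)//.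
rewrite [leLHS]mulrCA ler_wpM2l// -exprMn.
have qL0 : 0 <= q * `|L|.+1%:R by exact: mulr_ge0 (ltW q0) (ler0n _ _).
have qL : q * `|L|.+1%:R <= 130 * d ^+ 2 by rewrite mulrC -ler_pdivlMr.
by rewrite lerXn2r// nnegrE (le_trans qL0 qL).
Qed.

Definition ge2_cst : R := Num.sqrt (comb_cst * (S1 + 1)) * 2 ^+ n.
Definition le2_cst : R := 2 * card_cst *
  (Num.sqrt (comb_cst * (2 * (130 * d ^+ 2) ^+ n / S1)) * (S1 + 1)).

Let sqr_le_mul (D x y : R) : 0 <= D -> 0 <= y -> x ^+ 2 <= D * y ^+ 2 -> x <= Num.sqrt D * y.
Proof.
move=> D0 y0 xy; apply: le_trans (ler_norm x) _.
rewrite -sqrtr_sqr -[leRHS](_ : Num.sqrt (D * y ^+ 2) = _); first exact: ler_wsqrtr.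
by rewrite sqrtrM// sqrtr_sqr ger0_norm.
Qed.

Variables (p : \bar R) (tau : R).
Hypotheses (p1 : (1 <= p)%E) (Ntau : (Lp_norm p g < tau%:E)%E).
Local Notation u := (expo_inv p).

Let tau0 : 0 < tau.
Proof. by rewrite -lte_fin (le_lt_trans _ Ntau)//; exact: Lnorm_ge0. Qed.

Lemma lp_norm_ge2 : (2%:E <= p)%E ->
  fmin * lp_norm p X a <= ge2_cst * q `^ (n%:R * (1 / 2 - u)) * tau.
Proof.
move=> p2.
have u0 : 0 <= u <= 1.
  rewrite /expo_inv; case: p p2 => [r| |]//=; rewrite ?lexx ?ler01// lee_fin => r2.
  by rewrite inver gt_eqF/=; first (by rewrite invr_ge0 invf_le1; lra); lra.
have lpA : lp_norm p X a <= A.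
  case: p p2 => [r| |]//=; first by rewrite lee_fin => ?; exact: sum_powR_ge2.
  move=> _; rewrite big_seq; apply: bigmax_le => [|y yX]; first exact: sqrtr_ge0.
  by rewrite -sqrtr_sqr ler_wsqrtr// sqr_le_sum.
apply: le_trans (_ : fmin * A <= _); first by rewrite ler_pM2l// fmin_gt0.
have D0 : 0 <= comb_cst * (S1 + 1) by rewrite mulr_ge0 ?comb_cst_ge0// addr_ge0// ltW.
pose Q := q `^ (n%:R / 2).
have Q0 : 0 <= Q by exact: powR_ge0.
have QQ : Q ^+ 2 = q ^+ n.
  by rewrite -powR_mulrn// -powRrM divfK// powR_mulrn// ltW.
have : fmin * A <= Num.sqrt (comb_cst * (S1 + 1)) * (Q * tau).
  apply: sqr_le_mul => //; first by rewrite mulr_ge0// ltW.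
  apply: le_trans coef_L2_bound _.
  rewrite [X in _ <= _ * X]exprMn QQ -mulrA -[leRHS]mulrA ler_wpM2l ?comb_cst_ge0//.
  rewrite [leRHS]mulrCA ler_pM2l ?exprn_gt0//.
  exact: Lp_norm_bound bg (isT : (0 < 2)%N) p2 Ntau.
move=> /le_trans; apply; rewrite /ge2_cst -!mulrA ler_wpM2l ?sqrtr_ge0//.
rewrite mulrA ler_wpM2r ?(ltW tau0)//.
(* The first factor has an exponent between 0 and [n], so it is at most [2 ^+ n] as [q <= 2]; this
   holds uniformly in [p]. *)
have -> : Q = q `^ (n%:R * u) * q `^ (n%:R * (1 / 2 - u)).
  rewrite -powRD; first by congr (_ `^ _); ring.
  by apply/implyP => _; rewrite gt_eqF.
rewrite ler_wpM2r ?powR_ge0//.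
case/andP: u0 => u0 u1.
apply: (@le_trans _ _ (2 `^ (n%:R * u))).
  have nu0 : 0 <= n%:R * u by exact: mulr_ge0.
  by apply: ge0_ler_powR => //; rewrite nnegrE ltW.
rewrite -powR_mulrn//; apply: ler_powR; first by rewrite ler1n.
by rewrite ler_piMr.
Qed.

Lemma lp_norm_le2 : (p <= 2%:E)%E ->
  fmin * lp_norm p X a <= le2_cst * q `^ (n%:R * (1 / 2 - u)) * tau.
Proof.
case: p p1 Ntau => [r| |]//; rewrite !lee_fin => r1 Nr r2.
have r0 : 0 < r by lra.
have uE : expo_inv r%:E = r^-1 by rewrite /expo_inv inver gt_eqF.
rewrite uE /=; set v := r^-1.
have v1 : 1 / 2 <= v <= 1.
  by rewrite div1r /v lef_pV2 ?posrE// r2 invf_le1.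
have X0 : (0 < size X)%N by case: (XC) => /ltnW.
have r12 : 1 <= r <= 2 by rewrite r1 r2.
have := @sum_powR_le2 _ _ X a r r12 X0.
rewrite -/v => lpA.
set m : R := (size X)%:R in lpA.
have m0 : 0 < m by rewrite ltr0n.
have c1 : 1 <= card_cst.
  rewrite /card_cst -[leLHS]mulr1 ler_pM ?exprn_ege1//; first by rewrite ler1n.
  rewrite -[leLHS]mulr1 ler_pM ?exprn_ege1 ?ler1n//.
  by rewrite lerDr mulr_ge0// ltW.
have mc : m <= card_cst / q ^+ n.
  rewrite ler_pdivlMr ?exprn_gt0// /card_cst -ler_pdivrMl ?exprn_gt0// mulrC -mulrA -exprVn -exprMn.
  apply: card_separated Xsep _; first by rewrite divr_gt0.
  by rewrite ler_pdivrMr// mul1r.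
(* The exponent lies in [[0, 1/2]] and [card_cst >= 1], so the power of the constant is at most the
   constant itself, uniformly in [p]. *)
have mv : m `^ (v - 2^-1) <= card_cst * q `^ (n%:R * (1 / 2 - v)).
  apply: (@le_trans _ _ ((card_cst / q ^+ n) `^ (v - 2^-1))).
    by apply: ge0_ler_powR; rewrite ?nnegrE ?(le_trans (ltW m0) mc) ?(ltW m0)//; lra.
  rewrite powRM ?invr_ge0 ?exprn_ge0 ?(ltW q0)//; last by lra.
  have -> : (q ^+ n)^-1 `^ (v - 2^-1) = q `^ (n%:R * (1 / 2 - v)).
    rewrite -(powR_mulrn _ (ltW q0)) -powRN -powRrM; congr (_ `^ _); lra.
  rewrite ler_wpM2r ?powR_ge0//.
  by rewrite -[leRHS]powRr1; [apply: ler_powR => //; lra|lra].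
have c0 : 0 <= card_cst by lra.
have D0 : 0 <= comb_cst * (2 * (130 * d ^+ 2) ^+ n / S1).
  by rewrite mulr_ge0 ?comb_cst_ge0// divr_ge0 ?(ltW S10)// mulr_ge0//.
have fA : fmin * A <= Num.sqrt (comb_cst * (2 * (130 * d ^+ 2) ^+ n / S1)) * ((S1 + 1) * tau).
  apply: sqr_le_mul => //; first by rewrite mulr_ge0 ?addr_ge0 ?(ltW tau0)// ltW.
  apply: le_trans coef_L1_bound _; rewrite ler_wpM2l//.
  rewrite lerXn2r ?nnegrE//.
  - by apply: rint_ge0 => x _; exact: normr_ge0.
  - by rewrite mulr_ge0 ?addr_ge0 ?(ltW tau0)// ltW.
  - by have := Lp_norm_bound bg (isT : (0 < 1)%N) (_ : (1%:E <= r%:E)%E) Nr; rewrite expr1; apply.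
apply: (@le_trans _ _ (fmin * (2 * (card_cst * q `^ (n%:R * (1 / 2 - v))) * A))).
  rewrite ler_pM2l ?fmin_gt0//; apply: le_trans lpA _.
  by rewrite ler_wpM2r ?sqrtr_ge0// ler_pM2l.
have -> z : fmin * (2 * (card_cst * z) * A) = 2 * card_cst * z * (fmin * A) by ring.
rewrite /le2_cst.
have -> (x1 x2 x3 z : R) : x1 * (x2 * x3) * z * tau = x1 * z * (x2 * (x3 * tau)) by ring.
by rewrite ler_wpM2l// !mulr_ge0 ?powR_ge0.
Qed.

End stability.

(** * From coefficient bounds to the stability ratio *)

Section stability_ratio.
Context (R : realType) (n : nat).
Variables (p : \bar R) (phi : R -> R) (X : {fset n.+1.-tuple R}).

Lemma lp_norm_ge0 a : 0 <= lp_norm p X a.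
Proof. by case: p => [r| |] /=; rewrite ?powR_ge0// bigmax_ge_id. Qed.

(** A strict upper bound [tau] is positive even when the norm is 0, so one may divide by it; letting
    it decrease to the norm gives the bound. A zero norm forces zero coefficients, and an infinite
    one makes the quotient 0. *)
Lemma stability_ratio_le (W : R) : 0 <= W ->
  (forall a (tau : R), (Lp_norm p (kernel_comb phi X a) < tau%:E)%E -> lp_norm p X a <= W * tau) ->
  (stability_ratio p phi X <= W%:E)%E.
Proof.
move=> W0 H; apply: ge_ereal_sup => _ [a _ <-].
have := Lnorm_ge0 (@surface_measure R n) p (EFin \o ((kernel_comb phi X a) \_ sphere)).
rewrite -/(Lp_norm _ _); move: (H a); case: (Lp_norm _ _) => [t| |] // {}H.
  rewrite lee_fin => t0.
  have lpt : lp_norm p X a <= W * t.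
    apply/ler_addgt0Pr => e e0.
    have e1 : 0 < e / (W + 1) by rewrite divr_gt0//; lra.
    apply: (le_trans (H (t + e / (W + 1)) _)); first by rewrite lte_fin; lra.
    rewrite mulrDr lerD2l mulrCA ler_piMr ?(ltW e0)// ler_pdivrMr ?mul1r; lra.
  have [t00|tn0] := eqVneq t 0.
    have -> : lp_norm p X a = 0.
      by apply/eqP; rewrite eq_le lp_norm_ge0 andbT (le_trans lpt)// t00 mulr0.
    by rewrite mul0e.
  rewrite inver (negbTE tn0) -EFinM lee_fin ler_pdivrMr//.
  by rewrite lt_def tn0.
by rewrite invey mule0.
Qed.

End stability_ratio.

Theorem theorem5p7 (R : realType) (n k : nat) (kappa : R -> R)
    (n_ge1 : (1 <= n)%N) (k_ge : (n + 2 <= k)%N)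
    (kappaCk : Ck k kappa)
    (kappa_even : forall x, kappa (- x) = kappa x)
    (kappa_neq0 : exists x, kappa x != 0)
    (kappa_01 : forall x, 0 <= kappa x <= 1)
    (kappa_supp : closure [set x | kappa x != 0] `<=` `[-2, 2]) :
  exists C c : R, [/\ 0 < C, 0 < c &
    forall (phi : R -> R) (phihat : nat -> R),
      sbf n phi phihat -> smooth_zonal n phi ->
    forall p : \bar R, (1 <= p)%E ->
    forall X : {fset n.+1.-tuple R}, centers X ->
      let p' := hoelder_conjugate p in
      let q := separation_radius X in
      let rho := mesh_ratio X in
      let L := Num.floor (2 / (c * q) - lambda_ R n) in
      (stability_ratio p phi X <=
        (C * rho `^ (n%:R * expo_inv p) *
         (q `^ (n%:R * (expo_inv p' - 1 / 2)) / phihat_min phihat L))%:E)%E].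
Proof.
pose K := ge2_cst R n + le2_cst R n + 1.
have ge20 : 0 <= ge2_cst R n by rewrite mulr_ge0 ?sqrtr_ge0 ?exprn_ge0.
have S10 := surface_sphere_gt0 R n.
have le20 : 0 <= le2_cst R n.
  rewrite /le2_cst /card_cst !mulr_ge0 ?sqrtr_ge0 ?exprn_ge0 ?addr_ge0 ?mulr_ge0//.
  exact: ltW.
have K0 : 0 < K by rewrite /K; lra.
exists (4 ^+ n * K), (freq_cst R n); split.
- by rewrite mulr_gt0 ?exprn_gt0.
- by rewrite invr_gt0 mulr_gt0 ?exprn_gt0 ?ltr0n.
move=> phi phihat phiE _ p p1 X XC /=; rewrite expo_inv_conjugate//.
set q := separation_radius X; set rho := mesh_ratio X; set L := Num.floor _; set u := expo_inv p.
have fmin0 : 0 < phihat_min phihat L := fmin_gt0 n_ge1 phiE XC.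
set fmin := phihat_min phihat L in fmin0 *.
have u01 : 0 <= u <= 1.
  rewrite /u /expo_inv; case: p p1 {u} => [r| |]//=; rewrite ?lexx ?ler01// lee_fin => r1.
  by rewrite inver gt_eqF/=; [rewrite invr_ge0 invf_le1; lra|lra].
(* From [rho >= 1/4] and [0 <= u <= 1]; this allows the power of the mesh ratio to be inserted at
   the cost of [4 ^+ n]. *)
have rho1 : 1 <= 4 ^+ n * rho `^ (n%:R * u).
  have r4 : 4^-1 `^ n%:R <= rho `^ (n%:R * u).
    have nu : n%:R * u <= n%:R :> R by rewrite ler_piMr//; case/andP: u01.
    apply: (@le_trans _ _ (4^-1 `^ (n%:R * u))).
      by apply: ger_powR => //; rewrite invr_gt0 invf_le1// ltr0n ler1n.
    have nu0 : 0 <= n%:R * u by rewrite mulr_ge0//; case/andP: u01.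
    have := mesh_ratio_ge n_ge1 XC; rewrite -/rho => h.
    by apply: ge0_ler_powR => //; rewrite nnegrE ?(le_trans _ h)// invr_ge0.
  apply: le_trans (_ : 4 ^+ n * 4^-1 `^ n%:R <= _); last by rewrite ler_pM2l ?exprn_gt0.
  by rewrite powR_mulrn ?invr_ge0// -exprMn divff// expr1n.
set Q := q `^ _.
have Q0 : 0 <= Q by exact: powR_ge0.
apply: stability_ratio_le.
  by rewrite !mulr_ge0 ?powR_ge0 ?exprn_ge0 ?invr_ge0 ?(ltW fmin0) ?(ltW K0).
move=> a tau Ntau.
have tau0 : 0 < tau by rewrite -lte_fin (le_lt_trans _ Ntau)//; exact: Lnorm_ge0.
(* As [1/p' = 1 - u], the exponent [1/p' - 1/2] is the [1/2 - u] of the two coefficient bounds. *)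
have QE : Q = q `^ (n%:R * (1 / 2 - u)) by congr (_ `^ _); lra.
have lpK : fmin * lp_norm p X a <= K * Q * tau.
  have KQ z : z <= K -> z * Q * tau <= K * Q * tau.
    by move=> zK; rewrite ler_wpM2r ?(ltW tau0)// ler_wpM2r.
  have [p2|/ltW p2] := leP p 2%:E.
  - have := lp_norm_le2 n_ge1 phiE XC p1 Ntau p2.
    rewrite -/q -/L -/fmin -/u -QE => /le_trans; apply; apply: KQ; rewrite /K; lra.
  - have := lp_norm_ge2 n_ge1 phiE XC Ntau p2.
    rewrite -/q -/L -/fmin -/u -QE => /le_trans; apply; apply: KQ; rewrite /K; lra.
rewrite -(ler_pM2l fmin0); apply: le_trans lpK _.
have -> : fmin * (4 ^+ n * K * rho `^ (n%:R * u) * (Q / fmin) * tau) =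
    (4 ^+ n * rho `^ (n%:R * u)) * (K * Q * tau) by field; rewrite gt_eqF.
by rewrite ler_peMl// !mulr_ge0 ?(ltW K0) ?(ltW tau0).
Qed.
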